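(* Let $d\in\mathbb{N}$, let $\Omega\subset\mathbb{C}^d$ be a non-empty open set, and let $L:\mathcal{H}(\Omega)\to\mathcal{H}(\Omega)$ be a bounded linear operator. Then: (i) There exist a sequence $\{s_k\}$ of positive numbers belonging to $\mathcal{E}(1/d)$, an equicontinuous sequence $\{f_k'\}$ in the topological dual $\mathcal{H}(\Omega)'$ of $\mathcal{H}(\Omega)$, and a bounded sequence $\{f_k\}$ in $\mathcal{H}(\Omega)$, such that $L$ can be written $$Lf=\sum_k s_k\langle f,f_k'\rangle f_k\quad\text{for all }f\in\mathcal{H}(\Omega).$$ (ii) $\lambda(L)\in\mathcal{E}(1/d)$.
   Context: $\mathcal{H}(\Omega)$ is the Fréchet space of holomorphic functions $f:\Omega\to\mathbb{C}$ with the topology of uniform convergence on compact subsets of $\Omega$. A subset $S$ of a topological vector space $E$ is bounded if for each neighbourhood $U$ of $0$ we have $S\subset\alpha U$ for some $\alpha>0$. A linear operator $L:E\to E$ is called bounded if it takes some neighbourhood of $0$ into a bounded set. $\langle f,f'\rangle$ denotes the evaluation of $f'\in\mathcal{H}(\Omega)'$ at $f\in\mathcal{H}(\Omega)$. $\lambda(L)=\{\lambda_n(L)\}_{n\ge1}$ is the sequence of eigenvalues of $L$, each repeated according to its algebraic multiplicity, ordered by decreasing modulus (padded by zeros if there are only finitely many nonzero eigenvalues). For $a,\alpha>0$, $\mathcal{E}(a,\alpha)$ is the set of complex sequences $x=(x_n)_{n\in\mathbb{N}}$ with $\sup_{n\in\mathbb{N}}|x_n|\exp(an^\alpha)<\infty$,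 and $\mathcal{E}(\alpha):=\bigcup_{a>0}\mathcal{E}(a,\alpha)$. $\mathbb{N}$ is the set of strictly positive integers. *)

(* Defs.v *)
From HB Require Import structures.
From mathcomp Require Import all_boot all_order all_algebra.
From mathcomp Require Import all_classical all_reals all_analysis.
From mathcomp Require Import complex.

Set Implicit Arguments.
Unset Strict Implicit.
Unset Printing Implicit Defensive.

Import Order.TTheory GRing.Theory Num.Theory.
Import numFieldNormedType.Exports.

Local Open Scope classical_set_scope.
Local Open Scope ring_scope.
Local Open Scope complex_scope.

HB.instance Definition _ (R : realType) := NormedModule.copy R[i] (R[i])^o.

Section holomorphic_functions.
Context {R : realType} {d : nat}.
Implicit Types Omega : set 'rV[R[i]]_d.

(* Complex (Frechet) differentiability at each point of Omega. The function
   valL_ 0 f is the extension of f by 0; when Omega is open, its values outside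
   Omega do not affect differentiability at a point of Omega. *)
Definition holomorphic Omega : set (Omega -> R[i]) :=
  [set f | forall z, Omega z -> differentiable (valL_ 0 f) z].

Definition holo_pred Omega : {pred Omega -> R[i]} := mem (@holomorphic Omega).

Record holo Omega := Holo {
  holo_fun :> Omega -> R[i];
  _ : holo_fun \in @holo_pred Omega }.

HB.instance Definition _ Omega := [isSub for @holo_fun Omega].
HB.instance Definition _ Omega := [Choice of holo Omega by <:].

Lemma holomorphic_submod_closed Omega :
  submod_closed (@holo_pred Omega).
Proof.
split=> [|a f g /set_mem hf /set_mem hg]; apply/mem_set => z Oz.
  rewrite (_ : valL_ 0 _ = cst 0); first exact: differentiable_cst.
  by apply/funext => x /=; case: ('oinv_set_val x).
rewrite (_ : valL_ 0 _ = a *: valL_ 0 f + valL_ 0 g); last first.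
  apply/funext => x /=; rewrite !fctE /=.
  by case: ('oinv_set_val x) => //=; rewrite scaler0 addr0.
by apply: differentiableD; [apply: differentiableZ; exact: hf|exact: hg].
Qed.

HB.instance Definition _ Omega :=
  GRing.isSubmodClosed.Build R[i] (Omega -> R[i]) (@holo_pred Omega)
    (holomorphic_submod_closed Omega).
HB.instance Definition _ Omega :=
  [SubChoice_isSubLmodule of holo Omega by <:].

(* Uniform convergence on the compact subsets of Omega. *)
HB.instance Definition _ Omega := Uniform.copy (holo Omega)
  (initial_topology
    (@holo_fun Omega : holo Omega -> {family compact, Omega -> R[i]})).

End holomorphic_functions.

Section topological_vector_spaces.
Context {K : numFieldType} {E : preTopologicalLmodType K}.

(* For K = R[i], 0 < alpha says that alpha is a positive real number. *)
Definition tvs_bounded (S : set E) :=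
  forall U : set E, nbhs 0 U ->
    exists2 alpha : K, 0 < alpha & S `<=` [set alpha *: u | u in U].

End topological_vector_spaces.

Section operators.
Context {K : numFieldType} {E : preTopologicalLmodType K}.

Definition bounded_operator (L : E -> E) :=
  exists2 U : set E, nbhs 0 U & tvs_bounded (L @` U).

End operators.

Section eigenvalues.
Context {K : numFieldType} {E : lmodType K}.
Implicit Types (L : {linear E -> E}) (z : K).

Definition op_eigenvalue L z := exists2 f : E, f != 0 & L f = z *: f.

Definition generalized_eigenspace L z : set E :=
  [set f | exists n, iter n (fun g => L g - z *: g) f = 0].

Definition has_dimension (V : set E) (m : nat) :=
  exists2 phi : {linear 'rV[K]_m -> E}, injective phi & range phi = V.

Definition algebraic_multiplicity L z (m : nat) :=
  has_dimension (generalized_eigenspace L z) m.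

(* lam lists the nonzero eigenvalues of L by decreasing modulus, each as often
   as its algebraic multiplicity, and is padded by zeros if there are only
   finitely many of them. Ties in modulus may be broken arbitrarily, so lam is
   not determined by L, whereas the sequence of moduli is. *)
Definition eigenvalue_sequence L (lam : nat -> K) :=
  [/\ forall n, `|lam n.+1| <= `|lam n|,
      forall n, lam n != 0 -> op_eigenvalue L (lam n) &
      forall z, z != 0 -> op_eigenvalue L z ->
        exists2 m, algebraic_multiplicity L z m &
          ([set n | lam n = z] #= `I_m)%card].

End eigenvalues.

Section exponential_classes.
Context {R : realType}.

(* Sequences are indexed from 0 here, so that x n stands for x_{n+1}. *)
Definition exp_class_at (a alpha : R) : set (nat -> R[i]) :=
  [set x | (ereal_sup (range (fun n =>
     (ComplexField.Normc.normc (x n) * expR (a * n.+1%:R `^ alpha))%:E))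
     < +oo)%E].

Definition exp_class (alpha : R) : set (nat -> R[i]) :=
  \bigcup_(a in [set a | 0 < a]) exp_class_at a alpha.

End exponential_classes.

(* Main.v *)
Require Import Defs.
From HB Require Import structures.
From mathcomp Require Import all_boot all_order all_algebra.
From mathcomp Require Import all_classical all_reals all_analysis.
From mathcomp Require Import complex perm.
From mathcomp Require Import ring lra zify.

Set Implicit Arguments.
Unset Strict Implicit.
Unset Printing Implicit Defensive.

Import Order.TTheory GRing.Theory Num.Theory.
Import numFieldNormedType.Exports.

Local Open Scope classical_set_scope.
Local Open Scope ring_scope.
Local Open Scope complex_scope.

Local Notation normc := ComplexField.Normc.normc.
Local Notation Re := complex.Re.
Local Notation Im := complex.Im.

(** A bounded operator L is controlled by the supremum of |f| over a single compact
    set K. Cover K by finitely many small polysquares with larger concentric ones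
    inside Omega. Newton interpolation in each variable expands f on a small
    polysquare as the sum over multi-indices al of (divided difference) * (product
    of factors z_j - node); by Cauchy's formula both are exponentially small in the
    order of al after rescaling. There are O(N^d) multi-indices with entries below
    N, so enumerating all the rescaled divided differences as x_0, x_1, ... gives
    the Hilbert seminorm p(f)^2 = sum_n |x_n f|^2 with
      sup_K |f| <= C exp(-a n^(1/d)) p(f)  as soon as  x_m f = 0 for all m < n.
    (i) Choose e_n among the f with x_m f = 0 for m < n, almost minimizing p under
    x_n f = 1. Since p is Hilbertian, the e_n are almost orthogonal: the triangular
    expansion f = sum_n c_n(f) e_n has bounded coefficients and remainders, and
    L f = sum_n c_n(f) L e_n with L e_n = O(exp(-a n^(1/d))).
    (ii) On a finite-dimensional invariant subspace spanned by generalized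
    eigenvectors, the same construction gives a basis in which the i-th row of the
    matrix of L is O(exp(-a i^(1/d))). Leibniz' formula bounds its determinant,
    which is the product of the eigenvalues, by n! C^n exp(-a sum_i i^(1/d)); the
    factorial is harmless after taking n-th roots. *)

(** Squares replace circles because their sides are segments, where bisection and real integrals
    apply directly; the value 2 pi i is then never computed, a lower bound for the modulus of the
    integral of the Cauchy kernel being enough. Newton interpolation is preferred to Taylor
    expansion because its coefficients are finite combinations of point values: they are linear on
    all functions, involve no derivative, and are estimated by testing them on Cauchy kernels. The
    Hilbert form of the seminorm matters because eliminating one coordinate after another in a sup
    norm could cost a constant factor at every step, whereas a convexity identity reduces the loss
    at step n to the factor 1 - 1/(n+2)^2. No spectral theory of compact operators is presupposed:
    finite multiplicities, the existence of an ordered list of eigenvalues and its decay all come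
    from one inequality for the product of the eigenvalues of a finite triangular system. *)

Section modulus.
Context {R : realType}.
Implicit Types x y z : R[i].

Lemma normcEC z : `|z| = (normc z)%:C.
Proof. by case: z. Qed.

Lemma normc_ge0 z : 0 <= normc z.
Proof. by case: z => a b; exact: sqrtr_ge0. Qed.

Lemma normc_le_ReIm z : normc z <= `|Re z| + `|Im z|.
Proof.
case: z => a b /=; rewrite -[leRHS]ger0_norm ?addr_ge0// -sqrtr_sqr.
apply: ler_wsqrtr; rewrite sqrrD !real_normK ?num_real// lerD2r lerDl.
by rewrite mulrn_wge0// mulr_ge0.
Qed.

Lemma ler_Re_normc z : `|Re z| <= normc z.
Proof.
by case: z => a b /=; rewrite -sqrtr_sqr; apply: ler_wsqrtr; rewrite lerDl sqr_ge0.
Qed.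

Lemma ler_Im_normc z : `|Im z| <= normc z.
Proof.
by case: z => a b /=; rewrite -sqrtr_sqr; apply: ler_wsqrtr; rewrite lerDr sqr_ge0.
Qed.

Lemma ler_normcD x y : normc (x + y) <= normc x + normc y.
Proof. exact: le_normcD. Qed.

Lemma normcB x y : normc (x - y) = normc (y - x).
Proof. by rewrite -normcN opprB. Qed.

Lemma ler_normcB x y : normc (x - y) <= normc x + normc y.
Proof. by rewrite (le_trans (ler_normcD _ _))// normcN. Qed.

Lemma ler_normc_sum I (r : seq I) (P : pred I) (F : I -> R[i]) :
  normc (\sum_(i <- r | P i) F i) <= \sum_(i <- r | P i) normc (F i).
Proof.
elim/big_rec2: _ => [|i b a _ ab]; first by rewrite ComplexField.Normc.normc0.
by rewrite (le_trans (ler_normcD _ _))// lerD2l.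
Qed.

Lemma normcM x y : normc (x * y) = normc x * normc y.
Proof. exact: ComplexField.Normc.normcM. Qed.

Lemma normcV x : normc x^-1 = (normc x)^-1.
Proof. exact: ComplexField.Normc.normcV. Qed.

Lemma normcR (a : R) : normc a%:C = `|a|.
Proof. by rewrite /= expr0n addr0 sqrtr_sqr. Qed.

Lemma normcX x n : normc (x ^+ n) = normc x ^+ n.
Proof.
elim: n => [|n IH]; first by rewrite !expr0 ComplexField.Normc.normc1.
by rewrite !exprS normcM IH.
Qed.

Lemma normc_prod I (r : seq I) (P : pred I) (F : I -> R[i]) :
  normc (\prod_(i <- r | P i) F i) = \prod_(i <- r | P i) normc (F i).
Proof.
elim/big_rec2: _ => [|i b a _ ab]; first by rewrite ComplexField.Normc.normc1.
by rewrite normcM ab.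
Qed.

Lemma normc_eq0 x : (normc x == 0) = (x == 0).
Proof.
apply/eqP/eqP => [/ComplexField.Normc.eq0_normc//|->].
exact: ComplexField.Normc.normc0.
Qed.

Lemma normc_gt0 x : (0 < normc x) = (x != 0).
Proof. by rewrite lt0r normc_eq0 normc_ge0 andbT. Qed.

End modulus.

(** * Cauchy's formula on squares *)

Section complex_integral.
Context {R : realType}.
Implicit Types (a b : R) (phi psi : R -> R[i]).
Local Notation mu := (@lebesgue_measure R).

Definition cint a b phi : R[i] :=
  (\int[mu]_(t in `[a, b]) Re (phi t)) +i* (\int[mu]_(t in `[a, b]) Im (phi t)).

(** Phrased with the real-valued [normc], as the norm of [R[i]] takes its values in [R[i]]. *)
Definition ccont phi (t : R) := forall e, 0 < e ->
  exists2 d, 0 < d & forall u, `|u - t| < d -> normc (phi u - phi t) < e.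

Definition ccont_on a b phi := forall t, a <= t <= b -> ccont phi t.

Lemma ccontRe phi t : ccont phi t -> {for t, continuous (fun u => Re (phi u) : R^o)}.
Proof.
move=> h; apply/cvgrPdist_lt => e /h[d d0 hd]; apply/nbhs_ballP; exists d => //= u.
rewrite /ball/= distrC => /hd ud.
by rewrite distrC -raddfB (le_lt_trans (ler_Re_normc _)).
Qed.

Lemma ccontIm phi t : ccont phi t -> {for t, continuous (fun u => Im (phi u) : R^o)}.
Proof.
move=> h; apply/cvgrPdist_lt => e /h[d d0 hd]; apply/nbhs_ballP; exists d => //= u.
rewrite /ball/= distrC => /hd ud.
by rewrite distrC -raddfB (le_lt_trans (ler_Im_normc _)).
Qed.

Lemma ccont_on_integrable (f : R -> R) a b :
  (forall t, a <= t <= b -> {for t, continuous (f : R -> R^o)}) ->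
  mu.-integrable `[a, b] (EFin \o f).
Proof.
move=> h; apply: continuous_compact_integrable; first exact: segment_compact.
by apply: continuous_in_subspaceT => t; rewrite inE/= in_itv/=; exact: h.
Qed.

Lemma ccont_onRe phi a b : ccont_on a b phi ->
  mu.-integrable `[a, b] (EFin \o (fun t => Re (phi t))).
Proof. by move=> h; apply: ccont_on_integrable => t /h/ccontRe. Qed.

Lemma ccont_onIm phi a b : ccont_on a b phi ->
  mu.-integrable `[a, b] (EFin \o (fun t => Im (phi t))).
Proof. by move=> h; apply: ccont_on_integrable => t /h/ccontIm. Qed.

Lemma eq_cint a b phi psi : (forall t, a <= t <= b -> phi t = psi t) ->
  cint a b phi = cint a b psi.
Proof.
move=> h; congr (_ +i* _); apply: eq_Rintegral => t; rewrite inE/= in_itv/= => tab;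
  by rewrite h.
Qed.

Lemma cintD a b phi psi : ccont_on a b phi -> ccont_on a b psi ->
  cint a b (fun t => phi t + psi t) = cint a b phi + cint a b psi.
Proof.
move=> h k; rewrite /cint.
under eq_Rintegral do rewrite raddfD/=.
under [X in _ +i* X]eq_Rintegral do rewrite raddfD/=.
rewrite !RintegralD//; by [apply: ccont_onRe|apply: ccont_onIm].
Qed.

Lemma cintZ a b (c : R[i]) phi : ccont_on a b phi ->
  cint a b (fun t => c * phi t) = c * cint a b phi.
Proof.
case: c => c d h; rewrite /cint.
have hR := ccont_onRe h; have hI := ccont_onIm h.
have iZ (f : R -> R) (k : R) : mu.-integrable `[a, b] (EFin \o f) ->
  mu.-integrable `[a, b] (EFin \o (fun t => k * f t)).
  by move=> hf; apply: eq_integrable (integrableZl _ k hf).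
rewrite [X in X +i* _](_ : _ =
  \int[mu]_(t in `[a, b]) (c * Re (phi t) - d * Im (phi t))); last first.
  by apply: eq_Rintegral => t _; case: (phi t).
rewrite RintegralB//; [|exact: iZ|exact: iZ].
rewrite [X in _ +i* X](_ : _ =
  \int[mu]_(t in `[a, b]) (c * Im (phi t) + d * Re (phi t))); last first.
  by apply: eq_Rintegral => t _; case: (phi t).
rewrite RintegralD//; [|exact: iZ|exact: iZ].
by rewrite !RintegralZl.
Qed.

Lemma rint_cst a b (c : R) : a <= b ->
  \int[mu]_(t in `[a, b]) (cst c t) = c * (b - a).
Proof.
move=> ab; rewrite Rintegral_cst//= lebesgue_measure_itv/= lte_fin.
congr (_ * _); case: ltP => // ba /=; apply/esym/eqP.
by rewrite subr_eq0 eq_le ab ba.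
Qed.

Lemma cint_cst a b (c : R[i]) : a <= b -> cint a b (fun=> c) = c * (b - a)%:C.
Proof.
case: c => c d ab; rewrite /cint /= !rint_cst//.
by apply/eqP; rewrite eq_complex /= !mulr0 subr0 add0r !eqxx.
Qed.

Lemma cint_split a c b phi : a <= c <= b -> ccont_on a b phi ->
  cint a b phi = cint a c phi + cint c b phi.
Proof.
move=> /andP[ac cb] h; rewrite /cint.
have key (f : R -> R) : mu.-integrable `[a, b] (EFin \o f) ->
    \int[mu]_(t in `[a, b]) f t =
    \int[mu]_(t in `[a, c]) f t + \int[mu]_(t in `[c, b]) f t.
  move=> hf; have := Rintegral_itvB (x := c) hf.
  rewrite !bnd_simp => /(_ ac cb) /eqP; rewrite subr_eq addrC => /eqP ->.
  rewrite Rintegral_itv_obnd_cbnd//; apply: integrableS hf => //.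
  by apply: subset_itvr; rewrite bnd_simp.
by rewrite (key _ (ccont_onRe h)) (key _ (ccont_onIm h)).
Qed.

Lemma ler_Rint (f : R -> R) a b M : a <= b ->
  mu.-integrable `[a, b] (EFin \o f) ->
  (forall t, a <= t <= b -> `|f t| <= M) ->
  `|\int[mu]_(t in `[a, b]) f t| <= M * (b - a).
Proof.
move=> ab hf hM; rewrite -rint_cst//.
apply: le_trans (le_normr_Rintegral _ hf) _ => //.
apply: le_Rintegral => //.
- exact: (integrable_norm hf).
- by apply: (ccont_on_integrable (f := cst _)) => t _; exact: cst_continuous.
Qed.

(** Real and imaginary parts are bounded separately, whence the crude factor 2; no sharp constant
    matters later. *)
Lemma normc_cint a b phi M : a <= b -> ccont_on a b phi ->
  (forall t, a <= t <= b -> normc (phi t) <= M) ->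
  normc (cint a b phi) <= 2 * M * (b - a).
Proof.
move=> ab h hM; apply: le_trans (normc_le_ReIm _) _ => /=.
have -> : 2 * M * (b - a) = M * (b - a) + M * (b - a) by ring.
apply: lerD; apply: ler_Rint => //; [exact: ccont_onRe| |exact: ccont_onIm|] => t tab.
- by apply: le_trans (ler_Re_normc _) (hM _ tab).
- by apply: le_trans (ler_Im_normc _) (hM _ tab).
Qed.

Lemma cint_Im_ge a b phi m : a <= b -> ccont_on a b phi ->
  (forall t, a <= t <= b -> m <= Im (phi t)) ->
  m * (b - a) <= Im (cint a b phi).
Proof.
move=> ab h hm /=; rewrite -rint_cst//.
apply: le_Rintegral => //.
- by apply: (ccont_on_integrable (f := cst _)) => t _; exact: cst_continuous.
- exact: ccont_onIm.
Qed.

End complex_integral.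

(** * Goursat's theorem for rectangles *)

Section goursat.
Context {R : realType}.
Implicit Types (g : R[i] -> R[i]) (z w : R[i]) (a b c d s t : R).

Definition cts_at g z := forall e : R, 0 < e ->
  exists2 d, 0 < d & forall w, normc (w - z) < d -> normc (g w - g z) < e.

Lemma derivable_eps g z : derivable g z 1 -> exists D, forall e : R, 0 < e ->
  exists2 d, 0 < d & forall w, normc (w - z) < d ->
    normc (g w - g z - D * (w - z)) <= e * normc (w - z).
Proof.
move=> /cvg_ex[D /cvgrPdist_lt hD]; exists D => e e0.
have e0' : (0 : R[i]) < e%:C by rewrite ltcR.
have := hD _ e0' => /nbhs_ballP[d /= d0 hd].
have dR : d = (Re d)%:C by move: d0; rewrite ltcE => /andP[/eqP di _]; case: d di {hd} => ? ? /= ->.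
rewrite dR ltcR in d0; exists (Re d) => // w wz.
have [->|zw] := eqVneq w z; first by rewrite !subrr mulr0 subr0 ComplexField.Normc.normc0 mulr0.
have wz0 : w - z != 0 by rewrite subr_eq0.
have := hd (w - z); rewrite /ball /= sub0r normrN normcEC dR ltcR => /(_ wz wz0).
rewrite normcEC ltcR -[(w - z) *: 1]/((w - z) * 1) mulr1 subrK.
rewrite -[_ *: (g w - g z)]/((w - z)^-1 * (g w - g z)) => hlt.
have -> : g w - g z - D * (w - z) = - (w - z) * (D - (w - z)^-1 * (g w - g z)).
  by move: (w - z) wz0 (g w - g z) => u u0 v; field.
by rewrite normcM normcN mulrC; apply: ler_wpM2r (ltW hlt); exact: normc_ge0.
Qed.

Lemma derivable_cts g z : derivable g z 1 -> cts_at g z.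
Proof.
move=> /derivable_eps[D hD] e e0.
have [d d0 hd] := hD 1 ltr01.
have k0 : 0 < 1 + normc D by rewrite ltr_pwDl// normc_ge0.
exists (Num.min d (e / (1 + normc D))); first by rewrite lt_min d0 divr_gt0.
move=> w; rewrite lt_min => /andP[/hd wd we].
have -> : g w - g z = (g w - g z - D * (w - z)) + D * (w - z) by rewrite subrK.
apply: le_lt_trans (ler_normcD _ _) _; rewrite normcM.
apply: (@le_lt_trans _ _ ((1 + normc D) * normc (w - z))); last by rewrite mulrC -ltr_pdivlMr.
by rewrite mulrDl lerD2r.
Qed.

Lemma cts_at_ccontH g s t : cts_at g (s +i* t) -> ccont (fun s => g (s +i* t)) s.
Proof.
move=> h e /h[d d0 hd]; exists d => // u us; apply: hd.
have -> : u +i* t - (s +i* t) = (u - s)%:C by apply/eqP; rewrite eq_complex /= subrr !eqxx.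
by rewrite normcR.
Qed.

Lemma cts_at_ccontV g s t : cts_at g (s +i* t) -> ccont (fun t => g (s +i* t)) t.
Proof.
move=> h e /h[d d0 hd]; exists d => // u us; apply: hd.
have -> : s +i* u - (s +i* t) = 0 +i* (u - t) by apply/eqP; rewrite eq_complex /= subrr !eqxx.
by rewrite /= expr0n add0r sqrtr_sqr.
Qed.

Definition in_rect a b c d z := (a <= Re z <= b) && (c <= Im z <= d).

(* The integral of g over the positively oriented boundary of [a,b] + i[c,d]. *)
Definition rect_int g a b c d :=
  cint a b (fun s => g (s +i* c)) - cint a b (fun s => g (s +i* d))
  + 'i%C * (cint c d (fun t => g (b +i* t)) - cint c d (fun t => g (a +i* t))).

Definition bd_rect a b c d z :=
  in_rect a b c d z && [|| Re z == a, Re z == b, Im z == c | Im z == d].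

Definition cts_bd g a b c d := forall z, bd_rect a b c d z -> cts_at g z.

Section boundary_continuity.
Variables (g : R[i] -> R[i]) (a b c d : R).
Hypotheses (ab : a <= b) (cd : c <= d) (h : cts_bd g a b c d).

Lemma cts_bd_sides : [/\ ccont_on a b (fun s => g (s +i* c)),
  ccont_on a b (fun s => g (s +i* d)), ccont_on c d (fun t => g (b +i* t)) &
  ccont_on c d (fun t => g (a +i* t))].
Proof.
split=> x hx; [apply: cts_at_ccontH|apply: cts_at_ccontH|apply: cts_at_ccontV|apply: cts_at_ccontV];
  by apply: h; rewrite /bd_rect /in_rect/= hx !eqxx ?lexx ?ab ?cd ?orbT.
Qed.

End boundary_continuity.

Lemma eq_rect_int g1 g2 a b c d : a <= b -> c <= d ->
  (forall z, bd_rect a b c d z -> g1 z = g2 z) ->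
  rect_int g1 a b c d = rect_int g2 a b c d.
Proof.
move=> ab cd h; rewrite /rect_int; congr (_ - _ + _ * (_ - _)); apply: eq_cint => x hx;
  by apply: h; rewrite /bd_rect /in_rect/= hx !eqxx ?lexx ?ab ?cd ?orbT.
Qed.

Lemma rect_intD g1 g2 a b c d : a <= b -> c <= d ->
  cts_bd g1 a b c d -> cts_bd g2 a b c d ->
  rect_int (fun z => g1 z + g2 z) a b c d = rect_int g1 a b c d + rect_int g2 a b c d.
Proof.
move=> ab cd /(cts_bd_sides ab cd)[h1 h2 h3 h4] /(cts_bd_sides ab cd)[k1 k2 k3 k4].
by rewrite /rect_int !cintD//; ring.
Qed.

Lemma rect_intZ g (k : R[i]) a b c d : a <= b -> c <= d -> cts_bd g a b c d ->
  rect_int (fun z => k * g z) a b c d = k * rect_int g a b c d.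
Proof.
move=> ab cd /(cts_bd_sides ab cd)[h1 h2 h3 h4].
by rewrite /rect_int !cintZ//; ring.
Qed.

Lemma normc_rect_int g a b c d M : a <= b -> c <= d -> cts_bd g a b c d ->
  (forall z, bd_rect a b c d z -> normc (g z) <= M) ->
  normc (rect_int g a b c d) <= 4 * M * ((b - a) + (d - c)).
Proof.
move=> ab cd /(cts_bd_sides ab cd)[h1 h2 h3 h4] hM.
have b1 := normc_cint (M := M) ab h1. have b2 := normc_cint (M := M) ab h2.
have b3 := normc_cint (M := M) cd h3. have b4 := normc_cint (M := M) cd h4.
rewrite /rect_int; apply: le_trans (ler_normcD _ _) _.
rewrite normcM (_ : normc 'i%C = 1) ?mul1r; last by rewrite /= expr0n add0r expr1n sqrtr1.
have -> : 4 * M * ((b - a) + (d - c)) = (2 * M * (b - a) + 2 * M * (b - a)) +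
   (2 * M * (d - c) + 2 * M * (d - c)) by ring.
apply: lerD; apply: le_trans (ler_normcB _ _) _; apply: lerD;
  [apply: b1|apply: b2|apply: b3|apply: b4] => x hx; apply: hM;
  by rewrite /bd_rect /in_rect/= hx !eqxx ?lexx ?ab ?cd ?orbT.
Qed.

Lemma rect_int_splitV g a m b c d : a <= m <= b -> c <= d ->
  cts_bd g a b c d ->
  rect_int g a b c d = rect_int g a m c d + rect_int g m b c d.
Proof.
move=> /andP[am mb] cd /(cts_bd_sides (le_trans am mb) cd)[h1 h2 h3 h4].
by rewrite /rect_int (cint_split (c := m) _ h1) ?am// (cint_split (c := m) _ h2) ?am//; ring.
Qed.

Lemma rect_int_splitH g a b c m d : a <= b -> c <= m <= d ->
  cts_bd g a b c d ->
  rect_int g a b c d = rect_int g a b c m + rect_int g a b m d.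
Proof.
move=> ab /andP[cm md] /(cts_bd_sides ab (le_trans cm md))[h1 h2 h3 h4].
by rewrite /rect_int (cint_split (c := m) _ h3) ?cm// (cint_split (c := m) _ h4) ?cm//; ring.
Qed.

Lemma cts_at_affine (p q : R[i]) z : cts_at (fun w => p + q * w) z.
Proof.
apply: derivable_cts; apply: derivableD; first exact: derivable_cst.
apply: (derivableM (f := cst q) (g := id)); first exact: derivable_cst.
exact: derivable_id.
Qed.

Lemma rect_int_affine (p q : R[i]) a b c d : a <= b -> c <= d ->
  rect_int (fun w => p + q * w) a b c d = 0.
Proof.
move=> ab cd.
have [h1 h2 h3 h4] : [/\ ccont_on a b (fun s => p + q * (s +i* c)),
  ccont_on a b (fun s => p + q * (s +i* d)), ccont_on c d (fun t => p + q * (b +i* t)) &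
  ccont_on c d (fun t => p + q * (a +i* t))].
  by apply: (cts_bd_sides ab cd (g := fun w => p + q * w)) => z _; exact: cts_at_affine.
have cN x y f : ccont_on x y f -> ccont_on x y (fun t => -1 * f t).
  move=> h t /h ht e /ht[r r0 hr]; exists r => // u /hr.
  by rewrite !mulN1r -opprD normcN.
have cB x y f k : ccont_on x y f -> ccont_on x y k -> x <= y ->
    cint x y f - cint x y k = cint x y (fun t => f t + -1 * k t).
  by move=> hf hk xy; rewrite cintD ?cintZ ?mulN1r//; exact: cN.
rewrite /rect_int !cB//.
rewrite (@eq_cint _ a b _ (fun=> - (q * 'i%C * (d - c)%:C))); last first.
  move=> t _; rewrite [t +i* c]complexE [t +i* d]complexE /= rmorphB /=; ring.
rewrite (@eq_cint _ c d _ (fun=> q * (b - a)%:C)); last first.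
  move=> t _; rewrite [b +i* t]complexE [a +i* t]complexE /= rmorphB /=; ring.
rewrite !cint_cst//; ring.
Qed.

Lemma nested_intervals (u v : nat -> R) : (forall n, u n <= u n.+1) ->
  (forall n, v n.+1 <= v n) -> (forall n, u n <= v n) ->
  exists x, forall n, u n <= x <= v n.
Proof.
move=> /nondecreasing_seqP hu /nonincreasing_seqP hv uv.
have ub n m : u m <= v n.
  apply: le_trans (hu _ _ (leq_maxr n m)) _.
  exact: le_trans (uv _) (hv _ _ (leq_maxl n m)).
exists (sup (range u)) => n; apply/andP; split.
  by apply: sup_ubound; [exists (v 0%N) => _ [m _ <-]|exists n].
by apply: ge_sup; [exists (u 0%N), 0%N|move=> _ [m _ <-]].
Qed.

(** Choosing a quarter at each step gives nested rectangles, hence two sequences of nested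
    intervals, which provide [x] and [y]. Packing the four bounds into one tuple lets [choice]
    select the next quarter. *)
Lemma rect_bisection (P : R * R * R * R -> Prop) a b c d :
  a <= b -> c <= d ->
  (forall a b c d (x := (a + b) / 2) (y := (c + d) / 2), a <= b -> c <= d ->
    P (a, b, c, d) -> [\/ P (a, x, c, y), P (x, b, c, y), P (a, x, y, d) | P (x, b, y, d)]) ->
  P (a, b, c, d) ->
  exists x y, (a <= x <= b) && (c <= y <= d) /\ forall n, exists a' b' c' d',
   [/\ (a <= a') && (b' <= b), (c <= c') && (d' <= d), (a' <= x <= b') && (c' <= y <= d'),
    b' - a' = (b - a) / 2 ^+ n /\ d' - c' = (d - c) / 2 ^+ n & P (a', b', c', d')].
Proof.
move=> ab cd hP P0.
pose Q (q : R * R * R * R) := [/\ q.1.1.1 <= q.1.1.2, q.1.2 <= q.2 & P q].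
have step (q : R * R * R * R) : exists q' : R * R * R * R, Q q -> [/\ Q q',
    (q.1.1.1 <= q'.1.1.1) && (q'.1.1.2 <= q.1.1.2), (q.1.2 <= q'.1.2) && (q'.2 <= q.2),
    q'.1.1.2 - q'.1.1.1 = (q.1.1.2 - q.1.1.1) / 2 & q'.2 - q'.1.2 = (q.2 - q.1.2) / 2].
  have [|nQ] := pselect (Q q); last by exists q => /nQ.
  move: q => [[[a1 b1] c1] d1]; rewrite /Q /= => -[ab1 cd1 /(hP _ _ _ _ ab1 cd1)].
  case=> hP1; [exists (a1, (a1 + b1) / 2, c1, (c1 + d1) / 2)|
    exists ((a1 + b1) / 2, b1, c1, (c1 + d1) / 2)|exists (a1, (a1 + b1) / 2, (c1 + d1) / 2, d1)|
    exists ((a1 + b1) / 2, b1, (c1 + d1) / 2, d1)] => _ /=; split=> //; try split=> //=; try lra.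
have [F hF] := choice step.
pose q n := iter n F (a, b, c, d).
have Qn n : Q (q n) by elim: n => [|n IH]; [split|case: (hF _ IH)].
have [x hx] := @nested_intervals (fun n => (q n).1.1.1) (fun n => (q n).1.1.2)
  (fun n => (let: And5 _ h _ _ _ := hF _ (Qn n) in proj1 (andP h)))
  (fun n => (let: And5 _ h _ _ _ := hF _ (Qn n) in proj2 (andP h)))
  (fun n => let: And3 h _ _ := Qn n in h).
have [y hy] := @nested_intervals (fun n => (q n).1.2) (fun n => (q n).2)
  (fun n => (let: And5 _ _ h _ _ := hF _ (Qn n) in proj1 (andP h)))
  (fun n => (let: And5 _ _ h _ _ := hF _ (Qn n) in proj2 (andP h)))
  (fun n => let: And3 _ h _ := Qn n in h).
exists x, y; split; first by rewrite (hx 0%N) (hy 0%N).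
move=> n; exists (q n).1.1.1, (q n).1.1.2, (q n).1.2, (q n).2.
have {hx hy}hxy : ((q n).1.1.1 <= x <= (q n).1.1.2) && ((q n).1.2 <= y <= (q n).2).
  by rewrite hx hy.
suff [h1 h2 h3 h4] : [/\ (a <= (q n).1.1.1) && ((q n).1.1.2 <= b),
    (c <= (q n).1.2) && ((q n).2 <= d),
    (q n).1.1.2 - (q n).1.1.1 = (b - a) / 2 ^+ n & (q n).2 - (q n).1.2 = (d - c) / 2 ^+ n].
  by split=> //; case: (Qn n) => _ _; case: (q n) => [[[]]].
elim: n {hxy} => [|n [h1 h2 h3 h4]]; first by rewrite /= !lexx !expr0 !divr1.
have [_ k1 k2 k3 k4] := hF _ (Qn n); split.
- move/andP: k1 => [k1 k1']; move/andP: h1 => [h1 h1'].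
  by rewrite (le_trans h1)// (le_trans k1').
- move/andP: k2 => [k2 k2']; move/andP: h2 => [h2 h2'].
  by rewrite (le_trans h2)// (le_trans k2').
- by rewrite [LHS]k3 h3 exprSr invfM mulrA.
- by rewrite [LHS]k4 h4 exprSr invfM mulrA.
Qed.

(** Halving the sides divides [e * (width + height) ^+ 2] by 4, so this lower bound on the integral
    is inherited by one of the quarters. Around the limit point of the bisection [g] is affine up to
    a small relative error, and affine functions integrate to 0: a contradiction. *)
Lemma goursat g a b c d : a <= b -> c <= d ->
  (forall z, in_rect a b c d z -> derivable g z 1) -> rect_int g a b c d = 0.
Proof.
move=> ab cd hg; apply/eqP; apply: contraT => I0.
have ctsg z : in_rect a b c d z -> cts_at g z by move=> /hg/derivable_cts.
have [l0|l0] := eqVneq ((b - a) + (d - c)) 0.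
  have := @normc_rect_int g a b c d 0.
  have ab' : a = b by lra.
  have cd' : c = d by lra.
  move: I0; rewrite /rect_int ab' cd' !subrr mulr0 addr0; by rewrite eqxx.
have lp : 0 < (b - a) + (d - c) by rewrite lt0r l0/= addr_ge0// subr_ge0.
set l := (b - a) + (d - c) in l0 lp.
(* Half of the ratio, so that the strict inequality in [P] holds for the initial rectangle. *)
pose e := normc (rect_int g a b c d) / (2 * l ^+ 2).
have e0 : 0 < e by rewrite divr_gt0 ?normc_gt0// mulr_gt0// exprn_gt0.
pose P (q : R * R * R * R) := let: (a', b', c', d') := q in
  ((a <= a') && (b' <= b) && (c <= c') && (d' <= d)) /\
  e * ((b' - a') + (d' - c')) ^+ 2 < normc (rect_int g a' b' c' d').
have [||||x [y [xy hxy]]] := @rect_bisection P a b c d => //.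
- move=> a' b' c' d' x y ab' cd' [/andP[/andP[/andP[h1 h2] h3] h4] h5].
  have axb : a' <= x <= b' by rewrite /x; lra.
  have cyd : c' <= y <= d' by rewrite /y; lra.
  have cts' : forall z, in_rect a' b' c' d' z -> cts_at g z.
    move=> z /andP[z1 z2]; apply: ctsg; rewrite /in_rect; lra.
  have sub a1 b1 c1 d1 : a' <= a1 -> b1 <= b' -> c' <= c1 -> d1 <= d' ->
      cts_bd g a1 b1 c1 d1.
    by move=> ? ? ? ? z /andP[/andP[z1 z2] _]; apply: cts'; rewrite /in_rect; lra.
  have I4 : rect_int g a' b' c' d' =
      (rect_int g a' x c' y + rect_int g x b' c' y) +
      (rect_int g a' x y d' + rect_int g x b' y d').
    rewrite (rect_int_splitH ab' cyd); last exact: sub.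
    rewrite (rect_int_splitV axb); [|lra|apply: sub => //; lra].
    by rewrite (rect_int_splitV (a := a') axb); [|lra|apply: sub => //; lra].
  apply: contrapT => hn.
  have /not_orP[n1 /not_orP[n2 /not_orP[n3 n4]]] :
    ~ (P (a', x, c', y) \/ P (x, b', c', y) \/ P (a', x, y, d') \/ P (x, b', y, d')).
    by move=> hor; apply: hn; case: hor => [|[|[|]]] ?;
      [apply: Or41|apply: Or42|apply: Or43|apply: Or44].
  have quarter a1 b1 c1 d1 : ~ P (a1, b1, c1, d1) ->
      a' <= a1 -> b1 <= b' -> c' <= c1 -> d1 <= d' ->
      (b1 - a1) + (d1 - c1) = ((b' - a') + (d' - c')) / 2 ->
      normc (rect_int g a1 b1 c1 d1) <= e * (((b' - a') + (d' - c')) / 2) ^+ 2.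
    move=> nP q1 q2 q3 q4 <-; rewrite leNgt; apply/negP => q5; apply: nP; split=> //.
    by rewrite (le_trans h1)// (le_trans q2)// (le_trans h3)// (le_trans q4).
  move: h5; apply/negP; rewrite -leNgt I4.
  have -> : e * (b' - a' + (d' - c')) ^+ 2 =
    (e * (((b' - a') + (d' - c')) / 2) ^+ 2 + e * (((b' - a') + (d' - c')) / 2) ^+ 2) +
    (e * (((b' - a') + (d' - c')) / 2) ^+ 2 + e * (((b' - a') + (d' - c')) / 2) ^+ 2).
    by field.
  apply: le_trans (ler_normcD _ _) _; apply: lerD; apply: le_trans (ler_normcD _ _) _;
    apply: lerD; apply: quarter => //; rewrite /x /y; clear -ab' cd'; lra.
- split; first by rewrite !lexx.
  have lx : l ^+ 2 != 0 by rewrite expf_neq0.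
  rewrite -/l (_ : e * l ^+ 2 = normc (rect_int g a b c d) / 2); last by rewrite /e; field.
  by rewrite ltr_pdivrMr// mulr_natr mulr2n ltrDl normc_gt0.
have inz : in_rect a b c d (x +i* y) by [].
have [D hD] := derivable_eps (hg _ inz).
(* The 8 is 4 from [normc_rect_int] times 2 from the generous bound on the distance to the limit
   point. *)
have [r r0 hr] := hD (e / 8) (divr_gt0 e0 (ltr0n _ 8)).
have [n ln] : exists n, l / 2 ^+ n < r.
  have : (fun n => l * 2^-1 ^+ n) @ \oo --> l * 0.
    apply: cvgMr; apply: cvg_expr; rewrite ger0_norm ?invr_ge0// invf_lt1 ?ltr1n//.
  rewrite mulr0 => /cvgrPdist_lt/(_ r r0)[n _ /(_ n (leqnn _))].
  rewrite /= sub0r normrN exprVn => h; exists n; exact: le_lt_trans (ler_norm _) h.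
have [a' [b' [c' [d' [/andP[aa bb] /andP[cc dd] /andP[xab ycd] [Eab Ecd] [_ big]]]]]] := hxy n.
have ab' : a' <= b' by case/andP: xab => /le_trans; apply.
have cd' : c' <= d' by case/andP: ycd => /le_trans; apply.
have ln' : b' - a' + (d' - c') = l / 2 ^+ n by rewrite Eab Ecd -mulrDl.
pose p := g (x +i* y) - D * (x +i* y).
have small z : in_rect a' b' c' d' z ->
    normc (z - (x +i* y)) <= b' - a' + (d' - c').
  move=> /andP[z1 z2]; apply: le_trans (normc_le_ReIm _) _.
  by case: z z1 z2 => zx zy /= z1 z2; apply: lerD; rewrite ler_norml; lra.
have ctsr : cts_bd (fun z => g z + -1 * (p + D * z)) a' b' c' d'.
  move=> z /andP[/andP[z1 z2] _].
  apply: derivable_cts; apply: derivableD.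
    by apply: hg; rewrite /in_rect; lra.
  apply: (derivableM (f := cst (-1)) (g := fun z => p + D * z)); first exact: derivable_cst.
  apply: derivableD; first exact: derivable_cst.
  apply: (derivableM (f := cst D) (g := id)); first exact: derivable_cst.
  exact: derivable_id.
have ctsa : cts_bd (fun z => p + D * z) a' b' c' d' by move=> z _; exact: cts_at_affine.
have Ir : rect_int g a' b' c' d' = rect_int (fun z => g z + -1 * (p + D * z)) a' b' c' d'.
  transitivity (rect_int (fun z => (g z + -1 * (p + D * z)) + (p + D * z)) a' b' c' d').
    by apply: eq_rect_int => // z _; rewrite mulN1r subrK.
  by rewrite rect_intD// rect_int_affine// addr0.
move: big; rewrite Ir ltNge => /negP big; case: big; rewrite ln'.
have -> : e * (l / 2 ^+ n) ^+ 2 = 4 * (e / 8 * (2 * (l / 2 ^+ n))) * (l / 2 ^+ n).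
  by move: (l / 2 ^+ n) => u; field.
rewrite -{2}ln'; apply: (normc_rect_int ab' cd' ctsr) => z /andP[/small zs _].
have -> : g z + -1 * (p + D * z) = g z - g (x +i* y) - D * (z - (x +i* y)).
  by rewrite /p; ring.
apply: le_trans (hr _ _) _; first by rewrite (le_lt_trans zs)// ln'.
apply: ler_wpM2l; first by rewrite divr_ge0// ltW.
rewrite (le_trans zs)// ln' ler_peMl ?ler1n// divr_ge0 ?exprn_ge0//; exact: ltW.
Qed.

End goursat.

Section cauchy.
Context {R : realType}.
Implicit Types (g : R[i] -> R[i]) (z w : R[i]) (a b c d s t : R).

Lemma derivable_kernel z w : w != z -> derivable (fun w => (w - z)^-1) w 1.
Proof.
move=> wz; apply: (derivableV (f := fun w => w - z)); first by rewrite subr_eq0.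
apply: derivableB; first exact: derivable_id.
exact: derivable_cst.
Qed.

Lemma cts_at_kernel z w : w != z -> cts_at (fun w => (w - z)^-1) w.
Proof. by move=> /derivable_kernel/derivable_cts. Qed.

(** Goursat's theorem removes in turn the strips below, above, to the left and to the right of the
    inner rectangle, whose interior may contain singularities. *)
Lemma rect_int_shrink g a b c d a' b' c' d' :
  a <= a' -> a' <= b' -> b' <= b -> c <= c' -> c' <= d' -> d' <= d ->
  (forall z, in_rect a b c d z -> ~~ ((a' < Re z < b') && (c' < Im z < d')) ->
    derivable g z 1) ->
  rect_int g a b c d = rect_int g a' b' c' d'.
Proof.
move=> aa ab bb cc cd dd hg.
(* The cases list the rectangles met while cutting: each boundary stays off the open inner
   rectangle, where nothing is known of [g]. *)
have cts x1 x2 y1 y2 : a <= x1 -> x2 <= b -> c <= y1 -> y2 <= d ->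
  [|| x2 <= a', b' <= x1, y2 <= c' | d' <= y1] || (x1 <= a') && (b' <= x2) && (y1 <= c') && (d' <= y2)
  || (x1 <= a') && (b' <= x2) && (y1 == c') && (d' == y2)
  || (x1 == a') && (b' == x2) && (y1 == c') && (d' == y2)
  || (x1 == a') && (b' <= x2) && (y1 == c') && (d' == y2) ->
  cts_bd g x1 x2 y1 y2.
  move=> h1 h2 h3 h4 h z /andP[/andP[z1 z2] zb]; apply: derivable_cts; apply: hg.
    by rewrite /in_rect; lra.
  apply/negP => /andP[zi1 zi2].
  move: zb => /or4P[] /eqP zE; rewrite zE in zi1 zi2 z1 z2 *; lra.
have zero x1 x2 y1 y2 : a <= x1 -> x1 <= x2 -> x2 <= b -> c <= y1 -> y1 <= y2 -> y2 <= d ->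
  [|| x2 <= a', b' <= x1, y2 <= c' | d' <= y1] -> rect_int g x1 x2 y1 y2 = 0.
  move=> h1 h2 h3 h4 h5 h6 h; apply: goursat => // z /andP[z1 z2]; apply: hg.
    by rewrite /in_rect; lra.
  by apply/negP => /andP[zi1 zi2]; lra.
have cc' : c <= c' <= d by lra.
have dd' : c' <= d' <= d by lra.
have aa' : a <= a' <= b by lra.
have bb' : a' <= b' <= b by lra.
have ab0 : a <= b by lra.
rewrite (rect_int_splitH ab0 cc'); last by apply: cts; lra.
rewrite (zero a b c c') ?add0r; [|lra..].
rewrite (rect_int_splitH ab0 dd'); last by apply: cts; lra.
rewrite (zero a b d' d) ?addr0; [|lra..].
rewrite (rect_int_splitV aa' cd); last by apply: cts; lra.
rewrite (zero a a' c' d') ?add0r; [|lra..].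
rewrite (rect_int_splitV bb' cd); last by apply: cts; lra.
by rewrite (zero b' b c' d') ?addr0//; lra.
Qed.

Definition in_square r z := in_rect (- r) r (- r) r z.
Definition on_square r z := bd_rect (- r) r (- r) r z.
Definition square_int g r := rect_int g (- r) r (- r) r.

Lemma on_square_normc r z : on_square r z -> r <= normc z.
Proof.
by move=> /andP[_ /or4P[] /eqP h];
  [have := ler_Re_normc z|have := ler_Re_normc z|have := ler_Im_normc z|have := ler_Im_normc z];
  rewrite h ?normrN => /(le_trans _) -> //; exact: ler_norm.
Qed.

Lemma on_square_sub r z w : on_square r w -> normc z <= r / 2 -> r / 2 <= normc (w - z).
Proof.
move=> /on_square_normc h1 h2; have := ler_normcD (w - z) z; rewrite subrK; lra.
Qed.

Lemma on_square_neq r z w : 0 < r -> on_square r w -> normc z <= r / 2 -> w != z.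
Proof.
move=> r0 h1 h2; have := on_square_sub h1 h2; apply: contraTneq => ->.
by rewrite subrr ComplexField.Normc.normc0 -ltNge divr_gt0.
Qed.

(** The quotient is bounded near its removable singularity [z], so shrinking the contour to a small
    square around [z] makes the integral arbitrarily small. *)
Lemma square_int_diffquot g r z : 0 < r -> normc z <= r / 2 ->
  (forall w, in_square r w -> derivable g w 1) ->
  square_int (fun w => (g w - g z) * (w - z)^-1) r = 0.
Proof.
move=> r0 zr hg.
have z1 : `|Re z| <= r / 2 := le_trans (ler_Re_normc z) zr.
have z2 : `|Im z| <= r / 2 := le_trans (ler_Im_normc z) zr.
rewrite !ler_norml in z1 z2.
have inz : in_square r z by rewrite /in_square /in_rect; lra.
have [D hD] := derivable_eps (hg _ inz).
have [d d0 hd] := hD 1 ltr01.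
pose q w := (g w - g z) * (w - z)^-1.
have dq w : in_square r w -> w != z -> derivable q w 1.
  move=> h wz; apply: (derivableM (f := fun w => g w - g z) (g := fun w => (w - z)^-1)).
    by apply: derivableB; [exact: hg|exact: derivable_cst].
  exact: derivable_kernel.
set I := square_int _ _.
have hI e : 0 < e -> e < r / 2 -> e < d / 2 ->
    normc I <= 4 * (1 + normc D) * (4 * e).
  move=> e0 er ed.
  have neqz w : ~~ ((Re z - e < Re w < Re z + e) && (Im z - e < Im w < Im z + e)) -> w != z.
    by apply: contraNneq => ->; lra.
  rewrite /I /square_int (@rect_int_shrink _ _ _ _ _ (Re z - e) (Re z + e) (Im z - e) (Im z + e)); try lra.
  - have -> : 4 * e = ((Re z + e) - (Re z - e)) + ((Im z + e) - (Im z - e)) by ring.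
    have onq w : bd_rect (Re z - e) (Re z + e) (Im z - e) (Im z + e) w -> in_square r w /\ w != z.
      move=> /andP[/andP[w1 w2] wb]; split; first by rewrite /in_square /in_rect; lra.
      by apply: neqz; move: wb => /or4P[] /eqP wE; rewrite wE in w1 w2 *; lra.
    apply: normc_rect_int; try lra.
      by move=> w /onq[? ?]; apply: derivable_cts; exact: dq.
    move=> w wb; have [? wz] := onq _ wb.
    have wz0 : w - z != 0 by rewrite subr_eq0.
    have nwz : 0 < normc (w - z) by rewrite normc_gt0.
    rewrite /q normcM normcV ler_pdivrMr//.
    have -> : g w - g z = (g w - g z - D * (w - z)) + D * (w - z) by rewrite subrK.
    apply: le_trans (ler_normcD _ _) _; rewrite normcM mulrDl lerD2r; apply: hd.
    move: wb => /andP[/andP[w1 w2] _].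
    apply: le_lt_trans (normc_le_ReIm _) _.
    have : `|Re (w - z)| <= e /\ `|Im (w - z)| <= e.
      by case: (w) (z) w1 w2 => [wx wy] [zx zy] /= w1 w2; rewrite !ler_norml; lra.
    by case; lra.
  - move=> w w1 /neqz wz; exact: dq.
apply/eqP; rewrite -normc_eq0; apply: contraT => n0.
have k0 : 0 < 1 + normc D by rewrite ltr_pwDl// normc_ge0.
have nI : 0 < normc I by rewrite lt0r n0 normc_ge0.
(* With this [e] the estimate [hI] bounds the modulus of [I] by its half. *)
pose e := Num.min (normc I / (32 * (1 + normc D))) (Num.min (r / 4) (d / 4)).
have e0 : 0 < e by rewrite !lt_min !divr_gt0// mulr_gt0.
have e1 : e <= normc I / (32 * (1 + normc D)) by rewrite ge_min lexx.
have e2 : e <= r / 4 by rewrite !ge_min lexx ?orbT.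
have e3 : e <= d / 4 by rewrite !ge_min lexx ?orbT.
have := hI e e0; move=> /(_ ltac:(lra) ltac:(lra)).
rewrite ler_pdivlMr ?mulr_gt0// in e1.
have -> : 4 * (1 + normc D) * (4 * e) = (e * (32 * (1 + normc D))) / 2 by field.
by move=> h; exfalso; lra.
Qed.

(** For [z] well inside the square the value is 2 pi i; below, only its independence of [z] and a
    lower bound for its modulus are established. *)
Definition winding r z := square_int (fun w => (w - z)^-1) r.

Lemma cauchy_formula g r z : 0 < r -> normc z <= r / 2 ->
  (forall w, in_square r w -> derivable g w 1) ->
  square_int (fun w => g w * (w - z)^-1) r = g z * winding r z.
Proof.
move=> r0 zr hg.
have hrr : - r <= r by lra.
have k1 : cts_bd (fun w => (w - z)^-1) (- r) r (- r) r.
  by move=> w hw; apply: cts_at_kernel; exact: on_square_neq hw zr.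
have k3 : cts_bd (fun w => g z * (w - z)^-1) (- r) r (- r) r.
  move=> w hw; apply: derivable_cts; apply: (derivableM (f := cst (g z))).
    exact: derivable_cst.
  by apply: derivable_kernel; exact: on_square_neq hw zr.
have k2 : cts_bd (fun w => (g w - g z) * (w - z)^-1) (- r) r (- r) r.
  move=> w hw; apply: derivable_cts.
  apply: (derivableM (f := fun w => g w - g z) (g := fun w => (w - z)^-1)).
    by apply: derivableB; [apply: hg; case/andP: hw|exact: derivable_cst].
  by apply: derivable_kernel; exact: on_square_neq hw zr.
have := square_int_diffquot r0 zr hg.
rewrite /winding /square_int -(rect_intZ _ hrr hrr k1) => h0.
rewrite -[RHS]add0r -[X in X + _]h0 -rect_intD//.
by apply: eq_rect_int => // w _; rewrite mulrBl subrK.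
Qed.

(* The difference of the two kernels is O(|w|^-2), and its integral does not
   change when the square is enlarged. *)
Lemma winding_cst r z1 z2 : 0 < r -> normc z1 <= r / 2 -> normc z2 <= r / 2 ->
  winding r z1 = winding r z2.
Proof.
move=> r0 zr1 zr2.
have hrr : - r <= r by lra.
have k z : normc z <= r / 2 -> cts_bd (fun w => (w - z)^-1) (- r) r (- r) r.
  by move=> zr w hw; apply: cts_at_kernel; exact: on_square_neq hw zr.
pose h w := (z1 - z2) * ((w - z1)^-1 * (w - z2)^-1).
have dh w : w != z1 -> w != z2 -> derivable h w 1.
  move=> w1 w2; apply: (derivableM (f := cst (z1 - z2))); first exact: derivable_cst.
  by apply: (derivableM (f := fun w => (w - z1)^-1)); exact: derivable_kernel.
have Ih : winding r z1 = winding r z2 + square_int h r.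
  rewrite /winding /square_int -rect_intD//; last 2 first.
  - exact: k.
  - by move=> w hw; apply: derivable_cts; apply: dh; apply: on_square_neq hw _.
  apply: eq_rect_int => // w hw.
  have h1 : w - z1 != 0 by rewrite subr_eq0; exact: on_square_neq hw _.
  have h2 : w - z2 != 0 by rewrite subr_eq0; exact: on_square_neq hw _.
  by rewrite /h; field; rewrite h1 h2.
suff h0 : square_int h r = 0 by rewrite Ih h0 addr0.
have big s : r <= s -> normc (square_int h r) <= 64 * normc (z1 - z2) / s.
  move=> rs; have s0 : 0 < s by lra.
  have zs1 : normc z1 <= s / 2 by lra.
  have zs2 : normc z2 <= s / 2 by lra.
  have hss : - s <= s by lra.
  have -> : square_int h r = square_int h s.
    apply/esym; apply: rect_int_shrink; try lra.
    move=> w _ wN; apply: dh; apply: contraNneq wN => ->.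
    - have := ler_Re_normc z1; have := ler_Im_normc z1; rewrite !ler_norml; lra.
    - have := ler_Re_normc z2; have := ler_Im_normc z2; rewrite !ler_norml; lra.
  have -> : 64 * normc (z1 - z2) / s =
     4 * (normc (z1 - z2) * ((s / 2)^-1 * (s / 2)^-1)) * ((s - - s) + (s - - s)).
    by field; rewrite gt_eqF.
  apply: normc_rect_int => //.
    by move=> w hw; apply: derivable_cts; apply: dh; exact: on_square_neq hw _.
  move=> w hw; rewrite /h normcM; apply: ler_wpM2l; first exact: normc_ge0.
  have s2 : 0 < s / 2 by lra.
  have l1 := on_square_sub hw zs1. have l2 := on_square_sub hw zs2.
  rewrite normcM !normcV; apply: ler_pM; rewrite ?invr_ge0 ?normc_ge0//;
    rewrite lef_pV2 ?posrE//; exact: lt_le_trans s2 _.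
apply/eqP; rewrite -normc_eq0; apply: contraT => n0.
have nI : 0 < normc (square_int h r) by rewrite lt0r n0 normc_ge0.
(* From this size on, [big] bounds the modulus of the integral by its half. *)
pose s := Num.max r (128 * normc (z1 - z2) / normc (square_int h r)).
have s1 : r <= s by rewrite le_max lexx.
have s2 : 128 * normc (z1 - z2) / normc (square_int h r) <= s by rewrite le_max lexx orbT.
have s0 : 0 < s by lra.
have := big s s1; rewrite ler_pdivlMr//.
rewrite ler_pdivrMr// mulrC in s2 => h2; exfalso.
have : 0 < normc (square_int h r) * s by rewrite mulr_gt0.
by have := normc_ge0 (z1 - z2); nra.
Qed.

End cauchy.

Section cauchy_estimates.
Context {R : realType}.
Implicit Types (g : R[i] -> R[i]) (z w : R[i]) (a b c d s t : R).

(* Each of the four sides contributes at least 1 to the imaginary part. *)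
Lemma winding_ge (r : R) z : 0 < r -> normc z <= r / 2 -> 4 <= normc (winding r z).
Proof.
move=> r0 zr; rewrite (@winding_cst R r z 0)//; last first.
  by rewrite ComplexField.Normc.normc0; lra.
apply: le_trans (ler_Im_normc _); apply: le_trans (ler_norm _).
have hrr : - r <= r by lra.
have cts0 : cts_bd (fun w => (w - 0)^-1) (- r) r (- r) r.
  move=> w hw; apply: cts_at_kernel; apply: on_square_neq hw _ => //.
  by rewrite ComplexField.Normc.normc0; lra.
have [h1 h2 h3 h4] := cts_bd_sides hrr hrr cts0.
(* On a side [x ^+ 2 + r ^+ 2 <= 2 * r ^+ 2]; integrating over the length [2 * r] then gives 1. *)
have bnd x : - r <= x <= r -> (2 * r)^-1 <= r / (x ^+ 2 + r ^+ 2).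
  move=> hx; rewrite -[leLHS]mul1r ler_pdivrMr ?mulr_gt0// mulrAC ler_pdivlMr; nra.
have cZ x y f k : ccont_on x y f -> ccont_on x y (fun t => k * f t).
  move=> h t /h ht e e0.
  have k0 : 0 < normc k + 1 by rewrite ltr_wpDl// normc_ge0.
  have [d d0 hd] := ht (e / (normc k + 1)) (divr_gt0 e0 k0).
  exists d => // u /hd; rewrite ltr_pdivlMr// -mulrBr normcM => h'.
  by apply: le_lt_trans h'; rewrite mulrC ler_wpM2l ?normc_ge0// lerDl.
have four : 4 = ((2 * r)^-1 * (r - - r) + (2 * r)^-1 * (r - - r)) +
  ((2 * r)^-1 * (r - - r) + (2 * r)^-1 * (r - - r)).
  by field; rewrite gt_eqF.
have ImM (u v : R[i]) : Im (u * v) = Re u * Im v + Im u * Re v.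
  by case: u v => ? ? [? ?].
have -> : winding r 0 =
    (cint (- r) r (fun s => (s +i* - r - 0)^-1) +
     cint (- r) r (fun s => -1 * (s +i* r - 0)^-1)) +
    (cint (- r) r (fun t => 'i%C * (r +i* t - 0)^-1) +
     cint (- r) r (fun t => - 'i%C * (- r +i* t - 0)^-1)).
  by rewrite /winding /square_int /rect_int !cintZ//; ring.
rewrite 3!raddfD four.
apply: lerD; apply: lerD; apply: cint_Im_ge => //; try exact: cZ; move=> x hx;
  apply: le_trans (bnd _ hx) _; rewrite subr0.
- have -> : Im (x +i* - r)^-1 = - (- r / (x ^+ 2 + (- r) ^+ 2)) by [].
  by rewrite sqrrN mulNr opprK.
- have -> : Im (-1 * (x +i* r)^-1) = r / (x ^+ 2 + r ^+ 2) by rewrite mulN1r /= opprK.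
  by [].
- have -> : Im ('i%C * (r +i* x)^-1) = r / (x ^+ 2 + r ^+ 2).
    by rewrite ImM /= mul0r mul1r add0r addrC.
  by [].
- have -> : Im (- 'i%C * (- r +i* x)^-1) = r / (x ^+ 2 + r ^+ 2).
    by rewrite ImM /= oppr0 mul0r add0r sqrrN addrC mulN1r mulNr opprK.
  by [].
Qed.

Lemma derivable_bigsum (I : Type) (q : seq I) (F : I -> R[i] -> R[i]) w :
  (forall i, derivable (F i) w 1) ->
  derivable (fun w => \sum_(i <- q) F i w) w 1.
Proof.
move=> hF; elim: q => [|i q IH].
  rewrite (_ : (fun _ => _) = cst 0); first exact: derivable_cst.
  by apply/funext => w'; rewrite big_nil.
rewrite (_ : (fun _ => _) = F i + (fun w => \sum_(i <- q) F i w)).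
  by apply: derivableD; [exact: hF|exact: IH].
by apply/funext => w'; rewrite big_cons.
Qed.

Lemma square_int_sum (I : Type) (q : seq I) (r : R) (F : I -> R[i] -> R[i]) : 0 < r ->
  (forall i w, on_square r w -> derivable (F i) w 1) ->
  square_int (fun w => \sum_(i <- q) F i w) r = \sum_(i <- q) square_int (F i) r.
Proof.
move=> r0 hF; have hrr : - r <= r by lra.
elim: q => [|i q IH].
  rewrite big_nil -[RHS](mul0r (square_int (fun w => 0) r)) /square_int -rect_intZ//.
    by apply: eq_rect_int => // w _; rewrite big_nil mul0r.
  by move=> w _; apply: derivable_cts; exact: derivable_cst.
rewrite big_cons -IH /square_int -rect_intD//.
- by apply: eq_rect_int => // w _; rewrite big_cons.
- by move=> w hw; apply: derivable_cts; exact: hF.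
- by move=> w hw; apply: derivable_cts; apply: derivable_bigsum => j; exact: hF.
Qed.

(* By Cauchy's formula, an estimate for a finite combination of point
   evaluations need only be checked on the kernels 1 / (w - .). *)
Lemma cauchy_duality (I : Type) (q : seq I) (a zeta : I -> R[i]) g (r M B : R) : 0 < r ->
  (forall i, normc (zeta i) <= r / 2) ->
  (forall w, in_square r w -> derivable g w 1) ->
  (forall w, in_square r w -> normc (g w) <= M) ->
  (forall w, on_square r w -> normc (\sum_(i <- q) a i * (w - zeta i)^-1) <= B) ->
  normc (\sum_(i <- q) a i * g (zeta i)) <= 4 * r * M * B.
Proof.
move=> r0 hz hg hM hB.
have hrr : - r <= r by lra.
have z0 : normc (0 : R[i]) <= r / 2 by rewrite ComplexField.Normc.normc0; lra.
have W4 := winding_ge r0 z0.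
have dF i w : on_square r w -> derivable (fun w => a i * (g w * (w - zeta i)^-1)) w 1.
  move=> hw; apply: (derivableM (f := cst (a i))); first exact: derivable_cst.
  apply: (derivableM (f := g)); first by apply: hg; case/andP: hw.
  by apply: derivable_kernel; exact: on_square_neq hw _.
(* [winding_cst] moves every [winding r (zeta i)] to the centre, so that a common factor leaves the
   sum. *)
have E : (\sum_(i <- q) a i * g (zeta i)) * winding r 0 =
    square_int (fun w => \sum_(i <- q) a i * (g w * (w - zeta i)^-1)) r.
  rewrite square_int_sum// mulr_suml; apply: eq_bigr => i _.
  rewrite /square_int rect_intZ//; last first.
    move=> w hw; apply: derivable_cts.
    apply: (derivableM (f := g)); first by apply: hg; case/andP: hw.
    by apply: derivable_kernel; exact: on_square_neq hw _.
  have := cauchy_formula r0 (hz i) hg; rewrite /square_int => ->.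
  by rewrite (@winding_cst R r (zeta i) 0)// mulrA.
have : normc (\sum_(i <- q) a i * g (zeta i)) * normc (winding r 0) <=
    4 * (M * B) * ((r - - r) + (r - - r)).
  rewrite -normcM E; apply: normc_rect_int => //.
    move=> w hw; apply: derivable_cts.
    by apply: derivable_bigsum => i; exact: dF.
  move=> w hw.
  rewrite (eq_bigr (fun i => g w * (a i * (w - zeta i)^-1))); last by move=> i _; ring.
  rewrite -mulr_sumr normcM; apply: ler_pM; rewrite ?normc_ge0//; last exact: hB.
  by apply: hM; case/andP: hw.
(* The half-perimeter is [4 * r], and the last 4 is cancelled against the lower bound of the winding
   integral. *)
have -> : 4 * (M * B) * (r - - r + (r - - r)) = 4 * r * M * B * 4 by ring.
have n0 := normc_ge0 (\sum_(i <- q) a i * g (zeta i)).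
move=> h; rewrite -(@ler_pM2r _ 4)//; apply: le_trans h.
exact: ler_wpM2l.
Qed.

End cauchy_estimates.

(** * Newton interpolation in polysquares *)

Section newton.
Context {R : realType}.
Implicit Types (z w : R[i]) (zeta : nat -> R[i]).

(** The coefficients are those of the divided difference at [zeta 0], ..., [zeta n], and the product
    is its value on the Cauchy kernel. In the induction the new node receives minus the sum of the
    other coefficients. *)
Lemma partial_fractions (zeta : nat -> R[i]) : injective zeta ->
  forall n, exists a : nat -> R[i], forall w, (forall i, w != zeta i) ->
    \sum_(0 <= i < n.+1) a i * (w - zeta i)^-1 = \prod_(0 <= i < n.+1) (w - zeta i)^-1.
Proof.
move=> zI; elim=> [|n [a IH]].
  by exists (fun=> 1) => w _; rewrite !big_nat1 mul1r.
pose b i := a i / (zeta i - zeta n.+1).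
exists (fun i => if i == n.+1 then - \sum_(0 <= i < n.+1) b i else b i) => w wz.
rewrite [RHS]big_nat_recr//= -IH// mulr_suml [LHS]big_nat_recr//= eqxx mulNr mulr_suml.
rewrite -sumrB; apply: eq_big_nat => i /andP[_ ilt].
rewrite ltn_eqF// /b.
have h1 : zeta i - zeta n.+1 != 0.
  by rewrite subr_eq0; apply/eqP => /zI E; rewrite E ltnn in ilt.
have h2 j : w - zeta j != 0 by rewrite subr_eq0.
by field; rewrite h1 !h2.
Qed.

(** The Newton remainder of the Cauchy kernel is again a product. For nodes and [z] near the centre
    and [w] on the square each of its factors will be at most 1/8, which gives the geometric
    convergence. *)
Lemma newton_kernel zeta z w N : w != z -> (forall i, w != zeta i) ->
  (w - z)^-1 - \sum_(0 <= n < N)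
     (\prod_(0 <= i < n) (z - zeta i)) * \prod_(0 <= i < n.+1) (w - zeta i)^-1 =
  (w - z)^-1 * \prod_(0 <= i < N) ((z - zeta i) * (w - zeta i)^-1).
Proof.
move=> wz wzeta; elim: N => [|N IH]; first by rewrite !big_geq// subr0 mulr1.
rewrite big_nat_recr//= opprD addrA IH [in RHS]big_nat_recr//= !big_split/=.
rewrite [\prod_(0 <= i < N.+1) _]big_nat_recr//=.
have h1 : w - z != 0 by rewrite subr_eq0.
have h2 : w - zeta N != 0 by rewrite subr_eq0.
by field; rewrite h1 h2.
Qed.

Definition square_bounded_holo (r M : R) (g : R[i] -> R[i]) :=
  (forall w, in_square r w -> derivable g w 1) /\
  (forall w, in_square r w -> normc (g w) <= M).

Lemma newton_expansion (r : R) : 0 < r ->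
  exists (zeta : nat -> R[i]) (a : nat -> nat -> R[i]) (h : nat -> R[i] -> R[i]),
  [/\ forall i, normc (zeta i) <= r / 32,
    forall n z, normc z <= r / 32 -> normc (h n z) <= 4^-1 ^+ n,
    forall g M n, square_bounded_holo r M g ->
      normc (\sum_(0 <= i < n.+1) a n i * g (zeta i)) <= 8 * 2^-1 ^+ n * M &
    forall g M N z, square_bounded_holo r M g -> normc z <= r / 32 ->
      normc (g z - \sum_(0 <= n < N) h n z * \sum_(0 <= i < n.+1) a n i * g (zeta i))
        <= 8 * 2^-1 ^+ N * M].
Proof.
move=> r0.
(* The nodes are distinct, as partial fractions with simple poles require, and remain within
   [r / 32] of the centre. *)
pose zeta (n : nat) : R[i] := (r / 32 / n.+1%:R)%:C.
have zI : injective zeta.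
  move=> m n [] E; have r32 : r / 32 != 0 by rewrite gt_eqF// divr_gt0.
  by have /invr_inj/eqP := mulfI r32 E; rewrite eqr_nat eqSS => /eqP.
have zr i : normc (zeta i) <= r / 32.
  rewrite normcR ger0_norm; last by rewrite !divr_ge0// ltW.
  by rewrite ler_pdivrMr// ler_peMr ?ler1n// divr_ge0// ltW.
have /choice[b hb] := partial_fractions zI.
have sp w z : on_square r w -> normc z <= r / 32 -> r / 2 <= normc (w - z) /\ w != z.
  move=> hw hz; have h : normc z <= r / 2 by lra.
  by split; [exact: on_square_sub hw h|exact: on_square_neq hw h].
have r4 : 0 < r / 4 by lra.
have r2 : 0 < r / 2 by lra.
(* Differences [z - zeta i] are at most [r / 16] and [w - zeta i] at least [r / 2] in modulus.
   Rescaling by powers of [r / 4] shares the ratio 1/8 between the basis polynomials, which get 1/4,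
   and the divided differences, which get 1/2. *)
pose s : R[i] := (r / 4)%:C.
have s0 : s != 0 by rewrite -normc_eq0 normcR gtr0_norm// gt_eqF.
have ns : normc s = r / 4 by rewrite normcR gtr0_norm.
pose a n i := s ^+ n * b n i.
pose h n z := s ^- n * \prod_(0 <= i < n) (z - zeta i).
have prodle (n : nat) w : on_square r w ->
    normc (\prod_(0 <= i < n) (w - zeta i)^-1) <= (2 / r) ^+ n.
  move=> hw; rewrite normc_prod -[leRHS](_ : \prod_(0 <= i < n) (2 / r) = _); last first.
    by rewrite prodr_const_nat subn0.
  apply: ler_prod => i _; rewrite normc_ge0 normcV/= -[2 / r]invf_div.
  have [k1 _] := sp _ _ hw (zr i).
  by rewrite lef_pV2 ?posrE// (lt_le_trans _ k1).
have kz n w : on_square r w -> \sum_(0 <= i < n.+1) a n i * (w - zeta i)^-1 =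
    s ^+ n * \prod_(0 <= i < n.+1) (w - zeta i)^-1.
  move=> hw; rewrite -hb; last by move=> i; case: (sp _ _ hw (zr i)).
  by rewrite mulr_sumr; apply: eq_bigr => i _; rewrite mulrA.
have z2 i : normc (zeta i) <= r / 2 by have := zr i; lra.
have hprod n z : normc z <= r / 32 -> normc (\prod_(0 <= i < n) (z - zeta i)) <= (r / 16) ^+ n.
  move=> hz; rewrite normc_prod -[leRHS](_ : \prod_(0 <= i < n) (r / 16) = _); last first.
    by rewrite prodr_const_nat subn0.
  apply: ler_prod => i _; rewrite normc_ge0/=.
  by apply: le_trans (ler_normcB _ _) _; have := zr i; lra.
exists zeta, a, h; split=> //.
- move=> n z hz; rewrite /h normcM normcV normcX ns.
  rewrite mulrC ler_pdivrMr ?exprn_gt0// -exprMn.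
  by rewrite (_ : 4^-1 * (r / 4) = r / 16); [exact: hprod|field].
- move=> g M n [hg hM].
  apply: le_trans (cauchy_duality (I := nat) (r := r) (M := M)
    (B := (r / 4) ^+ n * (2 / r) ^+ n.+1) _ _ hg hM _) _ => //.
    move=> w hw; rewrite kz// normcM normcX ns.
    by apply: ler_wpM2l; [rewrite exprn_ge0// ltW|apply: prodle].
  rewrite (_ : (r / 4) ^+ n * _ = 2 / r * 2^-1 ^+ n); last first.
    by rewrite exprS mulrCA -exprMn; congr (_ * _ ^+ n); field; rewrite gt_eqF.
  rewrite le_eqVlt; apply/orP; left; apply/eqP.
  by move: (2^-1 ^+ n) => u; field; rewrite gt_eqF.
- move=> g M N z [hg hM] hz.
  (* The error at [z] is itself a combination of point values, [None] standing for [z] and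
     [Some (n, i)] for [zeta i] in the term of order [n]; hence [cauchy_duality] applies to it. *)
  pose q := None :: [seq Some (n, i) | n <- index_iota 0 N, i <- index_iota 0 n.+1].
  pose pt (o : option (nat * nat)) := if o is Some (_, i) then zeta i else z.
  pose co (o : option (nat * nat)) := if o is Some (n, i) then - (h n z * a n i) else 1.
  have E (G : R[i] -> R[i]) : \sum_(o <- q) co o * G (pt o) =
      G z - \sum_(0 <= n < N) h n z * \sum_(0 <= i < n.+1) a n i * G (zeta i).
    rewrite /q big_cons big_allpairs_dep [co None]/= mul1r -sumrN; congr (_ + _).
    apply: eq_bigr => n _; rewrite mulr_sumr -sumrN.
    by apply: eq_bigr => i _; rewrite /= mulNr -mulrA.
  rewrite -E; apply: le_trans (cauchy_duality (r := r) (M := M)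
    (B := 2 / r * 8^-1 ^+ N) _ _ hg hM _) _ => //.
    by case=> [[n i]|] /=; [exact: z2|lra].
  move=> w hw; rewrite (E (fun x => (w - x)^-1)).
    have [k1 k2] := sp _ _ hw hz.
    rewrite (eq_bigr (fun n => (\prod_(0 <= i < n) (z - zeta i)) *
       \prod_(0 <= i < n.+1) (w - zeta i)^-1)); last first.
      move=> n _; rewrite kz// /h mulrACA mulrA [_ ^- _ * _]mulVf ?mul1r// expf_neq0//.
    rewrite newton_kernel//; last by move=> i; case: (sp _ _ hw (zr i)).
    rewrite normcM; apply: ler_pM; rewrite ?normc_ge0//.
      by rewrite normcV -[2 / r]invf_div lef_pV2 ?posrE// (lt_le_trans _ k1).
    rewrite big_split normcM /=.
    rewrite (_ : 8^-1 = (r / 16) * (2 / r)); last by field; rewrite gt_eqF.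
    rewrite exprMn; apply: ler_pM; rewrite ?normc_ge0//; [exact: hprod|exact: prodle].
  rewrite (_ : 4 * r * M * _ = 8 * 8^-1 ^+ N * M); last first.
    by move: (8^-1 ^+ N) => u; field; rewrite gt_eqF.
  apply: ler_wpM2r.
    apply: le_trans (hM 0 _); first exact: normc_ge0.
    by rewrite /in_square /in_rect/=; lra.
  apply: ler_wpM2l => //; apply: lerXn2r; rewrite ?nnegrE ?invr_ge0//.
  by rewrite lef_pV2 ?posrE// ler_nat.
Qed.

End newton.

(** * Boxes of multi-indices *)

Section multi_index_box.

Fixpoint mbox (N k : nat) : seq (seq nat) :=
  if k is k'.+1 then [seq n :: al | n <- index_iota 0 N, al <- mbox N k'] else [:: [::]].

Lemma size_mbox N k : size (mbox N k) = (N ^ k)%N.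
Proof. by elim: k => //= k IH; rewrite size_allpairs IH size_iota subn0 expnS. Qed.

Lemma mem_mbox N k al : (al \in mbox N k) = (size al == k) && all (fun n => n < N)%N al.
Proof.
elim: k al => [|k IH] [|n al] //=.

- by apply/allpairsP => -[[m be]] [].
- rewrite eqSS; apply/allpairsP/andP => [[[m be]] [/= hm hbe [-> ->]]|[h1 /andP[h2 h3]]].
    by move: hm hbe; rewrite mem_index_iota IH => /= -> /andP[-> ->].
  by exists (n, al); rewrite /= mem_index_iota IH h1 h2 h3.
Qed.

Lemma uniq_mbox N k : uniq (mbox N k).
Proof.
elim: k => //= k IH; apply: allpairs_uniq => //; first exact: iota_uniq.
by move=> [m al] [n be] _ _ /= [-> ->].
Qed.

Lemma sub_mbox M N k : (M <= N)%N -> {subset mbox M k <= mbox N k}.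
Proof.
move=> MN al; rewrite !mem_mbox => /andP[-> /allP h]; apply/allP => n /h hn.
exact: leq_trans hn MN.
Qed.

Lemma sumn_notin_mbox N k al : size al = k -> al \notin mbox N k -> (N <= sumn al)%N.
Proof.
move=> sal; rewrite mem_mbox sal eqxx /= => /allPn[n nal]; rewrite -leqNgt => /leq_trans; apply.
by elim: al {sal} nal => //= m al IH; rewrite inE => /orP[/eqP ->|/IH h];
  [exact: leq_addr|rewrite (leq_trans h)// leq_addl].
Qed.

Lemma sum_half_nat (R : realType) N : \sum_(0 <= n < N) (2^-1 : R) ^+ n <= 2.
Proof.
suff -> : \sum_(0 <= n < N) (2^-1 : R) ^+ n = 2 - 2 * 2^-1 ^+ N.
  by rewrite lerBlDr lerDl mulr_ge0// exprn_ge0// invr_ge0.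
elim: N => [|N IH]; first by rewrite big_geq// expr0; ring.
by rewrite big_nat_recr//= IH exprS; field.
Qed.

Lemma sum_half_mbox (R : realType) N k :
  \sum_(al <- mbox N k) (2^-1 : R) ^+ sumn al <= 2 ^+ k.
Proof.
have S1 := sum_half_nat R N.
elim: k => [|k IH]; first by rewrite /= big_seq1.
rewrite /= big_allpairs_dep /=.
under eq_bigr do under eq_bigr do rewrite exprD.
under eq_bigr do rewrite -mulr_sumr.
rewrite -mulr_suml exprS; apply: ler_pM => //; apply: sumr_ge0 => ? _;
  by rewrite exprn_ge0// invr_ge0.
Qed.

End multi_index_box.

(** * Newton expansion in several variables *)

Section polydisc_expansion.
Context {R : realType} {d : nat}.
Local Notation C := R[i].
Implicit Types (G : 'rV[C]_d -> C) (u v : 'rV[C]_d) (i j : 'I_d) (t : C).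

Definition upd u i t : 'rV[C]_d := \row_j (if j == i then t else u 0 j).

Lemma updE u i t j : upd u i t 0 j = if j == i then t else u 0 j.
Proof. by rewrite mxE. Qed.

Lemma upd_same u i s t : upd (upd u i s) i t = upd u i t.
Proof. by apply/rowP => j; rewrite !updE; case: eqP. Qed.

Lemma upd_swap u i j s t : i != j -> upd (upd u i s) j t = upd (upd u j t) i s.
Proof.
by move=> ij; apply/rowP => k; rewrite !updE; case: (eqVneq k j) => // ->; rewrite eq_sym (negbTE ij).
Qed.

Lemma upd_id u i : upd u i (u 0 i) = u.
Proof. by apply/rowP => j; rewrite updE; case: eqP => // ->. Qed.

Definition in_polysquare (r : R) u := forall j, in_square r (u 0 j).

(** Holomorphy is asked in each variable separately, which is the form in which the one-variable
    expansion is iterated. *)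
Definition polysquare_holo (r M : R) G := forall u, in_polysquare r u ->
  normc (G u) <= M /\ forall i, derivable (fun t => G (upd u i t)) (u 0 i) 1.

Variables (r : R) (zeta : nat -> C) (a : nat -> nat -> C) (h : nat -> C -> C).
Hypothesis r0 : 0 < r.
Hypothesis zeta_small : forall m : nat, normc (zeta m) <= r / 32.
Hypothesis h_small : forall n z, normc z <= r / 32 -> normc (h n z) <= 4^-1 ^+ n.
Hypothesis a_small : forall g M n, square_bounded_holo r M g ->
      normc (\sum_(0 <= i < n.+1) a n i * g (zeta i)) <= 8 * 2^-1 ^+ n * M.
Hypothesis newton_rem : forall g M N z, square_bounded_holo r M g -> normc z <= r / 32 ->
      normc (g z - \sum_(0 <= n < N) h n z * \sum_(0 <= i < n.+1) a n i * g (zeta i))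
        <= 8 * 2^-1 ^+ N * M.

Definition ndiff i n G : 'rV[C]_d -> C :=
  fun u => \sum_(0 <= m < n.+1) a n m * G (upd u i (zeta m)).

(** The coordinates in [s] are treated one after the other. Once all those on which the function
    depends are used up it is constant, and evaluating at 0 returns that constant. *)
Fixpoint mdiff (s : seq 'I_d) (al : seq nat) G : C :=
  match s, al with
  | i :: s', n :: al' => mdiff s' al' (ndiff i n G)
  | _, _ => G 0
  end.

Fixpoint mbasis (s : seq 'I_d) (al : seq nat) u : C :=
  match s, al with
  | i :: s', n :: al' => h n (u 0 i) * mbasis s' al' u
  | _, _ => 1
  end.

Lemma in_square0 : in_square r (0 : C).
Proof. by rewrite /in_square /in_rect (_ : Re 0 = 0)// (_ : Im 0 = 0)// oppr_le0 (ltW r0). Qed.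

Lemma in_square_zeta m : in_square r (zeta m).
Proof.
have := zeta_small m; have := ler_Re_normc (zeta m); have := ler_Im_normc (zeta m).
by rewrite !ler_norml /in_square /in_rect; lra.
Qed.

Lemma in_polysquare_upd u i t : in_polysquare r u -> in_square r t ->
  in_polysquare r (upd u i t).
Proof. by move=> hu ht j; rewrite updE; case: eqP. Qed.

Lemma slice_holo M G u i : polysquare_holo r M G -> in_polysquare r u ->
  square_bounded_holo r M (fun t => G (upd u i t)).
Proof.
move=> hG hu; split=> w hw; have [h1 h2] := hG _ (in_polysquare_upd i hu hw) => //.
have := h2 i; rewrite updE eqxx.
by under eq_fun do rewrite upd_same.
Qed.

Lemma ndiff_holo M G i n : polysquare_holo r M G ->
  polysquare_holo r (8 * 2^-1 ^+ n * M) (ndiff i n G).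
Proof.
move=> hG u hu; split.
  exact: a_small (slice_holo i hG hu).
move=> j; apply: (derivable_bigsum (F := fun m t => a n m * G (upd (upd u j t) i (zeta m)))) => m.
apply: (derivableM (f := cst (a n m))); first exact: derivable_cst.
have [->|ij] := eqVneq i j.
  rewrite (_ : (fun t => _) = cst (G (upd u j (zeta m)))); first exact: derivable_cst.
  by apply/funext => t; rewrite upd_same.
have [_ /(_ j)] := hG _ (in_polysquare_upd i hu (in_square_zeta m)).
rewrite updE eq_sym (negbTE ij).
rewrite (_ : (fun t => G (upd (upd u i (zeta m)) j t)) =
  (fun t => G (upd (upd u j t) i (zeta m))))//.
by apply/funext => t; rewrite upd_swap.
Qed.

Lemma mdiff_bound s al M G : size al = size s -> polysquare_holo r M G ->
  normc (mdiff s al G) <= 8 ^+ size s * 2^-1 ^+ sumn al * M.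
Proof.
elim: s al M G => [|i s IH] [|n al] M G //= => [_|[sal]] hG.
  have [|h0 _] := hG 0; last by rewrite !expr0 !mul1r.
  by move=> j; rewrite mxE; exact: in_square0.
apply: le_trans (IH _ _ _ sal (ndiff_holo i n hG)) _.
rewrite le_eqVlt; apply/orP; left; apply/eqP; rewrite exprS exprD; ring.
Qed.

Lemma mbasis_bound s al u : size al = size s -> (forall j, normc (u 0 j) <= r / 32) ->
  normc (mbasis s al u) <= 4^-1 ^+ sumn al.
Proof.
move=> + hu; elim: s al => [|i s IH] [|n al] //= => [_|[sal]].
  by rewrite expr0 expr0n /= addr0 expr1n sqrtr1.
rewrite exprD normcM; apply: ler_pM; rewrite ?normc_ge0//; last exact: IH.
exact: h_small.
Qed.

Lemma mdiff_linear s al (k : C) G1 G2 :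
  mdiff s al (fun u => k * G1 u + G2 u) = k * mdiff s al G1 + mdiff s al G2.
Proof.
elim: s al G1 G2 => [|i s IH] [|n al] G1 G2 //=.
rewrite -IH; congr mdiff; apply/funext => u.
rewrite /ndiff mulr_sumr -big_split; apply: eq_bigr => m _ /=; ring.
Qed.

(** Recursion of the error constants: 8 is the one-variable remainder, and 16 is the factor 8 of a
    divided difference times the sum 2 of the geometric series over its orders. *)
Fixpoint mconst (k : nat) : R := if k is k'.+1 then 8 + 16 * mconst k' else 0.

Lemma mconst_ge0 k : 0 <= mconst k.
Proof. by elim: k => //= k IH; rewrite addr_ge0// mulr_ge0. Qed.

(** Restricting the dependence of [G] to the coordinates in [s] makes the base case trivial, [G]
    being constant for empty [s], and is inherited since [ndiff i] removes the dependence on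
    coordinate [i]. *)
Lemma mdiff_expansion s M N G u :
  (forall v w : 'rV[C]_d, (forall j, j \in s -> v 0 j = w 0 j) -> G v = G w) ->
  polysquare_holo r M G -> (forall j, normc (u 0 j) <= r / 32) ->
  normc (G u - \sum_(al <- mbox N (size s)) mbasis s al u * mdiff s al G) <=
    mconst (size s) * 2^-1 ^+ N * M.
Proof.
move=> + + hu.
have usq : in_polysquare r u.
  move=> j; have := hu j; have := ler_Re_normc (u 0 j); have := ler_Im_normc (u 0 j).
  by rewrite !ler_norml /in_square /in_rect; lra.
have M0 M' G' : polysquare_holo r M' G' -> 0 <= M'.
  by move=> /(_ u usq)[+ _]; apply: le_trans; exact: normc_ge0.
elim: s M G => [|i s IH] M G dep hG.
  by rewrite /= big_seq1 mul1r (dep u 0)// subrr ComplexField.Normc.normc0 !mul0r.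
have slc := slice_holo i hG usq.
have rem := newton_rem N slc (hu i); rewrite upd_id in rem.
rewrite /= big_allpairs_dep /=.
under eq_bigr do under eq_bigr do rewrite -mulrA.
under eq_bigr do rewrite -mulr_sumr.
(* The error splits into the Newton remainder in coordinate [i] and the errors made in expanding
   each divided difference in the other coordinates. *)
have -> : G u - \sum_(0 <= n < N) h n (u 0 i) *
      \sum_(al <- mbox N (size s)) mbasis s al u * mdiff s al (ndiff i n G) =
    (G u - \sum_(0 <= n < N) h n (u 0 i) * ndiff i n G u) +
    \sum_(0 <= n < N) h n (u 0 i) * (ndiff i n G u -
      \sum_(al <- mbox N (size s)) mbasis s al u * mdiff s al (ndiff i n G)).
  rewrite [X in _ = _ + X](eq_bigr _ (fun n _ => mulrBr _ _ _)).
  by rewrite sumrB addrA subrK.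
apply: le_trans (ler_normcD _ _) _; 
rewrite (_ : (8 + 16 * mconst (size s)) * 2^-1 ^+ N * M =
  8 * 2^-1 ^+ N * M + 16 * mconst (size s) * 2^-1 ^+ N * M); last by ring.
apply: lerD => //.
apply: le_trans (ler_normc_sum _ _ _) _.
apply: (@le_trans _ _ (\sum_(0 <= n < N) 2^-1 ^+ n * (8 * mconst (size s) * 2^-1 ^+ N * M))).
  apply: ler_sum => n _; rewrite normcM.
  have hn := h_small n (hu i).
  have dep' (v w : 'rV[C]_d) : (forall j, j \in s -> v 0 j = w 0 j) -> ndiff i n G v = ndiff i n G w.
    move=> vw; apply: eq_bigr => m _; congr (_ * _); apply: dep => j.
    by rewrite inE !updE; case: eqP => //= _ /vw.
  have := IH _ _ dep' (ndiff_holo i n hG).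
  move=> /(ler_pM (normc_ge0 _) (normc_ge0 _) hn) /le_trans; apply.
  have -> : 4^-1 ^+ n * (mconst (size s) * 2^-1 ^+ N * (8 * 2^-1 ^+ n * M)) =
     (4^-1 ^+ n * 2^-1 ^+ n) * (8 * mconst (size s) * 2^-1 ^+ N * M) by ring.
  apply: ler_wpM2r; first by rewrite !mulr_ge0 ?mconst_ge0 ?exprn_ge0 ?invr_ge0 ?(M0 _ _ hG).
  by rewrite -exprMn; apply: lerXn2r; rewrite ?nnegrE//; lra.
rewrite -mulr_suml.
have S2 := sum_half_nat R N.
have -> : 16 * mconst (size s) * 2^-1 ^+ N * M = 2 * (8 * mconst (size s) * 2^-1 ^+ N * M) by ring.
apply: ler_wpM2r => //.
by rewrite !mulr_ge0 ?mconst_ge0 ?exprn_ge0 ?invr_ge0 ?(M0 _ _ hG).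
Qed.

End polydisc_expansion.

(* Y al is the rescaled divided difference of order al, H al the corresponding
   Newton basis polynomial. *)
Theorem polysquare_expansion (R : realType) (d : nat) (r : R) : 0 < r ->
  exists (Y : seq nat -> ('rV[R[i]]_d -> R[i]) -> R[i])
    (H : seq nat -> 'rV[R[i]]_d -> R[i]) (E : R),
  [/\ forall al (k : R[i]) G1 G2, Y al (fun u => k * G1 u + G2 u) = k * Y al G1 + Y al G2,
    forall al M G, size al = d -> polysquare_holo r M G ->
      normc (Y al G) <= 8 ^+ d * 2^-1 ^+ sumn al * M,
    forall al (u : 'rV[R[i]]_d), size al = d -> (forall j, normc (u 0 j) <= r / 32) ->
      normc (H al u) <= 4^-1 ^+ sumn al &
    forall M N G (u : 'rV[R[i]]_d), polysquare_holo r M G -> (forall j, normc (u 0 j) <= r / 32) ->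
      normc (G u - \sum_(al <- mbox N d) H al u * Y al G) <= E * 2^-1 ^+ N * M].
Proof.
move=> r0; have [zeta [a [h [h1 h2 h3 h4]]]] := newton_expansion r0.
have sd : size (enum 'I_d) = d by rewrite size_enum_ord.
exists (mdiff zeta a (enum 'I_d)), (mbasis h (enum 'I_d)), (@mconst R d).
split.
- by move=> al k G1 G2; exact: mdiff_linear.
- move=> al M G sal hG.
  have := mdiff_bound r0 h1 h3 (s := enum 'I_d) (al := al) _ hG.
  by rewrite sd => /(_ sal).
- by move=> al u sal hu; apply: (mbasis_bound h2) => //; rewrite sd.
- move=> M N G u hG hu.
  have := mdiff_expansion h1 h2 h3 h4 N (s := enum 'I_d) _ hG hu.
  rewrite sd; apply => v w vw; congr G; apply/rowP => j.
  by rewrite -(vw j) ?mem_enum.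
Qed.

(** * Almost orthogonal systems and determinants *)

Section near_orthogonal_system.
Context {R : realType}.
Local Notation C := R[i].
Context {E : lmodType C}.
Implicit Types (f g e u w : E) (k : C) (n m : nat).

Lemma normc_sqr (z : C) : normc z ^+ 2 = Re z ^+ 2 + Im z ^+ 2.
Proof. by case: z => a b /=; rewrite sqr_sqrtr// addr_ge0 ?sqr_ge0. Qed.

(** A form of the parallelogram law; summed over the functionals it expresses the Hilbert character
    of [sqsum] without an inner product. *)
Lemma normc_sqr_convex (a b : C) (t : R) :
  normc (a + t%:C * b) ^+ 2 =
  (1 - t) * normc a ^+ 2 + t * normc (a + b) ^+ 2 - t * (1 - t) * normc b ^+ 2.
Proof. by rewrite !normc_sqr; case: a b => [a1 a2] [b1 b2] /=; ring. Qed.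

Variable x : nat -> E -> C.
Hypothesis x_linear : forall n k f g, x n (k *: f + g) = k * x n f + x n g.

Definition sqsum f : R := limn (series (fun n => normc (x n f) ^+ 2)).

Definition vanishing n f := forall m, (m < n)%N -> x m f = 0.

Hypothesis x_cvg : forall f, cvgn (series (fun n => normc (x n f) ^+ 2)).

Lemma x0 n : x n 0 = 0.
Proof.
have := x_linear n 1 0 0; rewrite scale1r addr0 mul1r => /eqP.
by rewrite -subr_eq0 opprD addNKr oppr_eq0 => /eqP.
Qed.

Lemma xZ n k f : x n (k *: f) = k * x n f.
Proof. by have := x_linear n k f 0; rewrite addr0 x0 addr0. Qed.

Lemma xD n f g : x n (f + g) = x n f + x n g.
Proof. by have := x_linear n 1 f g; rewrite scale1r mul1r. Qed.

Lemma xB n f g : x n (f - g) = x n f - x n g.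
Proof. by rewrite addrC -scaleN1r x_linear mulN1r addrC. Qed.

Lemma vanishingZ n k f : vanishing n f -> vanishing n (k *: f).
Proof. by move=> h m /h hm; rewrite xZ hm mulr0. Qed.

Lemma vanishingD n f g : vanishing n f -> vanishing n g -> vanishing n (f + g).
Proof. by move=> h h' m hm; rewrite xD h// h'// addr0. Qed.

Lemma partial_sqsum_le f n : series (fun n => normc (x n f) ^+ 2) n <= sqsum f.
Proof.
apply: nondecreasing_cvgn_le => //; apply/nondecreasing_seqP => m.
by rewrite /series/= big_nat_recr//= lerDl sqr_ge0.
Qed.

Lemma sqsum_ge0 f : 0 <= sqsum f.
Proof. by apply: le_trans (partial_sqsum_le f 0); rewrite /series/= big_geq. Qed.

Lemma sqr_x_le f n : normc (x n f) ^+ 2 <= sqsum f.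
Proof.
apply: le_trans (partial_sqsum_le f n.+1).
rewrite /series/= big_nat_recr//= lerDr sumr_ge0// => ? _; exact: sqr_ge0.
Qed.

Lemma sqsumZ k f : sqsum (k *: f) = normc k ^+ 2 * sqsum f.
Proof.
apply: cvg_lim => //.
rewrite (_ : series _ = (fun n => normc k ^+ 2 * series (fun n => normc (x n f) ^+ 2) n)).
  by apply: cvgMr; exact: x_cvg.
apply/funext => n; rewrite /series/= mulr_sumr; apply: eq_bigr => i _.
by rewrite xZ normcM exprMn.
Qed.

Lemma sqsum_convex e u (t : R) : sqsum (e + t%:C *: u) =
  (1 - t) * sqsum e + t * sqsum (e + u) - t * (1 - t) * sqsum u.
Proof.
apply: cvg_lim => //.
rewrite (_ : series _ = (fun n => (1 - t) * series (fun n => normc (x n e) ^+ 2) n +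
   t * series (fun n => normc (x n (e + u)) ^+ 2) n -
   t * (1 - t) * series (fun n => normc (x n u) ^+ 2) n)).
  by apply: cvgB; [apply: cvgD|]; apply: cvgMr; exact: x_cvg.
apply/funext => n; rewrite /series/= !mulr_sumr -big_split -sumrB; apply: eq_bigr => i _ /=.
by rewrite !xD xZ normc_sqr_convex.
Qed.

(** The infimum of [sqsum] under [x n f = 1] is at least 1, since [sqsum] contains that square, but
    it may fail to be attained: hence the slack [d]. Normalizing to [sqsum e = 1] turns near
    minimality into a bound on [x n f / x n e]. The case [e = 0] occurs when the vanishing of the
    first [n] functionals forces that of [x n]. *)
Lemma near_minimizer n (d : R) : 0 < d -> d < 1 -> exists e, vanishing n e /\
  ((e = 0 /\ forall f, vanishing n f -> x n f = 0) \/
   [/\ sqsum e = 1, x n e != 0 &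
     forall f, vanishing n f -> normc (x n f / x n e) ^+ 2 * (1 - d) <= sqsum f]).
Proof.
move=> d0 d1.
have [all0|] := pselect (forall f, vanishing n f -> x n f = 0).
  by exists 0; split; [move=> m _; exact: x0|left].
move=> /existsNP[f0 /not_implyP[hf0 xf0]].
pose S := [set sqsum g | g in [set g | vanishing n g /\ x n g = 1]].
have S0 : S !=set0.
  exists (sqsum ((x n f0)^-1 *: f0)), ((x n f0)^-1 *: f0) => //=; split.
    exact: vanishingZ.
  by rewrite xZ mulVf//; exact/eqP.
have Slb : lbound S 1.
  by move=> _ [g [_ xg] <-]; apply: le_trans (sqr_x_le g n); rewrite xg ComplexField.Normc.normc1 expr1n.
have I1 : 1 <= inf S by exact: lb_le_inf.
have I0 : 0 < inf S by exact: lt_le_trans I1.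
have d1' : 0 < 1 - d by rewrite subr_gt0.
have [_ [g [hg xg] <-] glt] : exists2 y, S y & y < inf S / (1 - d).
  by apply: inf_lt => //; rewrite ltr_pdivlMr// gtr_pMr// gtrBl.
have Sg : inf S <= sqsum g by apply: ge_inf; [exists 1|exists g].
have g0 : 0 < sqsum g by exact: lt_le_trans Sg.
pose s : C := (Num.sqrt (sqsum g))%:C.
have s0 : s != 0 by rewrite -normc_eq0 normcR normr_eq0 sqrtr_eq0 -ltNge.
have ns : normc s ^+ 2 = sqsum g.
  by rewrite normcR real_normK ?num_real// sqr_sqrtr// ltW.
exists (s^-1 *: g); split; first exact: vanishingZ.
right; split.
- by rewrite sqsumZ normcV exprVn ns mulVf// gt_eqF.
- by rewrite xZ xg mulr1 invr_eq0.
- move=> f hf; rewrite xZ xg mulr1 invrK.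
  have [->|xf0'] := eqVneq (x n f) 0.
    by rewrite mul0r ComplexField.Normc.normc0 expr0n mul0r sqsum_ge0.
  have : inf S <= sqsum ((x n f)^-1 *: f).
    apply: ge_inf; first by exists 1.
    exists ((x n f)^-1 *: f) => //=; split; first exact: vanishingZ.
    by rewrite xZ mulVf.
  rewrite sqsumZ normcV exprVn mulrC ler_pdivlMr ?exprn_gt0 ?normc_gt0// => h.
  apply: le_trans h; rewrite normcM exprMn ns mulrAC -mulrA mulrC ler_pM2r; last first.
    by rewrite exprn_gt0 ?normc_gt0.
  by rewrite mulrC -ler_pdivlMr// ltW.
Qed.

Variable delta : nat -> R.
Variable e : nat -> E.
Hypothesis delta_bnd : forall n, 0 < delta n < 1.
Hypothesis e_vanishing : forall n, vanishing n (e n).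
Hypothesis e_min : forall n,
  (e n = 0 /\ forall f, vanishing n f -> x n f = 0) \/
   [/\ sqsum (e n) = 1, x n (e n) != 0 &
     forall f, vanishing n f ->
       normc (x n f / x n (e n)) ^+ 2 * (1 - delta n ^+ 2) <= sqsum f].

(** Gaussian elimination, each step killing one more functional. If [e n' = 0] nothing is
    subtracted, and [x n'] vanishes already. *)
Fixpoint remainder n f : E :=
  if n is n'.+1 then
    remainder n' f - (x n' (remainder n' f) / x n' (e n')) *: e n'
  else f.

Definition coefficient n f : C := x n (remainder n f) / x n (e n).

Lemma remainderE n f : remainder n f = f - \sum_(0 <= k < n) coefficient k f *: e k.
Proof.
elim: n => [|n IH]; first by rewrite big_geq// subr0.
by rewrite big_nat_recr//= opprD addrA -IH.
Qed.

Lemma remainder_linear n k f g :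
  remainder n (k *: f + g) = k *: remainder n f + remainder n g.
Proof.
elim: n => //= n ->; rewrite x_linear mulrDl scalerDl opprD addrACA.
by rewrite -mulrA -scalerA -scalerBr.
Qed.

Lemma coefficient_linear n k f g :
  coefficient n (k *: f + g) = k * coefficient n f + coefficient n g.
Proof. by rewrite /coefficient remainder_linear x_linear mulrDl mulrA. Qed.

Lemma remainder_vanishing n f : vanishing n (remainder n f).
Proof.
elim: n => [|n IH] //= m; rewrite ltnS leq_eqVlt => /orP[/eqP ->|mn]; last first.
  by rewrite xB xZ (IH _ mn) (e_vanishing mn) mulr0 subr0.
case: (e_min n) => [[-> h]|[_ h _]]; first by rewrite scaler0 subr0 h.
by rewrite xB xZ divfK// subrr.
Qed.

(* Minimality of e n is tested on e n + delta u, and convexity along the line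
   through e n and e n + u turns it into almost orthogonality. *)
Lemma remainder_step n f : (1 - delta n) *
  (normc (coefficient n f) ^+ 2 + sqsum (remainder n.+1 f)) <= sqsum (remainder n f).
Proof.
have /andP[d0 d1] := delta_bnd n.
have key r : 0 <= r -> (1 - delta n) * r <= r.
  by move=> r0; rewrite mulrBl mul1r lerBlDr lerDl mulr_ge0// ltW.
have c0 : coefficient n f = 0 -> (1 - delta n) *
  (normc (coefficient n f) ^+ 2 + sqsum (remainder n.+1 f)) <= sqsum (remainder n f).
  move=> c0 /=; rewrite c0 -/(coefficient n f) c0 scale0r subr0.
  by rewrite ComplexField.Normc.normc0 expr0n add0r key// sqsum_ge0.
case: (e_min n) => [[en0 h]|[en1 xe hmin]].
  by apply: c0; rewrite /coefficient en0 x0 invr0 mulr0.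
have [/c0//|cn0] := eqVneq (coefficient n f) 0.
set c := coefficient n f in cn0 *.
have c2 : 0 < normc c ^+ 2 by rewrite exprn_gt0// normc_gt0.
have [u uE] : exists u, u = c^-1 *: remainder n.+1 f by eexists.
have fE : remainder n f = c *: (e n + u).
  rewrite uE scalerDr scalerA mulfV// scale1r /= -/(coefficient n f) -/c addrC subrK//.
have -> : remainder n.+1 f = c *: u by rewrite uE scalerA mulfV// scale1r.
rewrite fE !sqsumZ. rewrite (_ : (1 - delta n) * _ =
  normc c ^+ 2 * ((1 - delta n) * (1 + sqsum u))); last by ring.
rewrite ler_pM2l//.
have uv : vanishing n.+1 u by rewrite uE; apply: vanishingZ; exact: remainder_vanishing.
have vu : vanishing n (e n + (delta n)%:C *: u).
  by apply: vanishingD => //; apply: vanishingZ => m /ltnW mn; exact: uv.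
have := hmin _ vu.
rewrite xD xZ (uv n)// mulr0 addr0 mulfV// ComplexField.Normc.normc1 expr1n mul1r.
rewrite sqsum_convex en1 => h1.
(* The slack is [delta n ^+ 2] and the step along [u] is [delta n]: dividing by [delta n] leaves
   only the loss [1 - delta n]. *)
rewrite -(ler_pM2l d0); nra.
Qed.

End near_orthogonal_system.

(* The coefficients of f lose only the factor prod (1 - 1/(n+2)^2) = 1/2. *)
Theorem near_orthogonal_basis (R : realType) (E : lmodType R[i]) (x : nat -> E -> R[i])
    (x_linear : forall n k f g, x n (k *: f + g) = k * x n f + x n g)
    (x_cvg : forall f, cvgn (series (fun n => normc (x n f) ^+ 2))) :
  exists (e : nat -> E) (c : nat -> E -> R[i]),
  [/\ forall n k f g, c n (k *: f + g) = k * c n f + c n g,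
    forall n, vanishing x n (e n) /\ (e n = 0 \/ sqsum x (e n) = 1),
    forall n f (r := f - \sum_(0 <= k < n) c k f *: e k),
      vanishing x n r /\ sqsum x r <= 2 * sqsum x f,
    forall n f, normc (c n f) ^+ 2 <= 2 * sqsum x f &
    forall k n, e n != 0 -> c k (e n) = (k == n)%:R].
Proof.
pose delta n : R := (n.+2%:R ^+ 2)^-1.
have n2 n : 0 < n.+2%:R ^+ 2 :> R by rewrite exprn_gt0.
have n3 n : 1 < n.+2%:R ^+ 2 :> R by rewrite expr_gt1// ltr1n.
have dbnd n : 0 < delta n < 1.
  by rewrite /delta invr_gt0 n2 invf_lt1// n3.
have /choice[e he] : forall n, exists e, vanishing x n e /\
  ((e = 0 /\ forall f, vanishing x n f -> x n f = 0) \/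
   [/\ sqsum x e = 1, x n e != 0 &
     forall f, vanishing x n f -> normc (x n f / x n e) ^+ 2 * (1 - delta n ^+ 2) <= sqsum x f]).
  move=> n; have /andP[d0 d1] := dbnd n.
  by apply: (near_minimizer x_linear x_cvg); rewrite ?exprn_gt0// exprn_ilt1// ltW.
have e_van n : vanishing x n (e n) by case: (he n).
have e_min n := (he n).2.
pose c := coefficient x e; pose rm := remainder x e.
exists e, c.
have rmE n f : f - \sum_(0 <= k < n) c k f *: e k = rm n f by rewrite /rm remainderE.
(* Telescoping: the factor is the product of [1 - delta k] over [k < n]. *)
have rem_bnd n f : (n.+2%:R / (2 * n.+1%:R)) * sqsum x (rm n f) <= sqsum x f.
  elim: n => [|n IH]; first by rewrite mulr1 divff// mul1r.
  have n10 : n.+1%:R != 0 :> R by rewrite pnatr_eq0.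
  have n20 : n.+2%:R != 0 :> R by rewrite pnatr_eq0.
  apply: le_trans IH.
  have -> : n.+3%:R / (2 * n.+2%:R) = n.+2%:R / (2 * n.+1%:R) * (1 - delta n) :> R.
    by rewrite /delta -[n.+3]addn1 -[n.+2]addn1 -[n.+1]addn1 !natrD in n10 n20 *; field; rewrite n10 n20.
  rewrite -[X in X <= _]mulrA; apply: ler_wpM2l; first by rewrite divr_ge0// mulr_ge0.
  apply: le_trans (remainder_step x_linear x_cvg dbnd e_van e_min n f).
  by apply: ler_wpM2l; rewrite ?lerDr ?sqr_ge0// subr_ge0 ltW//; case/andP: (dbnd n).
have half n : (2^-1 : R) <= n.+2%:R / (2 * n.+1%:R).
  by rewrite invfM mulrCA ler_peMr ?invr_ge0// ler_pdivlMr// mul1r ler_nat.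
have c_bnd n f : normc (c n f) ^+ 2 <= 2 * sqsum x f.
  have h1 : (n.+3%:R / (2 * n.+2%:R)) * normc (c n f) ^+ 2 <= sqsum x f.
    apply: le_trans (rem_bnd n f).
    have n10 : n.+1%:R != 0 :> R by rewrite pnatr_eq0.
    have n20 : n.+2%:R != 0 :> R by rewrite pnatr_eq0.
    have -> : n.+3%:R / (2 * n.+2%:R) = n.+2%:R / (2 * n.+1%:R) * (1 - delta n) :> R.
      by rewrite /delta -[n.+3]addn1 -[n.+2]addn1 -[n.+1]addn1 !natrD in n10 n20 *; field; rewrite n10 n20.
    rewrite -[X in X <= _]mulrA; apply: ler_wpM2l; first by rewrite divr_ge0// mulr_ge0.
    apply: le_trans (remainder_step x_linear x_cvg dbnd e_van e_min n f).
    by apply: ler_wpM2l; rewrite ?lerDl ?sqsum_ge0// subr_ge0 ltW//; case/andP: (dbnd n).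
  have := le_trans (ler_wpM2r (sqr_ge0 (normc (c n f))) (half n.+1)) h1.
  by rewrite ler_pdivrMl.
split=> //.
- by move=> n k f g; exact: coefficient_linear.
- by move=> n; split=> //; case: (e_min n) => [[]|[]]; [left|right].
- move=> n f /=; rewrite rmE; split; first exact: remainder_vanishing.
  have := le_trans (ler_wpM2r (sqsum_ge0 x_cvg (rm n f)) (half n)) (rem_bnd n f).
  by rewrite ler_pdivrMl.
- move=> k n en0.
  have xe : x n (e n) != 0 by case: (e_min n) => [[e0]|[]//]; rewrite e0 eqxx in en0.
  have rmS j f : rm j.+1 f = rm j f - (x j (rm j f) / x j (e j)) *: e j by [].
  (* Before step [n] the elimination leaves [e n] untouched, because [e n] vanishes there; step [n]
     itself turns it into 0. *)
  have low j : (j <= n)%N -> rm j (e n) = e n.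
    elim: j => // j IH jn; rewrite rmS IH; last exact: ltnW.
    by rewrite (e_van n j jn) mul0r scale0r subr0.
  have high j : rm (n.+1 + j)%N (e n) = 0.
    elim: j => [|j IH]; first by rewrite addn0 rmS low// divff// scale1r subrr.
    by rewrite addnS rmS IH x0// mul0r scale0r subr0.
  rewrite /c /coefficient -/(rm k (e n)); case: (ltngtP k n) => kn.
  - by rewrite low ?(e_van n k kn) ?mul0r// ltnW.
  - by rewrite -(subnKC kn) high x0// mul0r.
  - by rewrite kn low// divff.
Qed.

Lemma sorted_ltn_nth_ge (s : seq nat) i : sorted ltn s -> (i < size s)%N -> (i <= nth 0%N s i)%N.
Proof.
move=> ss; elim: i => // i IH si.
apply: leq_ltn_trans (IH (ltnW si)) _.
by rewrite (sorted_ltn_nth ltn_trans)// inE// ltnW.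
Qed.

(** * Determinant of a matrix with decaying rows *)

Section determinant_bound.
Context {R : realType} {m : nat}.
Local Notation C := R[i].
Variables (x : nat -> 'rV[C]_m -> C) (A : 'M[C]_m) (sigma : nat -> R).
Hypothesis x_linear : forall n k f g, x n (k *: f + g) = k * x n f + x n g.
Hypothesis x_cvg : forall f, cvgn (series (fun n => normc (x n f) ^+ 2)).
Hypothesis sqsum_inj : forall v, sqsum x v = 0 -> v = 0.
Hypothesis sigma_ge0 : forall n, 0 <= sigma n.
Hypothesis sigma_dec : forall n p, (n <= p)%N -> sigma p <= sigma n.
Hypothesis A_small : forall n v, vanishing x n v ->
  sqsum x (v *m A) <= sigma n ^+ 2 * sqsum x v.

(** The decay is carried by the rows alone, the coefficients [c n] being merely bounded; hence every
    permutation in Leibniz' formula receives the same bound. *)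
Lemma normc_det_le : normc (\det A) <= m`!%:R * \prod_(0 <= i < m) (2 * sigma i).
Proof.
have [e [c [c_lin e_van rem_bnd c_bnd c_e]]] := near_orthogonal_basis x_linear x_cvg.
pose J N := [seq n <- iota 0 N | e n != 0].
pose EJ N p : 'M[C]_(p, m) := \matrix_(i < p, j < m) e (nth 0%N (J N) i) 0 j.
pose CJ N p : 'M[C]_(m, p) := \matrix_(i < m, j < p) c (nth 0%N (J N) j) (delta_mx 0 i).
have c0 n : c n 0 = 0.
  by have := c_lin n (-1) 0 0; rewrite scaler0 addr0 mulN1r addNr.
have cE n v : c n v = \sum_i v 0 i * c n (delta_mx 0 i).
  rewrite {1}(row_sum_delta v).
  have cS (s : seq 'I_m) : c n (\sum_(i <- s) v 0 i *: delta_mx 0 i) =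
      \sum_(i <- s) v 0 i * c n (delta_mx 0 i).
    elim: s => [|i s IH]; first by rewrite !big_nil c0.
    by rewrite !big_cons c_lin IH.
  exact: cS.
have mulCJ N p k (M : 'M[C]_(k, m)) i j :
    (M *m CJ N p) i j = c (nth 0%N (J N) j) (row i M).
  by rewrite [LHS]mxE [RHS]cE; apply: eq_bigr => l _; rewrite [CJ _ _ _ _]mxE [row _ _ _ _]mxE.
have J_uniq N : uniq (J N) by rewrite filter_uniq// iota_uniq.
have J_e N i : (i < size (J N))%N -> e (nth 0%N (J N) i) != 0.
  by move=> /(mem_nth 0%N); rewrite mem_filter => /andP[].
have EC N : EJ N (size (J N)) *m CJ N (size (J N)) = 1%:M.
  apply/matrixP => i j; rewrite mulCJ.
  have -> : row i (EJ N (size (J N))) = e (nth 0%N (J N) i).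
    by apply/rowP => l; rewrite !mxE.
  rewrite c_e ?J_e ?ltn_ord// mxE nth_uniq ?ltn_ord//.
  by rewrite eq_sym.
have Jm N : (size (J N) <= m)%N.
  exact: mulmx1_min (EC N).
(* Biorthogonality bounds the number of nonzero [e n] by [m]; past an [N] where this number is
   maximal, all of them vanish. *)
have [N HN] : exists N, forall n, (N <= n)%N -> e n = 0.
  have exP : exists k, `[< exists N, size (J N) = k >] by exists 0%N; apply/asboolP; exists 0%N.
  have ubP k : `[< exists N, size (J N) = k >] -> (k <= m)%N.
    by move=> /asboolP[N <-].
  case: (ex_maxnP exP ubP) => k /asboolP[N Nk] kmax; exists N => n Nn.
  apply/eqP; apply: contraT => en0.
  have : (size (J n.+1) <= size (J N))%N.
    by rewrite Nk; apply: kmax; apply/asboolP; exists n.+1.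
  rewrite /J !size_filter -[n.+1]addn1 iotaD count_cat /= add0n en0 addn1 leqNgt ltnS.
  by rewrite -[in iota 0 n](subnKC Nn) iotaD count_cat leq_addr.
(* Past [N] the remainder of [v] no longer changes, yet it vanishes to every order: its seminorm is
   0 and [sqsum_inj] applies. *)
have sumJ v : v = \sum_(k <- J N) c k v *: e k.
  have remN n : (N <= n)%N -> v - \sum_(0 <= k < n) c k v *: e k =
      v - \sum_(0 <= k < N) c k v *: e k.
    move=> Nn; rewrite (big_cat_nat _ (n := N))//=.
    rewrite [X in _ - (_ + X)](_ : _ = 0) ?addr0// big_nat big1//.
    by move=> k /andP[/HN -> _]; rewrite scaler0.
  have r0 : v - \sum_(0 <= k < N) c k v *: e k = 0.
    apply: sqsum_inj; apply: cvg_lim => //; rewrite (_ : series _ = cst 0).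
      exact: cvg_cst.
    apply/funext => k; rewrite /series /= big1// => n _.
    have [h _] := rem_bnd (maxn N n.+1) v.
    rewrite -(remN (maxn N n.+1) (leq_maxl _ _)) h ?leq_maxr//.
    by rewrite ComplexField.Normc.normc0 expr0n.
  move/eqP: r0; rewrite subr_eq0 => /eqP r0.
  rewrite [LHS]r0 /J big_filter /index_iota subn0 [RHS]big_mkcond.
  by apply: eq_bigr => k _; case: eqP => //= ->; rewrite scaler0.
have CE : CJ N (size (J N)) *m EJ N (size (J N)) = 1%:M.
  apply/row_matrixP => i; rewrite row_mul row1 [RHS](sumJ (delta_mx 0 i)).
  apply/rowP => j; rewrite summxE (big_nth 0%N) big_mkord mxE.
  by apply: eq_bigr => k _; rewrite !mxE.
have Jsz : size (J N) = m by apply/eqP; rewrite eqn_leq Jm (mulmx1_min CE).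
rewrite Jsz in CE.
have EC' : EJ N m *m CJ N m = 1%:M by have := EC N; rewrite Jsz.
pose B := EJ N m *m A *m CJ N m.
have detB : \det A = \det B.
  rewrite /B !det_mulmx mulrAC -det_mulmx EC' det1 mul1r//.
have B_small i j : normc (B i j) <= 2 * sigma i.
  rewrite /B mulCJ row_mul.
  have -> : row i (EJ N m) = e (nth 0%N (J N) i) by apply/rowP => l; rewrite !mxE.
  set p := nth 0%N (J N) i.
  (* The kept index in position [i] is at least [i], so [sigma p] may be replaced by [sigma i]. *)
  have hip : (i <= p)%N.
    apply: sorted_ltn_nth_ge; last by rewrite Jsz.
    by rewrite sorted_filter ?iota_ltn_sorted//; exact: ltn_trans.
  have := c_bnd (nth 0%N (J N) j) (e p *m A).
  have [evp] := e_van p; case=> [ep0|ep1].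
    by have := J_e N i; rewrite Jsz -/p ep0 eqxx => /(_ (ltn_ord i)).
  have := A_small evp; rewrite ep1 mulr1 => h1 h2.
  have h3 := sigma_dec hip. have h4 := sigma_ge0 p.
  have n0 := normc_ge0 (c (nth 0%N (J N) j) (e p *m A)).
  rewrite -(@ler_pXn2r _ 2)// ?nnegrE//; last by rewrite mulr_ge0.
  nra.
rewrite detB /determinant; apply: le_trans (ler_normc_sum _ _ _) _.
apply: (@le_trans _ _ (\sum_(s : 'S_m) \prod_(0 <= i < m) (2 * sigma i))).
  apply: ler_sum => s _; rewrite normcM normcX normcN ComplexField.Normc.normc1 expr1n mul1r.
  rewrite normc_prod big_mkord; apply: ler_prod => i _.
  by rewrite normc_ge0 B_small.
by rewrite sumr_const card_Sn mulr_natl.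
Qed.

End determinant_bound.

(** * Generalized eigenspaces and eigenvalue sequences *)

Section triangular_systems.
Context {R : realType}.
Local Notation C := R[i].
Context {E : lmodType C}.
Variable L : {linear E -> E}.
Implicit Types (s : seq (E * C)) (f g w : E) (z k : C).

Fixpoint lspan s f : Prop :=
  if s is p :: s' then exists k : C, lspan s' (f - k *: p.1) else f = 0.

Fixpoint free_system s : Prop :=
  if s is p :: s' then ~ lspan s' p.1 /\ free_system s' else True.

(* Each pair (w, z) consists of a generalized eigenvector w for z that is an
   eigenvector modulo the span of the rest of the list. *)
Fixpoint triangular_system s : Prop :=
  if s is p :: s' then
    [/\ triangular_system s', ~ lspan s' p.1, lspan s' (L p.1 - p.2 *: p.1)
      & generalized_eigenspace L p.2 p.1]
  else True.

Lemma lspan_linear s k f g : lspan s f -> lspan s g -> lspan s (k *: f + g).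
Proof.
elim: s f g => /= [|p s IH] f g; first by move=> -> ->; rewrite scaler0 addr0.
move=> [a ha] [b hb]; exists (k * a + b).
by rewrite scalerDl opprD addrACA -scalerA -scalerBr; exact: IH.
Qed.

Lemma lspan0 s : lspan s 0.
Proof. by elim: s => //= p s IH; exists 0; rewrite scale0r subr0. Qed.

Lemma lspanZ s k f : lspan s f -> lspan s (k *: f).
Proof. by move=> h; rewrite -[_ *: _]addr0; apply: lspan_linear => //; exact: lspan0. Qed.

Lemma lspanD s f g : lspan s f -> lspan s g -> lspan s (f + g).
Proof. by move=> hf hg; rewrite -[f]scale1r; exact: lspan_linear. Qed.

Lemma lspanB s f g : lspan s f -> lspan s g -> lspan s (f - g).
Proof. by move=> hf hg; rewrite addrC -scaleN1r; exact: lspan_linear. Qed.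

Lemma lspan_cons p s f : lspan s f -> lspan (p :: s) f.
Proof. by move=> h; exists 0; rewrite scale0r subr0. Qed.

Lemma lspan_filter (a : pred (E * C)) s f : lspan [seq p <- s | a p] f -> lspan s f.
Proof.
elim: s f => //= p s IH f; case: (a p) => /= [[k /IH h]|/IH h].
  by exists k.
by exists 0; rewrite scale0r subr0.
Qed.

Lemma triangular_free s : triangular_system s -> free_system s.
Proof. by elim: s => //= p s IH [/IH h1 h2 _ _]. Qed.

Lemma free_filter (a : pred (E * C)) s : free_system s -> free_system [seq p <- s | a p].
Proof.
elim: s => //= p s IH [h1 /IH h2]; case: (a p) => //=; split=> //.
by move=> /lspan_filter.
Qed.

Lemma triangular_stable s f : triangular_system s -> lspan s f -> lspan s (L f).
Proof.
elim: s f => /= [|p s IH] f; first by move=> _ ->; exact: linear0.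
move=> [hs _ hL _] [k hk]; exists (k * p.2).
have -> : L f - (k * p.2) *: p.1 = L (f - k *: p.1) + k *: (L p.1 - p.2 *: p.1).
  have -> : L (f - k *: p.1) = L f - k *: L p.1 by rewrite linearB linearZ.
  by rewrite scalerBr scalerA addrA (subrK (k *: L p.1) (L f)).
by apply: lspanD; [exact: IH|exact: lspanZ].
Qed.

Definition shifted z g : E := L g - z *: g.

Lemma shifted_linear z k f g : shifted z (k *: f + g) = k *: shifted z f + shifted z g.
Proof.
by rewrite /shifted linearP scalerDr opprD addrACA scalerBr !scalerA (mulrC z).
Qed.

Lemma shiftedBZ z k f g : shifted z (f - k *: g) = shifted z f - k *: shifted z g.
Proof. by rewrite addrC -scaleNr shifted_linear scaleNr addrC. Qed.

Lemma iter_shifted_linear z n k f g :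
  iter n (shifted z) (k *: f + g) = k *: iter n (shifted z) f + iter n (shifted z) g.
Proof. by elim: n => //= n ->; rewrite shifted_linear. Qed.

Lemma iter_shifted0 z n : iter n (shifted z) 0 = 0.
Proof. by elim: n => //= n ->; rewrite /shifted linear0 scaler0 subr0. Qed.

Lemma gen_eigenP z f : generalized_eigenspace L z f <-> exists n, iter n (shifted z) f = 0.
Proof. by []. Qed.

Lemma gen_eigen_linear z k f g : generalized_eigenspace L z f ->
  generalized_eigenspace L z g -> generalized_eigenspace L z (k *: f + g).
Proof.
move=> /gen_eigenP[n hn] /gen_eigenP[m hm]; apply/gen_eigenP; exists (n + m)%N.
rewrite iter_shifted_linear [in X in X + _]addnC !iterD hn hm !iter_shifted0.
by rewrite scaler0 addr0.
Qed.

Lemma gen_eigen0 z : generalized_eigenspace L z 0.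
Proof. by apply/gen_eigenP; exists 0%N. Qed.

Lemma gen_eigen_iter z f n : generalized_eigenspace L z f ->
  generalized_eigenspace L z (iter n (shifted z) f).
Proof.
move=> /gen_eigenP[m hm]; apply/gen_eigenP; exists m.
by rewrite -iterD addnC iterD hm iter_shifted0.
Qed.

(** Iterating [L - z] on a generalized eigenvector ends at 0, so there is a last iterate outside a
    given subspace [P] before the first one inside. *)
Lemma first_iter (P : E -> Prop) z f : generalized_eigenspace L z f -> P 0 -> ~ P f ->
  exists2 n, ~ P (iter n (shifted z) f) & P (iter n.+1 (shifted z) f).
Proof.
move=> /gen_eigenP[n hn] P0 Pf.
elim: n f hn Pf => [|n IH] f /=; first by move=> ->.
rewrite -/(iter n.+1 _ _) iterSr => hn Pf.
have [h|h] := pselect (P (shifted z f)); first by exists 0%N.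
by have [m h1 h2] := IH _ hn h; exists m.+1; rewrite iterSr.
Qed.

Lemma gen_eigen_eigenvalue z f : generalized_eigenspace L z f -> f != 0 -> op_eigenvalue L z.
Proof.
move=> hf /eqP f0.
have [n h1 h2] := first_iter (P := fun g => g = 0) hf erefl f0.
exists (iter n (shifted z) f); first exact/eqP.
by apply/eqP; rewrite -subr_eq0; exact/eqP.
Qed.

(** The new vector is an iterate of [f] under [L - z] still outside the span, but whose image lies
    inside. *)
Lemma triangular_extend s z f : triangular_system s -> generalized_eigenspace L z f ->
  ~ lspan s f -> exists w, triangular_system ((w, z) :: s).
Proof.
move=> hs hf nf; have [n h1 h2] := first_iter (P := lspan s) hf (lspan0 s) nf.
by exists (iter n (shifted z) f); split=> //; exact: gen_eigen_iter.
Qed.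

(** Modulo the span of [s], [(L - z)^n] multiplies [w] by [(mu - z)^n], which is nonzero if
    [mu != z]. A vector killed by [(L - z)^n] thus has coefficient 0 along [w]. *)
Lemma gen_eigen_filter s z f : triangular_system s -> generalized_eigenspace L z f ->
  lspan s f -> lspan [seq p <- s | p.2 == z] f.
Proof.
elim: s f => //= -[w mu] s IH f /= [hs hw hL hG] hf [k hk].
have [muz|muz] := eqVneq mu z.
  exists k; apply: IH => //.
  by rewrite addrC -scaleNr; apply: gen_eigen_linear => //; rewrite -muz.
suff k0 : k = 0 by apply: IH => //; rewrite k0 scale0r subr0 in hk.
have stab g : lspan s g -> lspan s (shifted z g).
  by move=> hg; apply: lspanB; [exact: triangular_stable|exact: lspanZ].
have iterw n : lspan s (iter n (shifted z) w - (mu - z) ^+ n *: w).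
  elim: n => [|n IHn]; first by rewrite expr0 scale1r subrr; exact: lspan0.
  have -> : iter n.+1 (shifted z) w - (mu - z) ^+ n.+1 *: w =
     shifted z (iter n (shifted z) w - (mu - z) ^+ n *: w) +
     (mu - z) ^+ n *: (L w - mu *: w).
    rewrite iterS; set J := iter n _ w; rewrite shiftedBZ -[RHS]addrA; apply: (congr1 (fun u => shifted z J + u)).
    rewrite addrC -scalerBr.
    have -> : L w - mu *: w - shifted z w = - ((mu - z) *: w).
      rewrite /shifted opprB [z *: w - _]addrC addrACA subrr add0r scalerBl opprB.
      by rewrite addrC.
    by rewrite scalerN scalerA exprSr.
  by apply: lspanD; [exact: stab|exact: lspanZ].
have iters n g : lspan s g -> lspan s (iter n (shifted z) g).
  by elim: n => //= n IHn /IHn; exact: stab.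
move/gen_eigenP: hf => [n fn0].
have : lspan s ((k * (mu - z) ^+ n) *: w).
  have := iters n _ hk; rewrite addrC -scaleNr iter_shifted_linear fn0 addr0 => h1.
  have -> : (k * (mu - z) ^+ n) *: w = - k *: (iter n (shifted z) w - (mu - z) ^+ n *: w)
     - (- k *: iter n (shifted z) w).
    by rewrite scalerBr addrAC subrr sub0r scalerA -scaleNr mulNr opprK.
  by apply: lspanB => //; exact: lspanZ.
move=> h; apply/eqP; apply: contraT => k0.
have kn : k * (mu - z) ^+ n != 0 by rewrite mulf_neq0// expf_neq0// subr_eq0.
exfalso; apply: hw; rewrite -[w]scale1r -(mulVf kn) -scalerA; exact: lspanZ.
Qed.

Lemma lspan_gen_eigen s z : triangular_system s ->
  forall f, lspan [seq p <- s | p.2 == z] f -> generalized_eigenspace L z f.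
Proof.
elim: s => [|[w mu] s IH] /=; first by move=> _ f ->; exact: gen_eigen0.
move=> [hs _ _ hG] f; case: eqP => /= [muz [k hk]|_ hk]; last exact: IH.
by rewrite -[f](subrK (k *: w)) addrC; apply: gen_eigen_linear; [rewrite -muz|exact: IH].
Qed.

Definition lincomb s (a : 'rV[C]_(size s)) : E :=
  \sum_(i < size s) a 0 i *: (nth (0, 0) s i).1.

Lemma lincomb_is_linear s : linear (@lincomb s).
Proof.
move=> k a b; rewrite /lincomb scaler_sumr -big_split; apply: eq_bigr => i _ /=.
by rewrite !mxE scalerDl scalerA.
Qed.

HB.instance Definition _ s :=
  GRing.isLinear.Build C 'rV[C]_(size s) E *:%R (@lincomb s) (@lincomb_is_linear s).

Lemma lincomb_cons p s (a : 'rV[C]_(size s).+1) :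
  @lincomb (p :: s) a = a 0 0 *: p.1 + lincomb (\row_i a 0 (lift ord0 i)).
Proof.
rewrite /lincomb big_ord_recl /=; congr (_ + _).
by apply: eq_bigr => i _; rewrite !mxE.
Qed.

Lemma row_mx_head n (y : 'rV[C]_1) (v : 'rV[C]_n) :
  (row_mx y v : 'rV[C]_(1 + n)) 0 0 = y 0 0.
Proof.
have -> : (0 : 'I_(1 + n)) = lshift n (0 : 'I_1) by apply/val_inj.
by rewrite row_mxEl.
Qed.

Lemma row_mx_tail n (y : 'rV[C]_1) (v : 'rV[C]_n) :
  \row_i (row_mx y v : 'rV[C]_(1 + n)) 0 (lift ord0 i) = v.
Proof.
apply/rowP => i; rewrite mxE.
have -> : lift ord0 i = rshift 1 i :> 'I_(1 + n) by apply/val_inj.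
by rewrite row_mxEr.
Qed.

Lemma lincomb_range s : range (@lincomb s) = [set f | lspan s f].
Proof.
apply/seteqP; split=> [_ [a _ <-]|].
  elim: s a => [|p s IH] a /=; first by rewrite /lincomb big_ord0.
  by exists (a 0 0); rewrite lincomb_cons addrC addKr; exact: IH.
elim: s => [|p s IH] f /= => [->|[k /IH[a _ ha]]].
  by exists 0 => //; rewrite linear0.
exists (row_mx (const_mx k : 'rV[C]_1) a : 'rV[C]_(1 + size s)) => //.
rewrite lincomb_cons.
rewrite row_mx_head row_mx_tail mxE.
by rewrite ha addrC subrK.
Qed.

Lemma lincomb_inj s : free_system s -> injective (@lincomb s).
Proof.
move=> fs; suff h0 : forall a, lincomb a = 0 -> a = 0 :> 'rV_(size s).
  by move=> a b /eqP; rewrite -subr_eq0 -linearB => /eqP/h0/eqP; rewrite subr_eq0 => /eqP.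
elim: s fs => [|p s IH] /= fs a; first by move=> _; apply/rowP => -[].
case: fs => np fs; rewrite lincomb_cons => h.
have sp (b : 'rV[C]_(size s)) : lspan s (lincomb b).
  have : range (@lincomb s) (lincomb b) by exists b.
  by rewrite lincomb_range.
have a0 : a 0 0 = 0.
  apply/eqP; apply: contraT => a0; exfalso; apply: np.
  have -> : p.1 = - (a 0 0)^-1 *: lincomb (\row_i a 0 (lift ord0 i)).
    move/eqP: h; rewrite addrC addr_eq0 => /eqP ->.
    by rewrite scalerN scaleNr opprK scalerA mulVf// scale1r.
  exact: lspanZ.
move: h; rewrite a0 scale0r add0r => /(IH fs) h.
apply/rowP => i; rewrite [RHS]mxE.
case: (unliftP ord0 i) => [j ->|-> //].
by have /rowP/(_ j) := h; rewrite !mxE.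
Qed.

Lemma free_has_dimension s : free_system s ->
  has_dimension [set f | lspan s f] (size s).
Proof. by move=> fs; exists (@lincomb s); [exact: lincomb_inj|exact: lincomb_range]. Qed.

Lemma gen_eigen_dimension s z : triangular_system s ->
  (forall f, generalized_eigenspace L z f -> lspan s f) ->
  has_dimension (generalized_eigenspace L z) (count (fun p => p.2 == z) s).
Proof.
move=> hs hG.
have -> : generalized_eigenspace L z = [set f | lspan [seq p <- s | p.2 == z] f].
  apply/seteqP; split=> f /= hf; last exact: lspan_gen_eigen hf.
  by apply: gen_eigen_filter => //; exact: hG.
rewrite -size_filter; apply: free_has_dimension; apply: free_filter.
exact: triangular_free.
Qed.

Lemma has_dimension_le (V : set E) m n : has_dimension V m -> has_dimension V n -> (m <= n)%N.
Proof.
move=> [phi phiI phiV] [psi psiI psiV].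
have /choice[b hb] : forall i : 'I_m, exists b, psi b = phi (delta_mx 0 i).
  move=> i; have : range psi (phi (delta_mx 0 i)) by rewrite psiV -phiV; exists (delta_mx 0 i).
  by case=> b _ <-; exists b.
pose B : 'M[C]_(m, n) := \matrix_(i < m) b i.
have phiB a : phi a = psi (a *m B).
  rewrite {1}(row_sum_delta a) mulmx_sum_row !linear_sum; apply: eq_bigr => i _.
  by rewrite !linearZ /= rowK hb.
have /row_freeP[B' hB'] : row_free B.
  rewrite -kermx_eq0; apply/eqP/row_matrixP => i; rewrite row0.
  apply: phiI; rewrite linear0 phiB -row_mul mulmx_ker row0 linear0 //.
exact: mulmx1_min hB'.
Qed.

Lemma has_dimension_inj (V : set E) m n : has_dimension V m -> has_dimension V n -> m = n.
Proof.
by move=> hm hn; apply/eqP; rewrite eqn_leq (has_dimension_le hm hn) (has_dimension_le hn hm).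
Qed.

(** Matrices act on row vectors and the head of the list comes first, so that each vector adds a
    first row with its eigenvalue in the corner and a zero column below it. *)
Lemma triangular_matrix s : triangular_system s -> exists A : 'M[C]_(size s),
  (forall a, L (lincomb a) = lincomb (a *m A)) /\ \det A = \prod_(p <- s) p.2.
Proof.
elim: s => [|p s IH] /=.
  move=> _; exists 0; split; last by rewrite det_mx00 big_nil.
  by move=> a; rewrite /lincomb !big_ord0 linear0.
move=> [/IH[A [hA dA]] _ hL _].
have [b _ hb] : range (@lincomb s) (L p.1 - p.2 *: p.1) by rewrite lincomb_range.
exists (block_mx ((p.2)%:M : 'M[C]_1) b 0 A : 'M[C]_(1 + size s)); split; last first.
  transitivity (\det ((p.2)%:M : 'M[C]_1) * \det A); first exact: (det_ublock ((p.2)%:M : 'M[C]_1) b A).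
  by rewrite det_scalar1 big_cons dA.
move=> a; rewrite !lincomb_cons linearD linearZ /= hA.
pose a' : 'rV[C]_(1 + size s) := a.
have la : lsubmx a' = (a 0 0)%:M.
  apply/rowP => i; rewrite !mxE ord1 eqxx mulr1n; congr (a _ _); exact/val_inj.
have ra : rsubmx a' = \row_i a 0 (lift ord0 i).
  by apply/rowP => i; rewrite !mxE; congr (a _ _); exact/val_inj.
have aE : (a' *m block_mx ((p.2)%:M : 'M[C]_1) b 0 A : 'rV[C]_(1 + size s)) =
    row_mx ((a 0 0 * p.2)%:M : 'M[C]_1) (a 0 0 *: b + (\row_i a 0 (lift ord0 i)) *m A).
  rewrite -[a']hsubmxK la ra mul_row_block mulmx0 addr0 mul_scalar_mx scale_scalar_mx.
  by rewrite mul_scalar_mx.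
rewrite -/a' aE row_mx_head row_mx_tail [(_%:M) 0 0]mxE eqxx mulr1n.
rewrite lincomb_is_linear hb scalerBr -scalerA addrA; congr (_ + _).
by rewrite addrC subrK.
Qed.

End triangular_systems.

Lemma card_eq_uniq (T : eqType) (s : seq T) : uniq s -> ([set` s] #= `I_(size s))%card.
Proof.
case: s => [|x0 s0] us.
  by rewrite set_nil II0 card_eq_le !card_ge0.
set s := x0 :: s0 in us *.
have -> : [set` s] = nth x0 s @` `I_(size s).
  apply/seteqP; split=> [x /= xs|_ [i /= si <-]]; last exact: mem_nth.
  by exists (index x s); [rewrite /mkset index_mem|exact: nth_index].
apply: inj_card_eq => i j; rewrite !inE /= => si sj /eqP.
by rewrite nth_uniq// => /eqP.
Qed.

Section eigenvalue_sequences.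
Context {R : realType}.
Local Notation C := R[i].
Context {E : lmodType C}.
Variables (L : {linear E -> E}) (tau : nat -> R).
Hypothesis tau_ge0 : forall n, 0 <= tau n.
Hypothesis tau_cvg0 : forall r, 0 < r -> exists N, forall n, (N <= n)%N -> tau n < r.
Hypothesis tau_bound : forall s : seq (E * C), triangular_system L s ->
  all (fun p => p.2 != 0) s -> \prod_(p <- s) normc p.2 <= tau (size s) ^+ size s.
Implicit Types (s : seq (E * C)) (q : seq C) (f g w : E) (z : C) (r : R).

Local Notation G := (generalized_eigenspace L).

(** The product of the moduli is at least [r] to the length of [s]; take roots. Since [tau] tends to
    0, this limits the length of such a system, and so plays the role of the compactness of [L]. *)
Lemma triangular_lower_bound s r : triangular_system L s -> 0 < r -> s != [::] ->
  (forall p, p \in s -> r <= normc p.2) -> r <= tau (size s).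
Proof.
move=> hs r0 s0 hr.
have s1 : (0 < size s)%N by case: (s) s0.
rewrite -(@ler_pXn2r _ (size s)) ?nnegrE ?tau_ge0 ?(ltW r0)//.
apply: le_trans (tau_bound hs _).
  have -> : r ^+ size s = \prod_(p <- s) r by rewrite big_const_seq count_predT iter_mulr_1.
  rewrite big_seq [leRHS]big_seq; apply: ler_prod => p ps.
  by rewrite (ltW r0) hr.
apply/allP => p /hr h; rewrite -normc_eq0 gt_eqF//; exact: lt_le_trans h.
Qed.

(** Generalized eigenvectors for distinct eigenvalues are independent: by [gen_eigen_filter], one
    that lies in the span of the others lies in the span of an empty list. *)
Lemma triangular_of_distinct q : uniq q -> (forall z, z \in q -> exists2 f, G z f & f != 0) ->
  exists2 s, triangular_system L s & map snd s = q.
Proof.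
elim: q => [|z q IH] /=; first by exists [::].
move=> /andP[zq uq] hq.
have [z' z'q|s hs sq] := IH uq; first by apply: hq; rewrite inE z'q orbT.
have [f Gf f0] := hq z (mem_head _ _).
have [|w hw] := triangular_extend (s := s) hs Gf.
  move=> /(gen_eigen_filter hs Gf).
  rewrite (_ : [seq p <- s | p.2 == z] = [::]) /=; first by move/eqP; rewrite (negbTE f0).
  apply/eqP; rewrite -[_ == _]negbK -has_filter; apply: contra zq => /hasP[p ps /eqP <-].
  by rewrite -sq map_f.
by exists ((w, z) :: s) => //=; rewrite sq.
Qed.

Lemma distinct_bounded r : 0 < r -> exists N, forall q, uniq q ->
  (forall z, z \in q -> r <= normc z /\ exists2 f, G z f & f != 0) -> (size q <= N)%N.
Proof.
move=> r0; have [N hN] := tau_cvg0 r0; exists N => q uq hq.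
have [z /hq[]//|s hs sq] := triangular_of_distinct uq.
rewrite leqNgt; apply/negP => Nq.
have ss : size s = size q by rewrite -sq size_map.
have := hN (size s); rewrite ss => /(_ (ltnW Nq)); apply/negP; rewrite -leNgt -ss.
apply: triangular_lower_bound => //.
  by rewrite -size_eq0 ss -lt0n (leq_ltn_trans _ Nq).
by move=> p ps; have [] := hq p.2; rewrite // -sq map_f.
Qed.

Lemma seq_maximum q z0 : z0 \in q -> exists2 z, z \in q & forall z', z' \in q -> normc z' <= normc z.
Proof.
elim: q z0 => // z q IH z0 _.
case: q IH => [|z1 q] IH; first by exists z; rewrite ?mem_head// => z'; rewrite inE => /eqP ->.
have [y yq hy] := IH z1 (mem_head _ _).
have [zy|yz] := leP (normc z) (normc y).
  exists y; first by rewrite inE yq orbT.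
  by move=> z'; rewrite inE => /orP[/eqP ->|/hy].
exists z; first exact: mem_head.
move=> z'; rewrite inE => /orP[/eqP ->//|/hy h]; exact: le_trans (ltW yz).
Qed.

(** These are the nonzero eigenvalues whose multiplicity is not yet exhausted by [s]. *)
Definition missing s : set C := [set z | z != 0 /\ exists2 f, G z f & ~ lspan s f].

(** By [distinct_bounded] only finitely many missing eigenvalues have modulus at least that of [z0],
    so a maximal list of them contains all, and the largest is in it. *)
Lemma missing_max s : missing s !=set0 ->
  exists2 z, missing s z & forall z', missing s z' -> normc z' <= normc z.
Proof.
move=> [z0 hz0]; have r0 : 0 < normc z0 by rewrite normc_gt0; case: hz0.
have nz z : missing s z -> exists2 f, G z f & f != 0.
  move=> [_ [f Gf nf]]; exists f => //; apply/eqP => f0; apply: nf; rewrite f0.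
  exact: lspan0.
have [N hN] := distinct_bounded r0.
pose ok q := uniq q /\ forall z, z \in q -> normc z0 <= normc z /\ missing s z.
have exP : exists k, `[< exists2 q, ok q & size q = k >].
  by exists 0%N; apply/asboolP; exists [::].
have ubP k : `[< exists2 q, ok q & size q = k >] -> (k <= N)%N.
  move=> /asboolP[q [uq hq] <-]; apply: hN => // z /hq[h1 /nz h2]; by split.
case: (ex_maxnP exP ubP) => k /asboolP[q [uq hq] sq] kmax.
have full z : missing s z -> normc z0 <= normc z -> z \in q.
  move=> hz zz; apply: contraT => zq.
  have : (size (z :: q) <= k)%N.
    apply: kmax; apply/asboolP; exists (z :: q) => //; split; first by rewrite /= zq.
    by move=> z'; rewrite inE => /orP[/eqP ->|/hq].
  by rewrite /= sq ltnn.
have [z zq hz] := seq_maximum (full z0 hz0 (lexx _)).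
have [zz mz] := hq _ zq.
exists z => // z' mz'; have [h|h] := leP (normc z0) (normc z').
  by apply: hz; exact: full.
exact: le_trans (ltW h) zz.
Qed.

(** Greedy construction: the system is extended by a missing eigenvalue of largest modulus, or left
    unchanged and [lam] padded by 0. Moduli decrease because the sets of missing eigenvalues do. *)
Lemma eigenvalue_sequence_exists : exists lam, eigenvalue_sequence L lam.
Proof.
have /choice[F hF] : forall s, exists p : E * C, triangular_system L s ->
    missing s !=set0 -> [/\ triangular_system L (p :: s), missing s p.2 &
      forall z', missing s z' -> normc z' <= normc p.2].
  move=> s; have [hs|] := pselect (triangular_system L s); last by exists (0, 0).
  have [h0|] := pselect (missing s !=set0); last by exists (0, 0).
  have [z mz zmax] := missing_max h0.
  have [_ [f Gf nf]] := mz; have [w hw] := triangular_extend hs Gf nf.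
  by exists (w, z).
pose next s := if `[< missing s !=set0 >] then F s :: s else s.
pose S n := iter n next [::].
pose lam n := if `[< missing (S n) !=set0 >] then (F (S n)).2 else 0.
have ST n : triangular_system L (S n).
  elim: n => //= n IH; rewrite /next; case: asboolP => // h.
  by have [] := hF _ IH h.
have S_sub n f : lspan (S n) f -> lspan (S n.+1) f.
  by rewrite /= /next; case: asboolP => // _ h; exact: lspan_cons.
have S_mono n m f : (n <= m)%N -> lspan (S n) f -> lspan (S m) f.
  move=> /subnK <-; elim: (m - n)%N => // j IH h; rewrite addSn; apply: S_sub; exact: IH.
have missing_sub n m z : (n <= m)%N -> missing (S m) z -> missing (S n) z.
  move=> nm [z0 [f Gf nf]]; split=> //; exists f => //.
  by move=> h; apply: nf; exact: S_mono h.
have lamP n z : missing (S n) z -> missing (S n) (lam n) /\ normc z <= normc (lam n).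
  move=> mz; rewrite /lam; case: asboolP => [h|[]]; last by exists z.
  by have [_ h1 h2] := hF _ (ST n) h; split=> //; exact: h2.
have lam_missing n : lam n != 0 -> missing (S n) (lam n).
  rewrite /lam; case: asboolP; last by rewrite eqxx.
  by move=> h _; case: (hF _ (ST n) h).
exists lam; split.
- move=> n; rewrite !normcEC lecR.
  have [->|h] := eqVneq (lam n.+1) 0; first by rewrite ComplexField.Normc.normc0 normc_ge0.
  by have [] := lamP n (lam n.+1) (missing_sub _ _ _ (leqnSn n) (lam_missing _ h)).
- move=> n /lam_missing[_ [f Gf nf]]; apply: gen_eigen_eigenvalue Gf _.
  by apply: contra_notN nf => /eqP ->; exact: lspan0.
- move=> z z0 [f0 f0n Lf0].
  have r0 : 0 < normc z by rewrite normc_gt0.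
  (* [S n] holds the earlier values of [lam] in reverse order, except the padding zeros; filtering
     at [z != 0] hides the difference. *)
  have sndS n : [seq y <- map snd (S n) | y == z] = [seq y <- rev [seq lam k | k <- iota 0 n] | y == z].
    elim: n => // n IH.
    rewrite -[in iota 0 n.+1]addn1 iotaD map_cat rev_cat filter_cat -IH add0n.
    have [h|h] := pselect (missing (S n) !=set0).
      have -> : S n.+1 = F (S n) :: S n by rewrite [S n.+1]/= /next asboolT.
      have ln : lam n = (F (S n)).2 by rewrite /lam asboolT.
      by rewrite /= ln; case: ifP.
    have -> : S n.+1 = S n by rewrite [S n.+1]/= /next asboolF.
    have ln : lam n = 0 by rewrite /lam asboolF.
    by rewrite /= ln eq_sym (negbTE z0).
  (* Were [z] missing for ever, each step would add an eigenvalue of modulus at least that of [z],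
     contradicting the bound on the length. *)
  have [N hN] : exists N, ~ missing (S N) z.
    apply: contrapT => /forallNP hall.
    have {}hall n : missing (S n) z by apply: contrapT; exact: hall.
    have Ssz n : size (S n) = n /\ forall p, p \in S n -> normc z <= normc p.2.
      elim: n => // n [IH1 IH2]; rewrite [S n.+1]/= /next; case: asboolP => [h|[]]; last by exists z.
      split; first by rewrite /= IH1.
      move=> p; rewrite inE => /orP[/eqP ->|/IH2//].
      by have [_ _] := hF _ (ST n) h; apply.
    have [N hN] := tau_cvg0 r0.
    have := hN N.+1 (leqnSn N); apply/negP; rewrite -leNgt.
    have [s1 s2] := Ssz N.+1; rewrite -s1; apply: triangular_lower_bound => //.
    by rewrite -size_eq0 s1.
  have GS f : G z f -> lspan (S N) f.
    by move=> Gf; apply: contrapT => nf; apply: hN; split=> //; exists f.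
  exists (count (fun p => p.2 == z) (S N)); first exact: gen_eigen_dimension.
  have -> : count (fun p => p.2 == z) (S N) = size [seq k <- iota 0 N | lam k == z].
    have <- : size [seq y <- map snd (S N) | y == z] = count (fun p : E * C => p.2 == z) (S N).
      by rewrite size_filter count_map.
    by rewrite sndS size_filter count_rev count_map size_filter.
  rewrite (_ : [set n | lam n = z] = [set` [seq k <- iota 0 N | lam k == z]]).
    by apply: card_eq_uniq; rewrite filter_uniq// iota_uniq.
  apply/seteqP; split=> [n /= ln|n /=]; last by rewrite mem_filter => /andP[/eqP].
  rewrite mem_filter ln eqxx /= mem_iota add0n /= ltnNge; apply/negP => Nn.
  apply: hN; apply: missing_sub Nn _; rewrite -ln; apply: lam_missing; by rewrite ln.
Qed.

(** It suffices to realize [lam 0], ..., [lam n] by a triangular system. If the part for indices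
    below [m] exhausted the generalized eigenspace of [z = lam m], the multiplicity of [z] would be
    the number of [k < m] with [lam k = z]; but index [m] counts too. *)
Lemma eigenvalue_sequence_bound lam n : eigenvalue_sequence L lam ->
  normc (lam n) <= tau n.+1.
Proof.
move=> [lam_dec lam_eigen lam_mult].
have [->|ln0] := eqVneq (lam n) 0; first by rewrite ComplexField.Normc.normc0.
have dec k m : (k <= m)%N -> normc (lam m) <= normc (lam k).
  move=> /subnK <-; elim: (m - k)%N => // j IH; apply: le_trans IH.
  by have := lam_dec (j + k)%N; rewrite !normcEC lecR.
have nz k : (k <= n)%N -> lam k != 0.
  by move=> /dec h; rewrite -normc_gt0; apply: lt_le_trans h; rewrite normc_gt0.
have [s [hs ss]] : exists s, triangular_system L s /\
    map snd s = rev [seq lam k | k <- iota 0 n.+1].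
  have : (n.+1 <= n.+1)%N by [].
  elim: {-2}n.+1 => [|m IH] mn; first by exists [::].
  have [s [hs ss]] := IH (ltnW mn).
  set z := lam m.
  have z0 : z != 0 by exact: nz.
  have [f [Gf nf]] : exists f, G z f /\ ~ lspan s f.
    apply: contrapT => /forallNP h.
    have {}h f : G z f -> lspan s f.
      by move=> Gf; apply: contrapT => nf; apply: (h f).
    have d1 := gen_eigen_dimension hs h.
    have [d hd hc] := lam_mult z z0 (lam_eigen m z0).
    have dE := has_dimension_inj hd d1.
    have : (size [seq k <- iota 0 m.+1 | lam k == z] <= d)%N.
      rewrite -card_le_II -(card_le_eql (card_eq_uniq _)) ?filter_uniq ?iota_uniq//.
      rewrite -(card_le_eqr hc); apply: subset_card_le => k; rewrite /mkset.
      by rewrite mem_filter => /andP[/eqP].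
    have -> : d = size [seq k <- iota 0 m | lam k == z].
      have <- : size [seq y <- map snd s | y == z] = d.
        by rewrite size_filter count_map dE.
      by rewrite ss size_filter count_rev count_map size_filter.
    by rewrite !size_filter -addn1 iotaD count_cat /= eqxx addn1 ltnn.
  have [w hw] := triangular_extend hs Gf nf.
  exists ((w, z) :: s); split=> //.
  by rewrite -[m.+1]addn1 iotaD map_cat rev_cat /= ss.
have sz : size s = n.+1 by rewrite -(size_map snd) ss size_rev size_map size_iota.
rewrite -sz; apply: triangular_lower_bound => //; first by rewrite normc_gt0.
  by rewrite -size_eq0 sz.
move=> p ps; have : p.2 \in map snd s by exact: map_f.
rewrite ss mem_rev => /mapP[k]; rewrite mem_iota add0n ltnS => kn ->.
exact: dec.
Qed.

End eigenvalue_sequences.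

(** * Enumeration and stretched exponentials *)

Section enumeration.
Variables (T : eqType) (box : nat -> seq T).
Hypothesis box_uniq : forall N, uniq (box N).
Hypothesis box_sub : forall N, {subset box N <= box N.+1}.
Hypothesis box_size : forall N, (N <= size (box N))%N.

(** Appending the new elements of each box to the list of the previous one makes every box an
    initial segment of a single sequence. *)
Lemma exhaustion_enumeration : exists e : nat -> T,
  forall N, perm_eq [seq e i | i <- iota 0 (size (box N))] (box N).
Proof.
have [t0 _] : exists t0, t0 \in box 1.
  by have := box_size 1; case: (box 1) => // t s _; exists t; rewrite mem_head.
pose S := fix S N := if N is N'.+1 then S N' ++ [seq t <- box N | t \notin S N'] else box 0.
have SP N : perm_eq (S N) (box N).
  elim: N => [|N IH] //=; set q := [seq t <- _ | _].
  have memS := perm_mem IH.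
  apply: uniq_perm => [||t]; last first.
  - rewrite mem_cat mem_filter memS; case: (boolP (t \in box N)) => //= tN.
    by rewrite (box_sub tN).
  - exact: box_uniq.
  - rewrite cat_uniq (perm_uniq IH) box_uniq filter_uniq ?box_uniq// andbT.
    by apply/hasPn => t; rewrite mem_filter => /andP[].
have Ssize N : size (S N) = size (box N) by apply: perm_size.
have nthS N M i : (N <= M)%N -> (i < size (S N))%N -> nth t0 (S M) i = nth t0 (S N) i.
  move=> /subnK <- iN; elim: (M - N)%N => // j IH.
  rewrite addSn /= nth_cat; case: ltnP => // h; exfalso; move: h; apply/negP; rewrite -ltnNge.
  apply: leq_trans iN _; elim: j {IH} => // j IH.
  by rewrite addSn /= size_cat (leq_trans IH)// leq_addr.
(* The list [S i.+1] has at least [i.+1] elements, so its entry [i] is a genuine one and later lists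
   keep it. *)
exists (fun i => nth t0 (S i.+1) i) => N; apply: perm_trans (SP N).
rewrite (_ : map _ _ = S N)//; apply: (eq_from_nth (x0 := t0)); rewrite size_map size_iota//.
move=> i iN; rewrite (nth_map 0%N) ?size_iota// nth_iota// add0n.
have [h|h] := leqP N i.+1; first by rewrite (nthS N)// Ssize.
by rewrite -(nthS i.+1 N)//; [exact: ltnW|rewrite Ssize; exact: box_size].
Qed.

End enumeration.

Section stretched_exponentials.
Context {R : realType}.
Variable d : nat.
Hypothesis d0 : (0 < d)%N.

Definition nroot (n : nat) : R := n%:R `^ d%:R^-1.

Lemma nroot_ge0 n : 0 <= nroot n.
Proof. exact: powR_ge0. Qed.

Lemma nrootK n : nroot n ^+ d = n%:R.
Proof.
have dn0 : d%:R != 0 :> R by rewrite pnatr_eq0 -lt0n.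
by rewrite -powR_mulrn ?nroot_ge0// /nroot -powRrM mulVf// powRr1.
Qed.

Lemma le_nroot (a : R) n : 0 <= a -> (a <= nroot n) = (a ^+ d <= n%:R).
Proof. by move=> a0; rewrite -nrootK ler_pXn2r// nnegrE// nroot_ge0. Qed.

Lemma nroot_le (a : R) n : 0 <= a -> (nroot n <= a) = (n%:R <= a ^+ d).
Proof. by move=> a0; rewrite -nrootK ler_pXn2r// nnegrE// nroot_ge0. Qed.

Lemma nroot_mono m n : (m <= n)%N -> nroot m <= nroot n.
Proof. by move=> mn; rewrite nroot_le ?nroot_ge0// nrootK ler_nat. Qed.

Lemma expR_ge_pow (x : R) : 0 <= x -> (x / d%:R) ^+ d <= expR x.
Proof.
move=> x0; have dR : 0 < d%:R :> R by rewrite ltr0n.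
have xE : x = d%:R * (x / d%:R) by field; rewrite gt_eqF.
rewrite [in expR x]xE expRM_natl.
apply: lerXn2r; [by rewrite nnegrE divr_ge0// ltW|by rewrite nnegrE expR_ge0|].
by apply: le_trans (expR_ge1Dx _); rewrite lerDr.
Qed.

Lemma stretched_cvg0 (K a r : R) : 0 < a -> 0 < r -> 0 <= K ->
  exists N, forall n, (N <= n)%N -> K * expR (- (a * nroot n)) < r.
Proof.
move=> a0 r0 K0.
pose t := K / (a * r).
have t0 : 0 <= t by rewrite divr_ge0// mulr_ge0// ltW.
have [N hN] : exists N : nat, t ^+ d <= N%:R.
  by exists (Num.bound (t ^+ d)); rewrite ltW// archi_boundP// exprn_ge0.
exists N => n Nn.
have tn : t <= nroot n by rewrite le_nroot// (le_trans hN)// ler_nat.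
rewrite expRN ltr_pdivrMr ?expR_gt0//.
apply: (@lt_le_trans _ _ (r * (1 + a * nroot n))); last first.
  by apply: ler_wpM2l; [exact: ltW|exact: expR_ge1Dx].
apply: (@lt_le_trans _ _ (r * (1 + a * t))).
  have -> : r * (1 + a * t) = r + K by rewrite /t; field; rewrite !gt_eqF.
  by rewrite ltr_pwDl.
by apply: ler_wpM2l; [exact: ltW|rewrite lerD2l ler_pM2l].
Qed.

(** At least half of the [n] exponents are at least [a * nroot n / 2], so the product decays like
    the n-th power of [expR (- (a / 4 * nroot n))]. The factorial is at most [n ^ n], and
    [n <= B * expR (a / 8 * nroot n)] consumes half of this rate. *)
Lemma fact_prod_stretched (K a : R) : 0 < K -> 0 < a -> exists2 K', 0 < K' &
  forall n, n`!%:R * \prod_(0 <= i < n) (2 * (K * expR (- (a * nroot i.+1)))) <=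
    (K' * expR (- (a / 8 * nroot n))) ^+ n.
Proof.
move=> K0 a0.
have dR : 0 < d%:R :> R by rewrite ltr0n.
pose B := (8 * d%:R / a) ^+ d.
have B0 : 0 < B by rewrite exprn_gt0// divr_gt0// mulr_gt0.
exists (2 * K * B); first by rewrite !mulr_gt0.
move=> n.
have half : nroot n / 2 <= nroot (n./2).+1.
  rewrite le_nroot ?divr_ge0 ?nroot_ge0// expr_div_n nrootK ler_pdivrMr ?exprn_gt0//.
  apply: (@le_trans _ _ ((n./2).+1%:R * 2)).
    rewrite -natrM ler_nat muln2 -[leqLHS]odd_double_half; case: (odd n); lia.
  apply: ler_wpM2l => //; rewrite -natrX ler_nat -{1}(expn1 2) leq_exp2l//.
have nB : n%:R <= B * expR (a / 8 * nroot n).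
  have := @expR_ge_pow (a / 8 * nroot n) _.
  rewrite (_ : a / 8 * nroot n / d%:R = (8 * d%:R / a)^-1 * nroot n); last first.
    by field; rewrite !gt_eqF.
  rewrite exprMn nrootK exprVn -/B => h.
  rewrite -ler_pdivrMl//; apply: h.
  by rewrite mulr_ge0 ?nroot_ge0// divr_ge0// ltW.
have sum_ge : n%:R * (nroot n / 4) <= \sum_(0 <= i < n) nroot i.+1.
  rewrite (big_cat_nat (n := n./2)) ?leq0n//=; last by rewrite -{2}(odd_double_half n); lia.
  apply: (@le_trans _ _ (\sum_(n./2 <= i < n) nroot i.+1)); last first.
    by rewrite lerDr sumr_ge0// => i _; exact: nroot_ge0.
  apply: (@le_trans _ _ (\sum_(n./2 <= i < n) nroot n / 2)).
    rewrite sumr_const_nat -[leRHS]mulr_natl.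
    have -> : n%:R * (nroot n / 4) = n%:R / 2 * (nroot n / 2) by field.
    apply: ler_wpM2r; first by rewrite divr_ge0 ?nroot_ge0.
    rewrite ler_pdivrMr// -natrM ler_nat; have := odd_double_half n; case: (odd n); lia.
  rewrite big_nat [leRHS]big_nat; apply: ler_sum => i /andP[ni _].
  by apply: le_trans half _; apply: nroot_mono.
have fact_le : n`!%:R <= n%:R ^+ n :> R.
  rewrite -natrX ler_nat; elim: (n) => // m IH.
  by rewrite factS expnS leq_mul2l /= (leq_trans IH)//; case: (m) => // m'; rewrite leq_exp2r.
have -> : \prod_(0 <= i < n) (2 * (K * expR (- (a * nroot i.+1)))) =
   (2 * K) ^+ n * expR (- (a * \sum_(0 <= i < n) nroot i.+1)).
  rewrite (eq_bigr (fun i => (2 * K) * expR (- (a * nroot i.+1)))); last first.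
    by move=> i _; rewrite mulrA.
  rewrite big_split /= prodr_const_nat subn0; congr (_ * _).
  by rewrite mulr_sumr -sumrN expR_sum.
have h1 : n%:R * expR (- (a / 4 * nroot n)) <= B * expR (- (a / 8 * nroot n)).
  have -> : - (a / 8 * nroot n) = a / 8 * nroot n + - (a / 4 * nroot n) by field.
  by rewrite expRD mulrA; apply: ler_wpM2r => //; exact: expR_ge0.
have h2 : expR (- (a * \sum_(0 <= i < n) nroot i.+1)) <= expR (- (a / 4 * nroot n)) ^+ n.
  rewrite -expRM_natl ler_expR mulrN lerN2.
  have -> : n%:R * (a / 4 * nroot n) = a * (n%:R * (nroot n / 4)) by field.
  by apply: ler_wpM2l => //; exact: ltW.
have K2 : 0 <= (2 * K) ^+ n by rewrite exprn_ge0// mulr_ge0// ltW.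
rewrite mulrCA -[in leRHS](mulrA _ B) [leRHS]exprMn; apply: ler_wpM2l => //.
apply: (@le_trans _ _ (n%:R ^+ n * expR (- (a / 4 * nroot n)) ^+ n)).
  by apply: ler_pM => //; exact: expR_ge0.
rewrite -exprMn; apply: lerXn2r => //; rewrite nnegrE mulr_ge0// ?expR_ge0//; exact: ltW.
Qed.

End stretched_exponentials.

(** * Compact sets and the space of holomorphic functions *)

Section compact_polysquares.
Context {R : realType}.
Local Notation C := R[i].

Lemma gt0C (e : C) : 0 < e -> e = (Re e)%:C /\ 0 < Re e.
Proof. by case: e => a b; rewrite ltcE /= => /andP[/eqP -> ->]. Qed.

Lemma continuous_normc : continuous (fun z : C => normc z : R^o).
Proof.
move=> z; have FF : Filter (nbhs z) by exact: nbhs_filter.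
apply/(@cvgrPdist_lt R R^o _ (nbhs z) FF (fun z : C => normc z : R^o)) => e e0.
have e0' : (0 : C) < e%:C by rewrite ltcR.
apply/nbhs_ballP; exists e%:C => //= w; rewrite /ball /= normcEC ltcR => zw.
apply: le_lt_trans zw.
rewrite ler_norml; have := ler_normcD (z - w) w; have := ler_normcD (w - z) z.
by rewrite !subrK (normcB w z); lra.
Qed.

Lemma compact_square (c : C) (r : R) : compact [set t | in_square r (t - c)].
Proof.
pose g (p : R * R) : C := (p.1 + Re c) +i* (p.2 + Im c).
have cg : continuous g.
  move=> p; have FF : Filter (nbhs p) by exact: nbhs_filter.
  apply/(@cvgrPdist_lt C C _ (nbhs p) FF g) => e /gt0C[-> e0].
  apply/nbhs_ballP; exists (Re e / 2) => /=; first by rewrite divr_gt0.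
  move=> q [/= h1 h2]; rewrite normcEC ltcR; apply: le_lt_trans (normc_le_ReIm _) _.
  move: h1 h2; rewrite /ball /= /g.
  case: p q {FF} => [p1 p2] [q1 q2] /= h1 h2.
  rewrite (_ : p1 + Re c - (q1 + Re c) = p1 - q1); last by ring.
  rewrite (_ : p2 + Im c - (q2 + Im c) = p2 - q2); last by ring.
  lra.
rewrite (_ : [set t | _] = g @` (`[- r, r] `*` `[- r, r])).
  apply: (@continuous_compact _ _ g).
    by apply: continuous_subspaceT => p; exact: cg.
  by apply: compact_setX; exact: segment_compact.
apply/seteqP; split=> [t ht|_ [[a b] [/= ha hb] <-]].
  exists (Re t - Re c, Im t - Im c).
    by move: ht; rewrite /= /in_square /in_rect !raddfB /= => /andP[].
  by rewrite /g /= !subrK; case: (t).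
rewrite /= /in_square /in_rect /g !raddfB /=.
by rewrite !in_itv /= in ha hb; rewrite !addrK ha hb.
Qed.

Lemma compact_polysquare d (c : 'rV[C]_d) (r : R) :
  compact [set w | in_polysquare r (w - c)].
Proof.
have := @rV_compact C d (fun j => [set t | in_square r (t - c 0 j)])
  (fun j => @compact_square (c 0 j) r).
rewrite (_ : [set v | _] = [set w | in_polysquare r (w - c)])//.
by apply/seteqP; split=> v /= hv j; have := hv j; rewrite !mxE.
Qed.

Lemma open_polysquare d (Omega : set 'rV[C]_d) z : open Omega -> Omega z ->
  exists2 r : R, 0 < r & [set w | in_polysquare r (w - z)] `<=` Omega.
Proof.
rewrite openE => /[apply] /nbhs_ballP[e /= /gt0C[-> e0] he].
exists (Re e / 4); first by rewrite divr_gt0.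
move=> w hw; apply: he; rewrite /ball /=; split; first by rewrite ltcR.
move=> i j; rewrite ord1; have := hw j; rewrite !mxE /ball /= normcEC ltcR normcB.
move=> /andP[h1 h2]; apply: le_lt_trans (normc_le_ReIm _) _.
have : `|Re (w 0 j - z 0 j)| <= Re e / 4 by rewrite ler_norml.
have : `|Im (w 0 j - z 0 j)| <= Re e / 4 by rewrite ler_norml.
lra.
Qed.

Lemma small_polysquare_nbhs d (z : 'rV[C]_d) (r : R) : 0 < r ->
  nbhs z [set w | forall j, normc ((w - z) 0 j) <= r].
Proof.
move=> r0; apply/nbhs_ballP; exists r%:C => /=; first by rewrite ltcR.
move=> w [_ h] j; have := h 0 j; rewrite /ball /= normcEC ltcR normcB !mxE.
exact: ltW.
Qed.

Lemma compact_cover_polysquares d (K : set 'rV[C]_d) (r : 'rV[C]_d -> R) :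
  compact K -> (forall z, K z -> 0 < r z) ->
  exists q : seq 'rV[C]_d, (forall c, c \in q -> K c) /\
    forall z, K z -> exists2 c, c \in q & forall j, normc ((z - c) 0 j) <= r c.
Proof.
rewrite compact_cover => cK r0.
have [|z Kz|D DK cD] := cK _ K (fun c => [set w | forall j, normc ((w - c) 0 j) <= r c]^°).
- by move=> c _; exact: open_interior.
- by exists z => //; apply: small_polysquare_nbhs; exact: r0.
exists (finmap.enum_fset D); split; first by move=> c cD'; have := DK c cD'; rewrite inE.
move=> z /cD[c cc hz]; exists c => //; exact: interior_subset hz.
Qed.

End compact_polysquares.

Section holomorphic_on_polysquares.
Context {R : realType} {d : nat}.
Local Notation C := R[i].
Variable Omega : set 'rV[C]_d.

Lemma continuous_normc_comp (F : 'rV[C]_d -> C) z : differentiable F z ->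
  {for z, continuous (fun w => normc (F w) : R^o)}.
Proof.
move=> /differentiable_continuous cF.
by apply: (@continuous_comp _ _ _ F (fun z : C => normc z : R^o)) => //; exact: continuous_normc.
Qed.

Lemma compact_normc_bounded (F : 'rV[C]_d -> C) (K : set 'rV[C]_d) : compact K ->
  (forall z, K z -> differentiable F z) ->
  exists M, forall z, K z -> normc (F z) <= M.
Proof.
move=> cK dF.
have : compact ((fun w => normc (F w) : R^o) @` K).
  apply: continuous_compact => //; apply: continuous_in_subspaceT => z; rewrite inE => Kz.
  exact: continuous_normc_comp (dF z Kz).
move=> /compact_bounded[M [_ hM]]; exists (M + 1) => z Kz.
have := hM (M + 1) _ (normc (F z)); rewrite ltrDl ltr01 => /(_ isT) h.
by apply: le_trans (ler_norm _) (h _); exists z.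
Qed.

Lemma polysquare_holo_shift (F : 'rV[C]_d -> C) (c : 'rV[C]_d) (r M : R) :
  (forall u, in_polysquare r u -> differentiable F (c + u) /\ normc (F (c + u)) <= M) ->
  polysquare_holo r M (fun u => F (c + u)).
Proof.
move=> hF u hu; have [dF bF] := hF u hu; split=> // i.
have := diff_derivable (v := delta_mx 0 i) dF.
rewrite /derivable.
rewrite (_ : (fun h : C => h^-1 *: ((F \o shift (c + u)) (h *: delta_mx 0 i) - F (c + u))) =
  (fun h : C => h^-1 *: (((fun t => F (c + upd u i t)) \o shift (u 0 i)) (h *: 1) -
     F (c + upd u i (u 0 i)))))//.
apply/funext => h; congr (_ *: (F _ - F _)); last by rewrite upd_id.
apply/rowP => j; rewrite !mxE eqxx /=.
case: (eqVneq j i) => [->|ji].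
  by rewrite mulr1 -[h *: 1]/(h * 1) mulr1 addrCA.
by rewrite mulr0 add0r.
Qed.

End holomorphic_on_polysquares.

Lemma le0_geometric (R : realType) (y A : R) :
  (forall N, y <= A * 2^-1 ^+ N) -> y <= 0.
Proof.
move=> h; rewrite leNgt; apply/negP => y0.
have A0 : 0 < A by have := h 0%N; rewrite expr0 mulr1; apply: lt_le_trans.
have := h (Num.bound (A / y)); apply/negP; rewrite -ltNge exprVn ltr_pdivrMr ?exprn_gt0//.
rewrite mulrC -ltr_pdivrMr//; apply: lt_trans (archi_boundP _) _; first by rewrite divr_ge0// ltW.
by rewrite -natrX ltr_nat ltn_expl.
Qed.

(* The functionals x n are the rescaled divided differences attached to a finite
   cover of K by polysquares, enumerated by increasing order. *)
Theorem compact_expansion (R : realType) (d : nat) (Omega K : set 'rV[R[i]]_d) :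
  (0 < d)%N -> open Omega -> compact K -> K `<=` Omega -> K !=set0 ->
  exists (K' : set 'rV[R[i]]_d) (x : nat -> ('rV[R[i]]_d -> R[i]) -> R[i]) (B a : R),
  [/\ compact K' /\ K' `<=` Omega, 0 < B /\ 0 < a,
    forall n k F G, x n (fun z => k * F z + G z) = k * x n F + x n G,
    forall F M, (forall z, K' z -> differentiable F z /\ normc (F z) <= M) ->
      forall m, \sum_(0 <= n < m) normc (x n F) ^+ 2 <= B * M ^+ 2 &
    forall F n P, (forall z, K' z -> differentiable F z) -> 0 <= P ->
      (forall m, (m < n)%N -> x m F = 0) -> (forall m, normc (x m F) <= P) ->
      forall z, K z -> normc (F z) <= B * expR (- (a * @nroot R d n.+1)) * P].
Proof.
move=> d0 oO cK KO [z1 Kz1].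
have /choice[r hr] : forall z, exists r : R, 0 < r /\
    (Omega z -> [set w | in_polysquare r (w - z)] `<=` Omega).
  move=> z; have [Oz|nO] := pselect (Omega z); last by exists 1; split=> // /nO.
  by have [r r0 h] := open_polysquare oO Oz; exists r.
have r0 z : 0 < r z by case: (hr z).
have [q0 [q0K q0cov]] : exists q : seq 'rV[R[i]]_d, (forall c, c \in q -> K c) /\
    forall z, K z -> exists2 c, c \in q & forall j, normc ((z - c) 0 j) <= r c / 32.
  by apply: (compact_cover_polysquares (r := fun z => r z / 32)) => // z _; rewrite divr_gt0.
(* Repeated centres would list a pair [(c, al)] twice in a box. *)
pose q := undup q0.
have qK c : c \in q -> K c by rewrite mem_undup; exact: q0K.
have qcov z : K z -> exists2 c, c \in q & forall j, normc ((z - c) 0 j) <= r c / 32.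
  by move=> /q0cov[c cq hc]; exists c; rewrite ?mem_undup.
pose b := size q.
have b0 : (0 < b)%N by have [c] := qcov z1 Kz1; rewrite /b; case: (q).
pose K' : set 'rV[R[i]]_d := \big[setU/set0]_(c <- q) [set w | in_polysquare (r c) (w - c)].
have K'P c u : c \in q -> in_polysquare (r c) u -> K' (c + u).
  move=> cq hu; rewrite /K' -bigcup_seq; exists c => //=.
  by rewrite addrC addKr.
have /choice[Y /choice[H /choice[E hE]]] : forall c, exists Y H E, _ :=
  fun c => polysquare_expansion d (r0 c).
pose box N := [seq (c, al) | c <- q, al <- mbox N d].
have sbox N : size (box N) = (b * N ^ d)%N by rewrite size_allpairs size_mbox.
have pow_ge N : (N <= N ^ d)%N.
  by case: N => // N; rewrite -[leqLHS]expn1 leq_pexp2l.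
have [e he] : exists e : nat -> 'rV[R[i]]_d * seq nat,
    forall N, perm_eq [seq e i | i <- iota 0 (size (box N))] (box N).
  apply: exhaustion_enumeration => N.
  - apply: allpairs_uniq; [exact: undup_uniq|exact: uniq_mbox|].
    by move=> [c al] [c' al'] _ _ /= [-> ->].
  - move=> t /allpairsP[[c al] /= [cq hal ->]]; apply/allpairsP; exists (c, al); split=> //.
    exact: (sub_mbox (leqnSn N)) hal.
  - by rewrite sbox (leq_trans (pow_ge N))// leq_pmull.
have eP i : (e i).1 \in q /\ size (e i).2 = d.
  have : e i \in box i.+1.
    rewrite -(perm_mem (he i.+1)); apply: map_f; rewrite mem_iota add0n sbox.
    by rewrite (leq_trans (pow_ge i.+1))// leq_pmull.
  by move=> /allpairsP[[c al] /= [cq + ->]]; rewrite mem_mbox => /andP[/eqP].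
have eN N c al : c \in q -> al \in mbox N d -> exists2 i, (i < b * N ^ d)%N & e i = (c, al).
  move=> cq hal; have hb : (c, al) \in box N by apply/allpairsP; exists (c, al).
  have : (c, al) \in [seq e i | i <- iota 0 (size (box N))] by rewrite (perm_mem (he N)).
  by move=> /mapP[i + ->]; rewrite mem_iota add0n sbox => hi; exists i.
pose x n (F : 'rV[R[i]]_d -> R[i]) := Y (e n).1 (e n).2 (fun u => F ((e n).1 + u)).
pose B1 : R := b%:R * (8 ^+ d * 8 ^+ d * 2 ^+ d).
pose B2 : R := 2 * 2 ^+ d.
have B10 : 0 < B1 by rewrite !mulr_gt0 ?exprn_gt0// ltr0n.
have B20 : 0 < B2 by rewrite mulr_gt0// exprn_gt0.
have bR : 0 < b%:R :> R by rewrite ltr0n.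
have ln20 : 0 < ln 2 :> R by rewrite ln_gt0// ltr1n.
(* [B1] is for the sum of squares and [B2] for the decay. The rate comes from [2^-1 ^+ N] with N
   about (n / b)^(1/d), which is at least n^(1/d) / b. *)
exists K', x, (B1 + B2), (ln 2 / b%:R); split.
- split.
    by apply: bigsetU_compact => c _; exact: compact_polysquare.
  move=> w; rewrite /K' -bigcup_seq => -[c /= cq hw].
  by have [_ h] := hr c; apply: (h (KO _ (qK _ cq))).
- by split; [exact: addr_gt0|exact: divr_gt0].
- by move=> n k F G; have [h _ _ _] := hE (e n).1; exact: h.
- move=> F M hF m.
  have hol c : c \in q -> polysquare_holo (r c) M (fun u => F (c + u)).
    by move=> cq; apply: polysquare_holo_shift => u /(K'P c u cq)/hF.
  have c0 : 0 <= 8 ^+ d * 8 ^+ d * M ^+ 2 by rewrite mulr_ge0 ?sqr_ge0// mulr_ge0// exprn_ge0.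
  have Ybound c al : c \in q -> size al = d ->
     normc (Y c al (fun u => F (c + u))) ^+ 2 <= 8 ^+ d * 8 ^+ d * M ^+ 2 * 2^-1 ^+ sumn al.
    move=> cq sal; have [_ h _ _] := hE c.
    have := h al M _ sal (hol c cq) => {}h.
    have n0 := normc_ge0 (Y c al (fun u => F (c + u))).
    apply: (@le_trans _ _ ((8 ^+ d * 2^-1 ^+ sumn al * M) ^+ 2)).
      by apply: lerXn2r => //; rewrite nnegrE// (le_trans n0).
    have -> : (8 ^+ d * 2^-1 ^+ sumn al * M) ^+ 2 =
       8 ^+ d * 8 ^+ d * M ^+ 2 * (2^-1 ^+ sumn al * 2^-1 ^+ sumn al) :> R by ring.
    apply: ler_wpM2l; first exact: c0.
    by rewrite ger_pMr ?exprn_gt0 ?invr_gt0// exprn_ile1 ?invr_ge0// invf_le1// ler1n.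
  apply: (@le_trans _ _ (\sum_(0 <= n < size (box m)) normc (x n F) ^+ 2)).
    have mb : (m <= size (box m))%N.
      by rewrite sbox (leq_trans (pow_ge m))// leq_pmull.
    rewrite (big_cat_nat (n := m) (p := size (box m)))//= lerDl sumr_ge0// => i _.
    exact: sqr_ge0.
  have -> : \sum_(0 <= n < size (box m)) normc (x n F) ^+ 2 =
     \sum_(t <- box m) normc (Y t.1 t.2 (fun u => F (t.1 + u))) ^+ 2.
    by rewrite -(perm_big _ (he m)) big_map /index_iota subn0.
  rewrite big_allpairs_dep /=.
  apply: (@le_trans _ _ (\sum_(c <- q) (8 ^+ d * 8 ^+ d * M ^+ 2 * 2 ^+ d))).
    rewrite big_seq [leRHS]big_seq; apply: ler_sum => c cq.
    apply: (@le_trans _ _ (\sum_(al <- mbox m d) 8 ^+ d * 8 ^+ d * M ^+ 2 * 2^-1 ^+ sumn al)).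
      rewrite big_seq [leRHS]big_seq; apply: ler_sum => al; rewrite mem_mbox => /andP[/eqP sal _].
      exact: Ybound.
    rewrite -mulr_sumr; apply: ler_wpM2l; last exact: sum_half_mbox.
    exact: c0.
  rewrite big_const_seq count_predT iter_addr_0 -/b -[leLHS]mulr_natl.
  have -> : b%:R * (8 ^+ d * 8 ^+ d * M ^+ 2 * 2 ^+ d) = B1 * M ^+ 2 by rewrite /B1; ring.
  by apply: ler_wpM2r; rewrite ?sqr_ge0// lerDl ltW.
- move=> F n P dF P0 hvan hP z Kz.
  have [c cq zc] := qcov z Kz.
  have cK' : compact K' by apply: bigsetU_compact => c' _; exact: compact_polysquare.
  have [M hM] := compact_normc_bounded cK' dF.
  have hol : polysquare_holo (r c) M (fun u => F (c + u)).
    apply: polysquare_holo_shift => u /(K'P c u cq) h; split; [exact: dF|exact: hM].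
  have [_ _ hH hrem] := hE c.
  (* [N0] will be the largest order whose whole box is enumerated before rank [n], so that its
     functionals all vanish on [F]. *)
  have exP : exists N, (b * N ^ d <= n)%N by exists 0%N; rewrite exp0n// muln0.
  have ubP N : (b * N ^ d <= n)%N -> (N <= n)%N.
    by apply: leq_trans; rewrite (leq_trans (pow_ge N))// leq_pmull.
  case: (ex_maxnP exP ubP) => N0 hN0 maxN0.
  have N0S : (n < b * N0.+1 ^ d)%N.
    by rewrite ltnNge; apply/negP => /maxN0; rewrite ltnn.
  (* The terms in box [N0] vanish, and the others have order at least [N0]. With
     [4^-1 = 2^-1 * 2^-1], one power gives [2^-1 ^+ N0] and the other keeps the sum below [2 ^+ d]
     for every [N]; the remainder disappears as [N] grows. *)
  have main : normc (F z) <= 2^-1 ^+ N0 * 2 ^+ d * P.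
    rewrite -subr_le0; apply: (@le0_geometric _ _ (E c * M)) => N.
    have := hrem M N _ (z - c) hol zc.
    rewrite (addrC c) subrK => hr1; rewrite lerBlDr.
    apply: (@le_trans _ _ (normc (F z - \sum_(al <- mbox N d) H c al (z - c) * Y c al (fun u => F (c + u)))
        + normc (\sum_(al <- mbox N d) H c al (z - c) * Y c al (fun u => F (c + u))))).
      by apply: le_trans (ler_normcD _ _); rewrite subrK.
    apply: lerD; first by rewrite mulrAC.
    apply: le_trans (ler_normc_sum _ _ _) _.
    apply: (@le_trans _ _ (\sum_(al <- mbox N d) 2^-1 ^+ N0 * P * 2^-1 ^+ sumn al)).
      rewrite big_seq [leRHS]big_seq; apply: ler_sum => al hal.
      have sal : size al = d by move: hal; rewrite mem_mbox => /andP[/eqP].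
      have hx : exists i, x i F = Y c al (fun u => F (c + u)).
        by have [i _ ei] := eN N c al cq hal; exists i; rewrite /x ei.
      have rhs0 : 0 <= 2^-1 ^+ N0 * P * 2^-1 ^+ sumn al :> R.
        by rewrite !mulr_ge0// exprn_ge0// invr_ge0.
      have [hal0|hal0] := boolP (al \in mbox N0 d).
        have [i ilt ei] := eN N0 c al cq hal0.
        have : x i F = 0 by apply: hvan; exact: leq_trans ilt hN0.
        by rewrite /x ei /= => ->; rewrite mulr0 ComplexField.Normc.normc0.
      have hs := sumn_notin_mbox sal hal0.
      rewrite normcM.
      have h1 := hH al (z - c) sal zc.
      have h2 : normc (Y c al (fun u => F (c + u))) <= P.
        by case: hx => i <-; exact: hP.
      apply: le_trans (ler_pM (normc_ge0 _) (normc_ge0 _) h1 h2) _.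
      rewrite [leRHS]mulrAC; apply: ler_wpM2r => //.
      have -> : (4^-1 : R) = 2^-1 * 2^-1 by field.
      rewrite exprMn; apply: ler_wpM2r; first by rewrite exprn_ge0// invr_ge0.
      by apply: ler_wiXn2l; rewrite ?invr_ge0// invf_le1// ler1n.
    rewrite -mulr_sumr [leRHS]mulrAC; apply: ler_wpM2l; last exact: sum_half_mbox.
    by rewrite mulr_ge0// exprn_ge0// invr_ge0.
  apply: (le_trans main); apply: ler_wpM2r => //.
  have nr : @nroot R d n.+1 / b%:R <= N0.+1%:R.
    rewrite ler_pdivrMr// nroot_le ?mulr_ge0//.
    rewrite exprMn -!natrX -natrM ler_nat (leq_trans N0S)// mulnC leq_mul2l; apply/orP; right.
    exact: pow_ge.
  have half : (2^-1 : R) ^+ N0.+1 <= expR (- (ln 2 / b%:R * @nroot R d n.+1)).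
    have -> : (2^-1 : R) ^+ N0.+1 = expR (- (ln 2 * N0.+1%:R)).
      by rewrite mulrC expRN expRM_natl lnK ?exprVn// posrE.
    rewrite ler_expR lerN2 -mulrA ler_pM2l// mulrC//.
  rewrite mulrDl; apply: ler_wpDl; first by rewrite mulr_ge0 ?expR_ge0// ltW.
  (* The factor 2 in [B2] pays for the passage from [N0] to [N0.+1]. *)
  have -> : 2^-1 ^+ N0 * 2 ^+ d = B2 * 2^-1 ^+ N0.+1 :> R by rewrite /B2 exprS; field.
  by apply: ler_wpM2l; [exact: ltW|].
Qed.

Section compact_subtype.
Context {X : topologicalType}.
Variable Omega : set X.

Lemma compact_set_val (A : set Omega) : compact A -> compact (set_val @` A).
Proof.
move=> cA; apply: continuous_compact => //; apply: continuous_subspaceT.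
exact: initial_continuous.
Qed.

Lemma compact_preimage_set_val (K : set X) : compact K -> K `<=` Omega ->
  compact (set_val @^-1` K : set Omega).
Proof.
move=> cK KO F FF FA.
have GK : fmap set_val F K by [].
have [z [Kz cz]] := cK _ (fmap_proper_filter set_val FF) GK.
pose z' : Omega := SigSub (mem_set (KO z Kz)).
exists z'; split; first exact: Kz.
move=> S U FS [V [[W oW WV] Vz] VU].
have : (set_val @` S) `&` W !=set0.
  apply: cz.
    by rewrite /fmap /=; apply: filterS FS => s Ss; exists s.
  by apply: open_nbhs_nbhs; split=> //; move: Vz; rewrite -WV.
move=> [_ [[s Ss <-] Ws]]; exists s; split=> //.
by apply: VU; rewrite -WV.
Qed.

End compact_subtype.

(** * The compact-open topology through suprema on compact sets *)

Section holo_topology.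
Context {R : realType} {d : nat}.
Local Notation C := R[i].
Variable Omega : set 'rV[C]_d.
Implicit Types (f g : holo Omega).

Definition extension f : 'rV[C]_d -> C := valL_ 0 f.

Lemma extension_val f (x : Omega) : extension f (set_val x) = f x.
Proof. by have /(congr1 (fun h => h x)) := @valLK _ _ (0 : C) Omega f. Qed.

Lemma differentiable_extension f z : Omega z -> differentiable (extension f) z.
Proof. by have /set_mem hf := valP f; exact: hf. Qed.

Lemma extension_linear (k : C) f g :
  extension (k *: f + g) = (fun z => k * extension f z + extension g z).
Proof.
apply/funext => z; rewrite /extension /=.
by case: ('oinv_set_val z) => //=; rewrite mulr0 addr0.
Qed.

Lemma holo_eq f g : (forall z, Omega z -> extension f z = extension g z) -> f = g.
Proof.
move=> h; apply: val_inj; apply/funext => x /=.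
by rewrite -!extension_val h//; exact: set_valP.
Qed.

(** The filter generated by the sets [B] converges to [f] uniformly on every compact set, hence
    contains every neighbourhood of [f]. *)
Lemma nbhs_holo f (U : set (holo Omega)) : nbhs f U ->
  exists (K : set 'rV[C]_d) (e : R), [/\ compact K, K `<=` Omega, 0 < e &
    forall g, (forall z, K z -> normc (extension g z - extension f z) < e) -> U g].
Proof.
move=> [V [[W oW WV] Vf] VU].
have nW : nbhs (holo_fun f : {family compact, Omega -> C}) W.
  by apply: open_nbhs_nbhs; split=> //; move: Vf; rewrite -WV.
pose D := [set p : set Omega * R | compact p.1 /\ 0 < p.2].
pose B (p : set Omega * R) := [set h : Omega -> C | forall x, p.1 x -> normc (h x - f x) < p.2].
have FF : Filter (filter_from D B).
  apply: filter_from_filter; first by exists (set0, 1); split=> //=; exact: compact0.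
  move=> [A1 e1] [A2 e2] [/= c1 p1] [/= c2 p2].
  exists (A1 `|` A2, Num.min e1 e2); first by split=> /=; [exact: compactU|rewrite lt_min p1].
  move=> h /= hh; split=> x Ax; have := hh x; rewrite lt_min.
    by move=> /(_ (or_introl Ax))/andP[].
  by move=> /(_ (or_intror Ax))/andP[].
have : {family compact, filter_from D B --> (holo_fun f)}.
  apply/fam_cvgP => A cA S /uniform_nbhs[E [entE ES]].
  move: entE; rewrite -entourage_ballE => -[e /= /gt0C[-> e0] eE].
  exists (A, Re e); first by [].
  move=> h hh; apply: ES => x Ax; apply: eE => /=.
  by rewrite /ball /= normcEC ltcR normcB; exact: hh.
move=> /(_ W nW)[[A e] [/= cA e0] hA].
exists (set_val @` A), e; split=> //; first exact: compact_set_val.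
  by move=> _ [x _ <-]; exact: set_valP.
move=> g hg; apply: VU; rewrite -WV /=; apply: hA => x Ax /=.
by rewrite -!extension_val; apply: hg; exists x.
Qed.

Lemma nbhs_holoP f (K : set 'rV[C]_d) (e : R) : compact K -> K `<=` Omega -> 0 < e ->
  nbhs f [set g | forall z, K z -> normc (extension g z - extension f z) < e].
Proof.
move=> cK KO e0.
have cA := compact_preimage_set_val cK KO.
pose Ee : set (C * C) := [set p | normc (p.2 - p.1) < e].
have entE : entourage Ee.
  rewrite -entourage_ballE; exists e%:C => /=; first by rewrite ltcR.
  by move=> [a b]; rewrite /ball /= normcEC ltcR normcB.
have hN := @fam_nbhs Omega C compact _ Ee (holo_fun f) entE cA.
have hN' : nbhs f [set g | forall y, (set_val @^-1` K : set Omega) y -> Ee (f y, g y)].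
  exact: (@initial_continuous (holo Omega) _
    (@holo_fun _ _ Omega : holo Omega -> {family compact, Omega -> C}) f _ hN).
apply: filterS hN' => g /= hg z Kz.
have := hg (SigSub (mem_set (KO z Kz))) Kz.
by rewrite /Ee /= -!extension_val.
Qed.

End holo_topology.

Section bounded_operators.
Context {R : realType} {d : nat}.
Local Notation C := R[i].
Variable Omega : set 'rV[C]_d.
Implicit Types (f g : holo Omega).

Lemma extension0 : extension (0 : holo Omega) = (fun=> 0).
Proof.
by apply/funext => z; rewrite /extension /=; case: ('oinv_set_val z).
Qed.

Lemma extensionZ (k : C) f z : extension (k *: f) z = k * extension f z.
Proof. by rewrite -[k *: f]addr0 extension_linear extension0 addr0. Qed.

Lemma extensionB f g z : extension (f - g) z = extension f z - extension g z.
Proof. by rewrite addrC -scaleN1r extension_linear mulN1r addrC. Qed.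

Lemma holo_compact_bounded (K : set 'rV[C]_d) f : compact K -> K `<=` Omega ->
  exists2 M, 0 < M & forall z, K z -> normc (extension f z) <= M.
Proof.
move=> cK KO.
have [M hM] := compact_normc_bounded cK (fun z Kz => differentiable_extension f (KO z Kz)).
exists (`|M| + 1); first by rewrite ltr_wpDl.
by move=> z /hM h; rewrite (le_trans h)// (le_trans (ler_norm M))// lerDl.
Qed.

Lemma tvs_boundedP (S : set (holo Omega)) : tvs_bounded S <->
  forall K, compact K -> K `<=` Omega ->
    exists M, forall f, S f -> forall z, K z -> normc (extension f z) <= M.
Proof.
split=> [hS K cK KO|hS U].
  have [al al0 hal] := hS _ (nbhs_holoP (0 : holo Omega) cK KO ltr01).
  exists (normc al) => f /hal[u /= hu <-] z Kz.
  have := hu z Kz; rewrite extension0 subr0 extensionZ normcM => h.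
  by rewrite ler_piMr ?normc_ge0// ltW.
move=> /nbhs_holo[K [e [cK KO e0 hU]]].
have [M hM] := hS K cK KO.
pose t := (`|M| + 1) / e.
have M1 : 0 < `|M| + 1 by rewrite ltr_wpDl.
have t0 : 0 < t by rewrite divr_gt0.
have tC : t%:C != 0 by rewrite -normc_eq0 normcR gtr0_norm// gt_eqF.
exists t%:C; first by rewrite ltcR.
move=> f Sf; exists ((t%:C)^-1 *: f); last by rewrite scalerA mulfV// scale1r.
apply: hU => z Kz; rewrite extension0 subr0 extensionZ normcM normcV normcR gtr0_norm//.
rewrite mulrC ltr_pdivrMr// /t mulrCA divff ?gt_eqF// mulr1.
by rewrite (le_lt_trans (hM f Sf z Kz))// (le_lt_trans (ler_norm M))// ltrDl.
Qed.

(** Homogeneity turns the neighbourhood into a bound by a supremum over a compact set. The point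
    [z0] is adjoined to keep this set non-empty, which forces [m] to be nonnegative. *)
Lemma bounded_operatorP (L : {linear holo Omega -> holo Omega}) :
  Omega !=set0 -> bounded_operator L ->
  exists K, [/\ compact K, K `<=` Omega, K !=set0 &
    forall K', compact K' -> K' `<=` Omega -> exists2 B : R, 0 < B &
      forall f m, (forall z, K z -> normc (extension f z) <= m) ->
        forall z, K' z -> normc (extension (L f) z) <= B * m].
Proof.
move=> [z0 Oz0] [U /nbhs_holo[K [e [cK KO e0 hU]]] /tvs_boundedP hL].
exists (K `|` [set z0]); split.
- by apply: compactU => //; exact: compact_set1.
- by move=> z [/KO//|->].
- by exists z0; right.
move=> K' cK' K'O; have [M hM] := hL K' cK' K'O.
have M1 : 0 < `|M| + 1 by rewrite ltr_wpDl.
exists ((`|M| + 1) * (2 / e)); first by rewrite mulr_gt0// divr_gt0.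
move=> f m hf z K'z.
have m0 : 0 <= m by apply: le_trans (hf z0 (or_intror erefl)); exact: normc_ge0.
apply/ler_addgt0Pr => r r0.
(* As [m] may be 0, [f] is rescaled by means of [m + eta]; this [eta] makes the excess equal to
   [r]. *)
pose eta := r / ((`|M| + 1) * (2 / e)).
have eta0 : 0 < eta by rewrite divr_gt0// mulr_gt0// divr_gt0.
pose t := e / (2 * (m + eta)).
have me0 : 0 < m + eta by rewrite ltr_wpDl.
have t0 : 0 < t by rewrite divr_gt0// mulr_gt0.
have Uf : U (t%:C *: f).
  apply: hU => w Kw; rewrite extension0 subr0 extensionZ normcM normcR gtr0_norm//.
  apply: (@le_lt_trans _ _ (t * (m + eta))).
    by rewrite ler_pM2l// (le_trans (hf w (or_introl Kw)))// lerDl ltW.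
  rewrite (_ : t * (m + eta) = e / 2); last by rewrite /t; field; rewrite gt_eqF.
  by rewrite ltr_pdivrMr// ltr_pMr// ltr1n.
have : normc (extension (L (t%:C *: f)) z) <= M by apply: hM => //; exists (t%:C *: f).
rewrite linearZ extensionZ normcM normcR gtr0_norm// mulrC -ler_pdivlMr// => h.
apply: (le_trans h).
have -> : (`|M| + 1) * (2 / e) * m + r = (`|M| + 1) / t.
  have -> : (`|M| + 1) / t = (`|M| + 1) * (2 / e) * (m + eta) by rewrite /t invf_div; ring.
  by rewrite [RHS]mulrDr /eta [_ * (r / _)]mulrC divfK// gt_eqF// mulr_gt0// divr_gt0.
rewrite ler_pM2r ?invr_gt0//; apply: (le_trans (ler_norm M)); rewrite lerDl//.
Qed.

Lemma exp_class_le (u : nat -> C) (K a : R) : 0 < a ->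
  (forall n, normc (u n) <= K * expR (- (a * @nroot R d n.+1))) ->
  exp_class d%:R^-1 u.
Proof.
move=> a0 hu; exists a => //; rewrite /exp_class_at /=.
apply: (@le_lt_trans _ _ K%:E); last exact: ltry.
apply: ge_ereal_sup => _ [n _ <-]; rewrite lee_fin.
rewrite -ler_pdivlMr ?expR_gt0// -expRN; exact: hu.
Qed.

End bounded_operators.

(** * Nuclear expansion and eigenvalue decay of a bounded operator *)

Theorem theorem7p1 (R : realType) (d : nat) (hd : (0 < d)%N)
    (Omega : set 'rV[R[i]]_d) (hOmega : open Omega) (hOmega0 : Omega !=set0)
    (L : {linear holo Omega -> holo Omega}) (hL : bounded_operator L) :
  (exists (s : nat -> R) (f' : nat -> {scalar holo Omega})
      (f : nat -> holo Omega),
    [/\ forall k, 0 < s k,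
        exp_class d%:R^-1 (fun k => (s k)%:C),
        (forall k, continuous (f' k)) /\ equicontinuous setT f',
        tvs_bounded (range f) &
        forall g : holo Omega,
          series (fun k => ((s k)%:C * f' k g) *: f k) @ \oo --> L g]) /\
  ((exists lam : nat -> R[i], eigenvalue_sequence L lam) /\
   (forall lam : nat -> R[i], eigenvalue_sequence L lam -> exp_class d%:R^-1 lam)).
Proof.
have [K [cK KO K0 LK]] := bounded_operatorP hOmega0 hL.
have [K' [X [B [a [[cK' K'O] [B0 a0] X_lin X_bound X_decay]]]]] :=
  compact_expansion hd hOmega cK KO K0.
pose x n (f : holo Omega) := X n (extension f).
have x_lin n k f g : x n (k *: f + g) = k * x n f + x n g.
  by rewrite /x extension_linear X_lin.
have x_partial f M m : (forall z, K' z -> normc (extension f z) <= M) ->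
    series (fun n => normc (x n f) ^+ 2) m <= B * M ^+ 2.
  move=> hM; apply: X_bound => z K'z; split; last exact: hM.
  exact: differentiable_extension (K'O _ K'z).
have x_cvg f : cvgn (series (fun n => normc (x n f) ^+ 2)).
  have [M _ hM] := holo_compact_bounded f cK' K'O.
  apply: nondecreasing_is_cvgn.
    by apply/nondecreasing_seqP => m; rewrite /series/= big_nat_recr//= lerDl sqr_ge0.
  by exists (B * M ^+ 2) => _ [m _ <-]; exact: x_partial.
have sqsum_le f M : (forall z, K' z -> normc (extension f z) <= M) ->
    sqsum x f <= B * M ^+ 2.
  by move=> hM; apply: limr_le => //; apply: nearW => m; exact: x_partial.
have decay f n : vanishing x n f -> forall z, K z ->
    normc (extension f z) <= B * expR (- (a * @nroot R d n.+1)) * Num.sqrt (sqsum x f).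
  move=> hf; apply: X_decay => [z /K'O Oz||//|m].
  - exact: differentiable_extension.
  - exact: sqrtr_ge0.
  - rewrite -[leLHS]ger0_norm ?normc_ge0// -sqrtr_sqr; apply: ler_wsqrtr.
    exact: sqr_x_le.
have [B' B'0 LK'] := LK K' cK' K'O.
pose sg n := expR (- (a * @nroot R d n.+1)).
have sg0 n : 0 < sg n by exact: expR_gt0.
(* [B + 1] stands in for the square root of [B], since [B <= (B + 1) ^+ 2]. *)
pose K1 := (B + 1) * (B' * B).
have K10 : 0 < K1 by rewrite !mulr_gt0// addr_gt0.
have L_small n f : vanishing x n f -> sqsum x (L f) <= (K1 * sg n) ^+ 2 * sqsum x f.
  move=> hf.
  have := sqsum_le (L f) _ (LK' _ _ (decay f n hf)) => /le_trans; apply.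
  rewrite -{2}[sqsum x f]sqr_sqrtr ?sqsum_ge0// -/(sg n).
  have -> : B * (B' * (B * sg n * Num.sqrt (sqsum x f))) ^+ 2 =
    B * ((B' * B * sg n * Num.sqrt (sqsum x f)) ^+ 2) by rewrite !mulrA.
  have -> : (K1 * sg n) ^+ 2 * Num.sqrt (sqsum x f) ^+ 2 =
    (B + 1) ^+ 2 * ((B' * B * sg n * Num.sqrt (sqsum x f)) ^+ 2) by rewrite /K1; ring.
  apply: ler_wpM2r; first exact: sqr_ge0.
  have B00 := ltW B0; nra.
(* By [decay] at rank 0 such an [f] vanishes on [K], and [L f] is controlled by the values on
   [K]. *)
have L_zero f : sqsum x f = 0 -> L f = 0.
  move=> f0; apply: holo_eq => z Oz; rewrite extension0.
  have [B2 B20 LKz] := LK [set z] (@compact_set1 _ z) (fun w (e : w = z) => eq_ind_r Omega Oz e).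
  have hd0 := decay f 0%N (fun m (h : (m < 0)%N) => False_ind _ (notF h)).
  rewrite f0 sqrtr0 mulr0 in hd0.
  have := LKz f 0 hd0 z erefl; rewrite mulr0 => h.
  by apply/eqP; rewrite -normc_eq0 eq_le h normc_ge0.
have [K2 K20 hK2] := fact_prod_stretched hd K10 a0.
pose tau n := K2 * expR (- (a / 8 * @nroot R d n)).
have a8 : 0 < a / 8 by rewrite divr_gt0.
have tau0 n : 0 <= tau n by rewrite mulr_ge0 ?expR_ge0// ltW.
have tau_cvg0 r : 0 < r -> exists N, forall n, (N <= n)%N -> tau n < r.
  by move=> r0; apply: stretched_cvg0 => //; exact: ltW.
have tau_bound (s : seq (holo Omega * R[i])) : triangular_system L s ->
    all (fun p => p.2 != 0) s -> \prod_(p <- s) normc p.2 <= tau (size s) ^+ size s.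
  move=> hs hn0; have [A [hA dA]] := triangular_matrix hs.
  have dA0 : \det A != 0.
    by rewrite dA prodf_seq_neq0; apply/allP => p /(allP hn0) ->.
  rewrite -normc_prod -dA; apply: le_trans (hK2 _).
  apply: (normc_det_le (x := fun n v => x n (lincomb v))).
  - by move=> n k v w; rewrite lincomb_is_linear x_lin.
  - by move=> v; exact: x_cvg.
  (* The seminorm is a norm on the span: [L] kills its null vectors, but is invertible there, its
     determinant being a product of nonzero eigenvalues. *)
  - move=> v /L_zero; rewrite hA => h0.
    have vA0 : v *m A = 0.
      by apply: (lincomb_inj (triangular_free hs)); rewrite h0 linear0.
    have uA : A \in unitmx by rewrite unitmxE unitfE.
    by rewrite -[v](mulmxK uA) vA0 mul0mx.
  - by move=> n; rewrite mulr_ge0 ?expR_ge0// ltW.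
  - move=> n p np; rewrite ler_pM2l// ler_expR lerN2 ler_pM2l//.
    exact: nroot_mono.
  - move=> n v hv; have := L_small n (lincomb v) hv; by rewrite hA.
split; last first.
  split; first exact: (eigenvalue_sequence_exists tau0 tau_cvg0 tau_bound).
  move=> lam hlam; apply: (exp_class_le (K := K2) a8) => n.
  exact: (eigenvalue_sequence_bound tau0 tau_bound).
have [e [c [c_lin e_van rem_bnd c_bnd _]]] := near_orthogonal_basis x_lin x_cvg.
(* [s n] dominates [e n] on [K], so dividing [L (e n)] by it leaves a bounded sequence; it is
   positive even when [e n = 0]. *)
pose s n := B * sg n.
have s0 n : 0 < s n by rewrite mulr_gt0.
have sC n : (s n)%:C != 0 by rewrite -normc_eq0 normcR gtr0_norm// gt_eqF.
have c_scalar n : scalar (c n) by move=> k f g; exact: c_lin.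
pose f' n : {scalar holo Omega} :=
  HB.pack (c n) (GRing.isLinear.Build _ _ _ _ (c n) (c_scalar n)).
pose f n := ((s n)%:C)^-1 *: L (e n).
(* All coefficients are at most [Q] times the supremum over [K'], so one neighbourhood serves every
   [n]: this is equicontinuity. *)
pose Q := Num.sqrt (2 * B).
have cQ n g M : (forall z, K' z -> normc (extension g z) <= M) -> 0 <= M ->
    normc (c n g) <= Q * M.
  move=> hM M0; rewrite -(@ler_pXn2r _ 2)// ?nnegrE ?normc_ge0 ?mulr_ge0 ?sqrtr_ge0//.
  rewrite exprMn sqr_sqrtr; last by rewrite mulr_ge0// ltW.
  by apply: le_trans (c_bnd n g) _; rewrite -mulrA ler_pM2l// sqsum_le.
have Q0 : 0 < Q by rewrite sqrtr_gt0 mulr_gt0.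
have cB n g h : c n (g - h) = c n g - c n h.
  by rewrite addrC -scaleN1r c_lin mulN1r addrC.
have equi g r : 0 < r -> nbhs g [set h | forall n, normc (c n h - c n g) < r].
  move=> r0; apply: filterS (nbhs_holoP g cK' K'O (divr_gt0 r0 (mulr_gt0 Q0 (ltr0n _ 2)))).
  move=> h /= hh n; rewrite -cB.
  apply: (@le_lt_trans _ _ (Q * (r / (Q * 2)))).
    apply: cQ; last by rewrite divr_ge0 ?mulr_ge0// ltW.
    by move=> z /hh/ltW; rewrite extensionB.
  have -> : Q * (r / (Q * 2)) = r / 2 by field; rewrite gt_eqF.
  by rewrite ltr_pdivrMr// ltr_pMr// ltr1n.
have e_small n z : K z -> normc (extension (e n) z) <= s n.
  move=> Kz; have [hv hn] := e_van n.
  apply: le_trans (decay _ _ hv z Kz) _; rewrite -/(sg n) -/(s n).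
  rewrite ler_piMr ?(ltW (s0 n))//.
  case: hn => [->|->]; last by rewrite sqrtr1.
  have -> : sqsum x 0 = 0.
    apply/eqP; rewrite eq_le sqsum_ge0// andbT.
    have := sqsum_le 0 0; rewrite expr0n mulr0; apply => w _.
    by rewrite extension0 ComplexField.Normc.normc0.
  by rewrite sqrtr0.
exists s, f', f; split.
- exact: s0.
- by apply: (exp_class_le (K := B) a0) => n; rewrite normcR gtr0_norm.
- split.
    move=> n g; have FF : Filter (nbhs g) by exact: nbhs_filter.
    apply/(@cvgrPdist_lt R[i] R[i] _ (nbhs g) FF (c n)) => r /gt0C[-> r0].
    apply: filterS (equi g _ r0) => h /= /(_ n).
    by rewrite normcEC ltcR normcB.
  move=> g S; rewrite -entourage_ballE => -[r /= /gt0C[-> r0] rS].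
  apply: filterS (equi g _ r0) => h /= hh n _; apply: rS => /=.
  by rewrite /ball /= normcEC ltcR normcB; exact: hh.
- apply/tvs_boundedP => K3 cK3 K3O; have [B3 B30 LK3] := LK K3 cK3 K3O.
  exists B3 => _ [n _ <-] z K3z.
  have := LK3 _ _ (e_small n) z K3z.
  rewrite /f extensionZ normcM normcV normcR gtr0_norm// => h.
  by rewrite mulrC ler_pdivrMr.
- move=> g U /nbhs_holo[K3 [r [cK3 K3O r0 hU]]].
  have [B3 B30 LK3] := LK K3 cK3 K3O.
  pose P := Num.sqrt (2 * sqsum x g).
  have [N hN] : exists N, forall n, (N <= n)%N ->
      (B3 * B * P + 1) * expR (- (a * @nroot R d n)) < r.
    by apply: stretched_cvg0 => //; rewrite addr_ge0// !mulr_ge0 ?sqrtr_ge0// ltW.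
  exists N => // n /= Nn; apply: hU => z K3z.
  (* The partial sum misses [L g] by [L rm]. As [rm] vanishes to order [n] it is small on [K], so
     [L rm] is small on every compact set. *)
  pose rm := g - \sum_(0 <= k < n) c k g *: e k.
  have serE : series (fun k => ((s k)%:C * f' k g) *: f k) n = L g - L rm.
    rewrite /rm linearB opprB addrC subrK linear_sum /series /=.
    apply: eq_bigr => k _; have -> : L (c k g *: e k) = c k g *: L (e k) by rewrite linearZ.
    by rewrite /f scalerA mulrAC mulfV// mul1r.
  rewrite serE extensionB [_ - _ - _]addrAC subrr sub0r normcN.
  have [hv hs] := rem_bnd n g.
  have hdec := decay _ _ hv.
  apply: le_lt_trans (LK3 _ _ hdec z K3z) _; rewrite -/rm.
  apply: le_lt_trans (hN n.+1 (leqW Nn)).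
  rewrite -/(sg n) mulrA mulrA mulrAC; apply: ler_wpM2r; first exact: ltW.
  apply: (@le_trans _ _ (B3 * B * P)); last by rewrite lerDl.
  apply: ler_wpM2l; first by rewrite mulr_ge0// ltW.
  exact: ler_wsqrtr.
Qed.
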